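(* Let $A,R$ be constants and let $\phi:\mathbb{C}\to\mathbb{R}$ satisfy $|\phi(z)-\phi(t)|\le A|z-t|$ for all $z,t\in\mathbb{C}$ and $\operatorname{supp}(\phi)\subset\{z:|z|\le R\}$. If $P_n(z)=a_n\prod_{k=1}^n(z-\alpha_k)$ is a polynomial of degree $n$ with integer coefficients and simple zeros, then $$\left|\frac1n\sum_{k=1}^n\phi(\alpha_k)-\int\phi\,d\mu\right|\le A(2R+1)\sqrt{\frac{\log\max(n,M(P_n))}{n}},\qquad n\ge 55,$$ where $\mu$ is the normalized arclength measure on the unit circle and $M(P_n)$ is the Mahler measure of $P_n$.
   Context: $A$ and $R$ are positive real numbers. The measure $\mu$ is given by $d\mu(e^{it})=\frac{1}{2\pi}dt$ on $\{|z|=1\}$. The Mahler measure is $M(P_n):=\exp\left(\frac{1}{2\pi}\int_0^{2\pi}\log|P_n(e^{it})|\,dt\right)$, which by Jensen's formula equals $|a_n|\prod_{k=1}^n\max(1,|\alpha_k|)$. The zeros $\alpha_k\in\mathbb{C}$ are not assumed to lie in the unit disk. *)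

(* Defs.v *)
From HB Require Import structures.
From mathcomp Require Import all_boot all_order all_algebra.
From mathcomp Require Export complex.
From mathcomp Require Import all_classical all_reals all_analysis.
Import Order.TTheory GRing.Theory Num.Theory.
Import numFieldNormedType.Exports.
Import ComplexField.Normc.

Set Implicit Arguments.
Unset Strict Implicit.
Unset Printing Implicit Defensive.

Local Open Scope classical_set_scope.
Local Open Scope ring_scope.

(* The complex plane is [R[i]]. The regular-algebra alias [R[i]^o] carries the
   topology of the modulus. The modulus itself is taken real-valued, as
   [normc z : R] rather than [`|z| : R[i]]. *)

Definition expi (R : realType) (t : R) : R[i] := Complex (cos t) (sin t).

Definition supp (R : realType) (phi : R[i] -> R) : set R[i] :=
  closure ([set z | phi z != 0] : set R[i]^o).

Definition borelC (R : realType) :=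
  g_sigma_algebraType (@open R[i]^o : set (set R[i]^o)).

Lemma twopi_gt0 (R : realType) : 0 < 2 * pi :> R.
Proof. by rewrite mulr_gt0// pi_gt0. Qed.

Lemma normc_le_add (R : realType) (a b : R) :
  normc (Complex a b) <= `|a| + `|b|.
Proof.
rewrite /normc -[leRHS]ger0_norm ?addr_ge0// -sqrtr_sqr ler_wsqrtr//.
rewrite sqrrD !real_normK ?num_real// lerD2r lerDl.
by rewrite mulrn_wge0// mulr_ge0.
Qed.

Lemma open_preimage_expi (R : realType) (U : set R[i]^o) :
  open U -> open (@expi R @^-1` U).
Proof.
move=> oU; rewrite openE => t Ut.
have /nbhs_ballP[e /= e0 eU] : nbhs (expi t : R[i]^o) U.
  exact: open_nbhs_nbhs.
have [r r0 er] : exists2 r : R, 0 < r & e = (r%:C)%C.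
  case: e e0 {eU} => a b; rewrite ltcE /= => /andP[/eqP -> a0].
  by exists a.
have r20 : 0 < r / 2 by rewrite divr_gt0.
have Hc : \forall s \near t, `|cos t - cos s| < r / 2.
  by have /cvgrPdist_lt/(_ _ r20) := @continuous_cos R t.
have Hs : \forall s \near t, `|sin t - sin s| < r / 2.
  by have /cvgrPdist_lt/(_ _ r20) := @continuous_sin R t.
rewrite /interior /=; near=> s.
apply: eU; rewrite /ball /= er normc_def ltcR.
apply: (le_lt_trans (normc_le_add (cos t - cos s) (sin t - sin s))).
rewrite [ltRHS]splitr ltrD//; near: s; assumption.
Unshelve. all: by end_near.
Qed.

Lemma measurable_expi (R : realType) :
  @measurable_fun _ _ (measurableTypeR R) (borelC R) setT (@expi R).
Proof.
apply: (@measurability _ _ (measurableTypeR R) (borelC R) setT (@expi R)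
  (@open R[i]^o)) => //.
move=> _ [U oU <-]; rewrite setTI.
by apply: measurable_realfun.open_measurable; exact: open_preimage_expi.
Qed.

(* dt/(2pi) on [0, 2pi], transported to the plane by t |-> e^{it} *)
Definition arclength (R : realType) : set (borelC R) -> \bar R :=
  @pushforward _ _ (measurableTypeR R) (borelC R) R
    (uniform_prob (twopi_gt0 R)) (@expi R).
Arguments arclength : clear implicits.

Section arclength_measure.
Context (R : realType).

Let arclength0 : arclength R set0 = 0%E.
Proof. by rewrite /arclength /pushforward preimage_set0 measure0. Qed.

Let arclength_ge0 A : (0 <= arclength R A)%E.
Proof. by rewrite /arclength /pushforward; apply: measure_ge0. Qed.

Let arclength_sigma_additive : semi_sigma_additive (arclength R).
Proof.
have mX (A : set (borelC R)) : measurable A ->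
    measurable (@expi R @^-1` A : set (measurableTypeR R)).
  by move=> mA; rewrite -[X in measurable X]setTI; exact: measurable_expi.
move=> F mF tF mUF; rewrite /arclength /pushforward preimage_bigcup.
apply: measure_semi_sigma_additive.
- by move=> n; exact: mX.
- apply/trivIsetP => /= i j _ _ ij; rewrite -preimage_setI.
  by move/trivIsetP : tF => /(_ _ _ _ _ ij) ->//; rewrite preimage_set0.
- by rewrite -preimage_bigcup; exact: mX.
Qed.

HB.instance Definition _ := isMeasure.Build _ _ _ (arclength R)
  arclength0 arclength_ge0 arclength_sigma_additive.

Let arclength_setT : arclength R setT = 1%E.
Proof. by rewrite /arclength /pushforward preimage_setT probability_setT. Qed.

HB.instance Definition _ :=
  Measure_isProbability.Build _ _ _ (arclength R) arclength_setT.

End arclength_measure.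

(* [ln 0 = 0] here; this matters only at the finitely many t such that e^{it}
   is a zero of [P]. *)
Definition mahler (R : realType) (P : {poly R[i]}) : R :=
  expR ((2 * pi)^-1 *
        \int[lebesgue_measure]_(t in `[0, 2 * pi]) ln (normc P.[expi t])).

(* Main.v *)
Require Import Defs.
From mathcomp Require Import all_boot all_order all_algebra.
From mathcomp Require Import all_classical all_reals all_analysis.
From mathcomp Require Import ring lra zify measurable_realfun.
Import Order.TTheory GRing.Theory Num.Theory.
Import numFieldNormedType.Exports.
Import ComplexField.Normc.
Local Open Scope classical_set_scope.
Local Open Scope ring_scope.

(** Let [sigma] be the normalized zero-counting measure minus arclength, a
   measure of total mass 0. By duality, [|int phi dsigma|^2] is at most the
   Dirichlet integral of [phi], which is of order [A^2 r^2], times the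
   logarithmic energy of [sigma]. Point masses have infinite energy, so they are
   smoothed angularly: testing against the Fejer means of order [2 n] of [phi]
   costs [A r / sqrt n], and only damps the [m]th Fourier mode of [sigma] by
   [(1 - m / (2 n)) ^ 2 <= q ^ m] with [q = n / (n + 1)]. The damped energy is at
   most [- n^-2 sum_(j != k) ln |alpha_j - alpha_k| + 2 n^-1 sum_k ln^+ |alpha_k|
   - n^-2 sum_k ln |alpha_k| + O(ln n / n)]. Since the discriminant and the
   product of the nonzero roots, cleared of denominators by powers of the leading
   coefficient, are nonzero integers, Jensen's formula bounds this by
   [(2 ln M + ln (n + 1) + O(1)) / n].

   The duality is carried out on a polar lattice with [N] angles and radii in
   geometric progression of ratio [exp (17/10 * 2 pi / N)]; there the Dirichlet
   integral is replaced by sums of squared differences along the sides of small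
   triangles, and [N] tends to infinity. *)

(** * Integer lower bounds for discriminants and products of roots *)

(** [phi] is only Lipschitz, so differences along chords replace its gradient, and bounding each
    chord separately overestimates the Dirichlet integral. On a square grid both increments could be
    extremal at once, a loss of a factor 2. Around a triangle the increments sum to zero, so their
    squares sum to at most [2 L^2], against [3/2 L^2] for a linear function of slope 1 on an
    equilateral triangle of side [L]: the loss is 4/3. A base of two angular steps and a height of
    17/10 steps make the triangles nearly equilateral; staying below [sqrt 3] leaves room for
    higher-order terms. The Dirichlet factor becomes [2 / (17/10)^2 = 200/289].

    Let [s] be the square root in the theorem. The energy is at most [157/50 s^2], so duality gives
    [37/25 A r s]; Fejer smoothing gives [13/25 A r s]. These add up to [2 A r s], and the remaining
    [A s] pays for a possible root at the origin.

    The limits do not commute: only the kernel cut off at [M] modes is Lipschitz in the logarithms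
    of the radii, so the lattice is refined with [M] fixed, and [M] tends to infinity afterwards. *)

Lemma horner_prod_XsubC_rem (F : comNzRingType) n (alpha : 'I_n -> F) (k : 'I_n) :
  (\prod_(j < n) ('X - (alpha j)%:P))^`().[alpha k] =
  \prod_(j < n | j != k) (alpha k - alpha j).
Proof.
rewrite (bigD1 k)//= derivM hornerD !hornerM derivXsubC hornerC mul1r.
rewrite hornerXsubC subrr mul0r addr0 horner_prod.
by apply: eq_bigr => j _; rewrite hornerXsubC.
Qed.

(* The Sylvester matrix times the matrix whose columns evaluate at the roots
   of [p] or read off one of the top [d] coefficients. *)
Lemma lead_coef_prod_horner_int (F : fieldType) n d (p s : {poly int})
    (alpha : 'I_n -> F) :
  size p = n.+1 -> (size s <= d.+1)%N -> injective alpha ->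
  (forall k, root (map_poly intr p) (alpha k)) ->
  exists z : int, (lead_coef p)%:~R ^+ d *
     \prod_(k < n) (map_poly intr s).[alpha k] = z%:~R.
Proof.
move=> szp szs inja rootp.
pose S : 'M[int]_(n + d, n + d) :=
  col_mx (\matrix_(j < n, c < n + d) ('X^j * s)`_c)
         (\matrix_(j < d, c < n + d) ('X^j * p)`_c).
pose f : {rmorphism int -> F} := intr.
exists (\det S).
pose V : 'M[F]_n := \matrix_(c < n, k < n) alpha k ^+ c.
pose V' : 'M[F]_(d, n) := \matrix_(c < d, k < n) alpha k ^+ (n + c).
pose W : 'M[F]_(n + d) := block_mx V 0 V' 1%:M.
have detW : \det W = \det V by rewrite det_lblock det1 mulr1.
have detV : \det V != 0.
  have -> : V = Vandermonde n (\row_k alpha k).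
    by apply/matrixP => i j; rewrite !mxE.
  rewrite det_Vandermonde; apply/prodf_neq0 => i _; apply/prodf_neq0 => j ij.
  rewrite !mxE subr_eq0; apply/eqP => /inja ji.
  by rewrite ji ltnn in ij.
pose D : 'rV[F]_n := \row_k (map_poly intr s).[alpha k].
pose U : 'M[F]_d := \matrix_(i < d, l < d) (('X^i * p)`_(n + l))%:~R.
have eval (t : {poly int}) (x : F) : (size t <= n + d)%N ->
    \sum_(c < n + d) (t`_c)%:~R * x ^+ c = (map_poly intr t).[x].
  move=> st; rewrite (@horner_coef_wide _ (n + d)); last first.
    by apply: leq_trans st; rewrite size_poly.
  by apply: eq_bigr => c _; rewrite coef_map.
(* Rows made from [p] vanish at the roots, hence the zero block. The nonzero Vandermonde determinant
   [\det V] then cancels from both sides. *)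
have SW : exists B, map_mx intr S *m W = block_mx (V *m diag_mx D) B 0 U.
  exists (\matrix_(i < n, l < d) (('X^i * s)`_(n + l))%:~R).
  have low m (M : 'M[int]_(m, n + d)) (i : 'I_m) (k : 'I_n) :
      (map_mx f M *m col_mx V V') i k =
      \sum_(c < n + d) (M i c)%:~R * alpha k ^+ c.
    rewrite !mxE; apply: eq_bigr => c _; rewrite !mxE; congr (_ * _).
    by case: splitP => j ->; rewrite !mxE.
  have high m (M : 'M[int]_(m, n + d)) (i : 'I_m) (l : 'I_d) :
      (map_mx f M *m col_mx 0 1%:M) i l = (M i (rshift n l))%:~R.
    rewrite !mxE big_split_ord /= big1 ?add0r; last first.
      by move=> c _; rewrite col_mxEu !mxE mulr0.
    rewrite (bigD1 l)//= col_mxEd !mxE eqxx mulr1 big1 ?addr0// => c cl.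
    by rewrite col_mxEd !mxE (negbTE cl) mulr0.
  have -> : W = row_mx (col_mx V V') (col_mx 0 1%:M).
    by rewrite /W block_mxEh.
  rewrite mul_mx_row /S map_col_mx !mul_col_mx -block_mxEh.
  congr block_mx; apply/matrixP => i k.
  - rewrite low (mul_mx_diag V) !mxE.
    under eq_bigr => c _ do rewrite mxE.
    rewrite eval; last first.
      apply: (leq_trans (size_polyMleq _ _)); rewrite size_polyXn /=.
      by have := ltn_ord i; clear -szs; move: (size s) szs => m; lia.
    by rewrite (rmorphM (map_poly f)) /= map_polyXn hornerM hornerXn.
  - by rewrite high !mxE.
  - rewrite low mxE.
    under eq_bigr => c _ do rewrite mxE.
    rewrite eval; last first.
      apply: (leq_trans (size_polyMleq _ _)); rewrite size_polyXn szp /=.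
      by have := ltn_ord i; clear; lia.
    by rewrite (rmorphM (map_poly f)) hornerM; have /eqP -> := rootp k;
      rewrite mulr0.
  - by rewrite high !mxE.
have detU : \det U = (lead_coef p)%:~R ^+ d.
  rewrite det_trig; last first.
    apply/is_trig_mxP => i l il; rewrite !mxE coefXnM ifN; last by lia.
    rewrite nth_default// szp; lia.
  under eq_bigr => i _.
    rewrite !mxE coefXnM ifN; last by lia.
    rewrite addnK; over.
  by rewrite big_const_ord iter_mulr_1 lead_coefE szp.
have [B SWB] := SW.
have : \det (map_mx f S *m W) = \det (block_mx (V *m diag_mx D) B 0 U).
  by congr (\det _); exact: SWB.
rewrite det_mulmx det_map_mx detW det_ublock det_mulmx det_diag detU.
rewrite mulrC -mulrA => /(mulfI detV) ->.
by rewrite mulrC; congr (_ * _); apply: eq_bigr => k _; rewrite mxE.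
Qed.

Section integer_bounds.
Context {R : realType}.
Implicit Types (x : R) (z : R[i]).

Lemma normc_real x : normc x%:C%C = `|x|.
Proof. by rewrite /normc /= expr0n addr0 sqrtr_sqr. Qed.

Lemma normc_int_ge1 (m : int) : m != 0 -> 1 <= normc (m%:~R : R[i]).
Proof.
move=> m0; have -> : m%:~R = (m%:~R : R)%:C%C by rewrite rmorph_int.
rewrite normc_real -intr_norm (_ : 1 = 1%:~R)// ler_int.
by rewrite -gtz0_ge1 normr_gt0.
Qed.

Lemma normc_prod (I : finType) (P : pred I) (F : I -> R[i]) :
  normc (\prod_(i | P i) F i) = \prod_(i | P i) normc (F i).
Proof.
by apply: (big_morph (@normc R)); [exact: normcM|exact: normc1].
Qed.

Lemma normcX z m : normc (z ^+ m) = normc z ^+ m.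
Proof. by elim: m => [|m ih]; rewrite ?normc1// !exprS normcM ih. Qed.

Lemma normc_neq0 z : (normc z != 0) = (z != 0).
Proof.
apply/idP/idP; apply: contraNN => /eqP; last by move=> /eq0_normc ->.
by move=> ->; rewrite normc0.
Qed.

Lemma normc_ge0 z : 0 <= normc z.
Proof. by case: z => a b; rewrite /normc sqrtr_ge0. Qed.

Context {n : nat} {p : {poly int}} {alpha : 'I_n -> R[i]}.
Context (p_deg : size p = n.+1)
  (p_zeros : map_poly intr p =
     (lead_coef p)%:~R *: \prod_(k < n) ('X - (alpha k)%:P))
  (p_simple : injective alpha).

Let a : R := normc ((lead_coef p)%:~R : R[i]).

Let lead_neq0 : lead_coef p != 0.
Proof. by rewrite lead_coef_eq0 -size_poly_eq0 p_deg. Qed.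

Lemma lead_coef_normc_ge1 : 1 <= a.
Proof. exact: normc_int_ge1. Qed.

Let P'alpha k : (map_poly intr p^`()).[alpha k] =
  (lead_coef p)%:~R * \prod_(j < n | j != k) (alpha k - alpha j).
Proof.
by rewrite -deriv_map p_zeros derivZ hornerZ horner_prod_XsubC_rem.
Qed.

(** The resultant of [p] and its derivative, a nonzero integer because the roots are distinct:
    [n - 1] factors [a] come from the resultant and [n] from the values of the derivative at the
    roots. *)
Lemma discriminant_ge1 : (0 < n)%N ->
  1 <= a ^+ (2 * n - 1) *
       \prod_(k < n) \prod_(j < n | j != k) normc (alpha k - alpha j).
Proof.
move=> n0.
have [|k|m Em] := @lead_coef_prod_horner_int _ n n.-1 p p^`() alpha p_deg
  _ p_simple.
- by rewrite prednK// (leq_trans (size_poly _ _))// p_deg.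
- rewrite p_zeros /root hornerZ horner_prod (bigD1 k)//= hornerXsubC subrr.
  by rewrite mul0r mulr0.
have Em' : (lead_coef p)%:~R ^+ (2 * n - 1) *
    \prod_(k < n) \prod_(j < n | j != k) (alpha k - alpha j) = m%:~R.
  rewrite -Em; under [in RHS]eq_bigr do rewrite P'alpha.
  rewrite big_split /= big_const_ord iter_mulr_1 mulrA -exprD.
  by congr (_ ^+ _ * _); lia.
have m0 : m != 0.
  apply/eqP => m0; move: Em'; rewrite m0 => /eqP.
  apply/negP; rewrite mulf_neq0// ?expf_neq0 ?intr_eq0//.
  apply/prodf_neq0 => k _; apply/prodf_neq0 => j jk.
  by rewrite subr_eq0; apply: contraNneq jk => /p_simple ->.
have := normc_int_ge1 _ m0; rewrite -Em' normcM normcX normc_prod.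
by under eq_bigr do rewrite normc_prod.
Qed.

(** Up to sign the left side is the lowest nonzero coefficient of [p]: the constant term, or the
    constant term of the derivative when 0 is a root, necessarily simple. *)
Lemma prod_nonzero_roots_ge1 :
  1 <= a * \prod_(k < n | alpha k != 0) normc (alpha k).
Proof.
have [/existsP[k0 /eqP a0]|/existsPn a0] := boolP [exists k, alpha k == 0].
- have H := P'alpha k0; move: H; rewrite a0 horner_coef0 coef_map /= => H.
  have E : a * \prod_(k < n | alpha k != 0) normc (alpha k) =
           normc ((p^`()`_0)%:~R : R[i]).
    rewrite H normcM normc_prod; congr (_ * _).
    under [RHS]eq_bigr do rewrite sub0r normcN.
    by apply: eq_bigl => k; rewrite -a0 (inj_eq p_simple).
  rewrite E; apply: normc_int_ge1.
  rewrite -(intr_eq0 R[i]) H mulf_neq0// ?intr_eq0//.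
  apply/prodf_neq0 => j jk.
  by rewrite subr_eq0 -a0; apply: contraNneq jk => /p_simple ->.
- have H : (p`_0)%:~R = (lead_coef p)%:~R * \prod_(k < n) (- alpha k) :> R[i].
    rewrite -(@coef_map _ _ (intr : {rmorphism int -> R[i]})) p_zeros coefZ.
    congr (_ * _); rewrite -horner_coef0 horner_prod.
    by apply: eq_bigr => k _; rewrite hornerXsubC sub0r.
  have E : a * \prod_(k < n | alpha k != 0) normc (alpha k) =
           normc ((p`_0)%:~R : R[i]).
    rewrite H normcM normc_prod; congr (_ * _).
    under [RHS]eq_bigr do rewrite normcN.
    by apply: eq_bigl => k; rewrite a0.
  rewrite E; apply: normc_int_ge1.
  rewrite -(intr_eq0 R[i]) H mulf_neq0// ?intr_eq0//.
  by apply/prodf_neq0 => j jk; rewrite oppr_eq0 a0.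
Qed.

End integer_bounds.

(** * Fourier coefficients of samples on a circle *)

Section discrete_fourier.
Context {R : realType}.
Implicit Types (N H m l j : nat) (x y : R) (v w : nat -> R).

Definition ang N : R := 2 * pi / N%:R.

Definition mean N v : R := N%:R^-1 * \sum_(j < N) v j.

Definition cosc N v m : R := mean N (fun j => v j * cos (m%:R * (ang N * j%:R))).
Definition sinc N v m : R := mean N (fun j => v j * sin (m%:R * (ang N * j%:R))).

Lemma cos_addn2pi x m : cos (x + 2 * pi * m%:R) = cos x.
Proof.
by rewrite (_ : 2 * pi * _ = pi *+ 2 *+ m);
  [exact: (periodicn (@cosD2pi R))|rewrite -mulr_natr -(mulr_natr pi); ring].
Qed.

Lemma sin_addn2pi x m : sin (x + 2 * pi * m%:R) = sin x.
Proof.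
by rewrite (_ : 2 * pi * _ = pi *+ 2 *+ m);
  [exact: (periodicn (@sinD2pi R))|rewrite -mulr_natr -(mulr_natr pi); ring].
Qed.

Lemma eq_mean N v w : (forall j, v j = w j) -> mean N v = mean N w.
Proof. by move=> vw; congr (_ * _); apply: eq_bigr => j _; exact: vw. Qed.

Lemma meanD N v w : mean N (fun j => v j + w j) = mean N v + mean N w.
Proof. by rewrite /mean big_split mulrDr. Qed.

Lemma meanZ N x v : mean N (fun j => x * v j) = x * mean N v.
Proof. by rewrite /mean -mulr_sumr mulrCA. Qed.

Lemma meanB N v w : mean N (fun j => v j - w j) = mean N v - mean N w.
Proof. by rewrite /mean sumrB mulrBr. Qed.

Lemma mean_sum (I : finType) (P : pred I) N (F : I -> nat -> R) :
  mean N (fun j => \sum_(i | P i) F i j) = \sum_(i | P i) mean N (F i).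
Proof. by rewrite /mean exchange_big mulr_sumr. Qed.

Lemma ler_mean N v w : (forall j, v j <= w j) -> mean N v <= mean N w.
Proof.
by move=> vw; rewrite /mean ler_wpM2l ?invr_ge0// ler_sum// => j _; exact: vw.
Qed.

Lemma mean_cst N x : (0 < N)%N -> mean N (fun=> x) = x.
Proof.
move=> N0; rewrite /mean sumr_const card_ord -[x *+ N]mulr_natl mulrA mulVf ?mul1r//.
by rewrite pnatr_eq0 -lt0n.
Qed.

Lemma ler_norm_mean N v : `|mean N v| <= mean N (fun j => `|v j|).
Proof.
by rewrite /mean normrM ger0_norm ?invr_ge0// ler_wpM2l ?invr_ge0// ler_norm_sum.
Qed.

Lemma mean_shift N l v : (forall j, v (j + N)%N = v j) ->
  mean N (fun j => v (j + l)%N) = mean N v.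
Proof.
case: N => [|N] vp; first by rewrite /mean !big_ord0.
elim: l => [|l ih]; first by apply: eq_mean => j; rewrite addn0.
rewrite -ih /mean; congr (_ * _).
rewrite big_ord_recr [RHS]big_ord_recl /= addrC; congr (_ + _).
  by rewrite -[RHS]vp; congr v; rewrite addnS add0n addnS addnC.
by apply: eq_bigr => j _; rewrite /bump leq0n add1n addSnnS.
Qed.

Lemma angM N m : (0 < N)%N -> m%:R * (ang N * N%:R) = 2 * pi * m%:R.
Proof.
by move=> N0; rewrite /ang divfK ?pnatr_eq0 -?lt0n// mulrC.
Qed.

Lemma ang_gt0 N : (0 < N)%N -> 0 < ang N.
Proof. by move=> N0; rewrite divr_gt0 ?mulr_gt0 ?pi_gt0 ?ltr0n. Qed.

Lemma cos_ang_period N m j : (0 < N)%N ->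
  cos (m%:R * (ang N * (j + N)%:R)) = cos (m%:R * (ang N * j%:R)).
Proof. by move=> N0; rewrite natrD !mulrDr angM// cos_addn2pi. Qed.

Lemma sin_ang_period N m j : (0 < N)%N ->
  sin (m%:R * (ang N * (j + N)%:R)) = sin (m%:R * (ang N * j%:R)).
Proof. by move=> N0; rewrite natrD !mulrDr angM// sin_addn2pi. Qed.

(** Multiplied by [2 sin (x / 2)] both sums telescope, and [N] steps make a whole number of turns.
    The factor is nonzero because [0 < l < N]. *)
Lemma mean_cos_sin N l : (0 < l < N)%N ->
  mean N (fun j => cos (l%:R * (ang N * j%:R))) = 0 /\
  mean N (fun j => sin (l%:R * (ang N * j%:R))) = 0.
Proof.
move=> /andP[l0 lN]; have N0 : (0 < N)%N by exact: ltn_trans lN.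
set x := l%:R * ang N.
have xN : x * N%:R = 2 * pi * l%:R by rewrite /x -mulrA angM.
have s0 : sin (x / 2) != 0.
  rewrite gt_eqF// sin_gt0_pi//; apply/andP; split.
    by rewrite divr_gt0// mulr_gt0 ?ang_gt0 ?ltr0n.
  have -> : x / 2 = pi * (l%:R / N%:R) by rewrite /x /ang; field; rewrite pnatr_eq0 -lt0n.
  by rewrite gtr_pMr ?pi_gt0// ltr_pdivrMr ?ltr0n// mul1r ltr_nat.
pose C k := \sum_(j < k) cos (l%:R * (ang N * j%:R)).
pose S k := \sum_(j < k) sin (l%:R * (ang N * j%:R)).
have CE k : 2 * sin (x / 2) * C k = sin (x * k%:R - x / 2) + sin (x / 2).
  elim: k => [|k ih]; first by rewrite /C big_ord0 !mulr0 sub0r sinN addNr.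
  rewrite /C big_ord_recr /= mulrDr ih (mulrA l%:R) -/x.
  rewrite -[k.+1%:R]natr1 (_ : x * (k%:R + 1) - x / 2 = x * k%:R + x / 2); last by field.
  by rewrite !(sinD, sinN, cosN); ring.
have SE k : 2 * sin (x / 2) * S k = cos (x / 2) - cos (x * k%:R - x / 2).
  elim: k => [|k ih]; first by rewrite /S big_ord0 !mulr0 sub0r cosN subrr.
  rewrite /S big_ord_recr /= mulrDr ih (mulrA l%:R) -/x.
  rewrite -[k.+1%:R]natr1 (_ : x * (k%:R + 1) - x / 2 = x * k%:R + x / 2); last by field.
  by rewrite !(cosD, sinN, cosN); ring.
have nz : 2 * sin (x / 2) != 0 by rewrite mulf_neq0.
rewrite /mean -/(C N) -/(S N); split.
  rewrite (_ : C N = 0) ?mulr0//; apply: (mulfI nz).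
  by rewrite CE xN (addrC (2 * pi * _)) sin_addn2pi sinN addNr mulr0.
rewrite (_ : S N = 0) ?mulr0//; apply: (mulfI nz).
by rewrite SE xN (addrC (2 * pi * _)) cos_addn2pi cosN subrr mulr0.
Qed.

Lemma mean_cos_shift N l x : (0 < l < N)%N ->
  mean N (fun j => cos (l%:R * (x - ang N * j%:R))) = 0.
Proof.
move=> lN; have [C0 S0] := mean_cos_sin N l lN.
under eq_mean => j do rewrite mulrBr cosB.
by rewrite meanD !meanZ C0 S0 !mulr0 addr0.
Qed.

Lemma cos_cos x y : cos x * cos y = 2^-1 * (cos (x + y) + cos (x - y)).
Proof. by rewrite !(cosD, sinN, cosN); field. Qed.

Lemma sin_sin x y : sin x * sin y = 2^-1 * (cos (x - y) - cos (x + y)).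
Proof. by rewrite !(cosD, sinN, cosN); field. Qed.

Lemma sin_cos x y : sin x * cos y = 2^-1 * (sin (x + y) + sin (x - y)).
Proof. by rewrite !(sinD, sinN, cosN); field. Qed.

Definition dirac0 (b : bool) : R := if b then 1 else 0.

Lemma mean_cosB N m l : (0 < N)%N -> (m < N)%N -> (l < N)%N ->
  mean N (fun j => cos (m%:R * (ang N * j%:R) - l%:R * (ang N * j%:R))) =
    dirac0 (m == l) /\
  mean N (fun j => sin (m%:R * (ang N * j%:R) - l%:R * (ang N * j%:R))) = 0.
Proof.
move=> N0 mN lN; have [->|ml] := eqVneq m l.
  under eq_mean => j do rewrite subrr cos0.
  rewrite mean_cst//; split=> //; under eq_mean => j do rewrite subrr sin0.
  by rewrite mean_cst.
case: (ltngtP m l) ml => // ml _.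
  have [|C0 S0] := mean_cos_sin N (l - m); first lia.
  have E j : m%:R * (ang N * j%:R) - l%:R * (ang N * j%:R) =
             - ((l - m)%:R * (ang N * j%:R)) by rewrite natrB ?(ltnW ml)//; ring.
  under eq_mean => j do rewrite E cosN; rewrite C0; split=> //.
  by under eq_mean => j do rewrite E sinN -mulN1r; rewrite meanZ S0 mulr0.
have [|C0 S0] := mean_cos_sin N (m - l); first lia.
have E j : m%:R * (ang N * j%:R) - l%:R * (ang N * j%:R) =
           (m - l)%:R * (ang N * j%:R) by rewrite natrB ?(ltnW ml)//; ring.
by split; under eq_mean => j do rewrite E.
Qed.

Lemma mean_cosD N m l : (0 < N)%N -> (m + l < N)%N ->
  mean N (fun j => cos (m%:R * (ang N * j%:R) + l%:R * (ang N * j%:R))) =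
    dirac0 ((m + l)%N == 0%N) /\
  mean N (fun j => sin (m%:R * (ang N * j%:R) + l%:R * (ang N * j%:R))) = 0.
Proof.
move=> N0 mlN.
have E j : m%:R * (ang N * j%:R) + l%:R * (ang N * j%:R) =
           (m + l)%:R * (ang N * j%:R) by rewrite natrD; ring.
have [ml0|ml0] := eqVneq (m + l)%N 0%N.
  split; under eq_mean => j do rewrite E ml0 mul0r ?cos0 ?sin0.
    by rewrite mean_cst.
  by rewrite mean_cst.
have [|C0 S0] := mean_cos_sin N (m + l); first lia.
by split; under eq_mean => j do rewrite E.
Qed.

(* The modes [-m] and [m] of a real sequence are conjugate, hence the
   weight 2. *)
Definition wt m : R := if m == 0%N then 1 else 2.

Lemma wt_ge0 m : 0 <= wt m.
Proof. by rewrite /wt; case: ifP. Qed.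

(** Expands the mean of [(v - S)^2 >= 0], where [S] is the projection of [v] onto the modes below
    [H]. As [2 H <= N], sums of two such modes stay below [N], so there is no aliasing. *)
Lemma bessel N H v : (0 < H)%N -> (2 * H <= N)%N ->
  \sum_(m < H) wt m * (cosc N v m ^+ 2 + sinc N v m ^+ 2) <=
  mean N (fun j => v j ^+ 2).
Proof.
move=> H0 HN; have N0 : (0 < N)%N by lia.
pose c m j := cos (m%:R * (ang N * j%:R)).
pose s m j := sin (m%:R * (ang N * j%:R)).
pose S j := \sum_(m < H) wt m * (cosc N v m * c m j + sinc N v m * s m j).
set B := \sum_(m < H) _.
have sin0 : sinc N v 0 = 0.
  rewrite /sinc; under eq_mean => j do rewrite mul0r sin0 mulr0.
  by rewrite mean_cst.
(* The sine of mode 0 vanishes identically, which accounts for the condition [m != 0] in the second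
   relation. *)
have orth m l : (m < H)%N -> (l < H)%N ->
  [/\ mean N (fun j => c m j * c l j) * wt m = dirac0 (m == l),
      mean N (fun j => s m j * s l j) * wt m = dirac0 ((m == l) && (m != 0%N)),
      mean N (fun j => c m j * s l j) = 0 & mean N (fun j => s m j * c l j) = 0].
  move=> mH lH.
  have [CD SD] := mean_cosD N m l N0 ltac:(lia).
  have [CB SB] := mean_cosB N m l N0 ltac:(lia) ltac:(lia).
  have [CD' SD'] := mean_cosD N l m N0 ltac:(lia).
  have [CB' SB'] := mean_cosB N l m N0 ltac:(lia) ltac:(lia).
  split.
  - under eq_mean => j do rewrite cos_cos.
    rewrite meanZ meanD CD CB /wt /dirac0 addn_eq0.
    case: (eqVneq m l) => [<-|ml]; case: (eqVneq m 0%N) => //= [m0|m0]; last by field.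
    - by field.
    - by field.
    - by rewrite ifN; [field|rewrite -m0 eq_sym].
  - under eq_mean => j do rewrite sin_sin.
    rewrite meanZ meanB CD CB /wt /dirac0 addn_eq0.
    case: (eqVneq m l) => [<-|ml]; case: (eqVneq m 0%N) => //= [m0|m0]; last by field.
    - by field.
    - by field.
    - by rewrite ifN; [field|rewrite -m0 eq_sym].
  - under eq_mean => j do rewrite mulrC sin_cos.
    by rewrite meanZ meanD SD' SB' addr0 mulr0.
  - under eq_mean => j do rewrite sin_cos.
    by rewrite meanZ meanD SD SB addr0 mulr0.
have SC l : (l < H)%N -> mean N (fun j => S j * c l j) = cosc N v l /\
                         mean N (fun j => S j * s l j) = sinc N v l.
  move=> lH; split.
    under eq_mean => j do rewrite /S mulr_suml.
    rewrite mean_sum (bigD1 (Ordinal lH))//= [X in _ + X]big1 ?addr0; last first.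
      move=> m; rewrite -val_eqE /= => ml; have [cc ss cs sc] := orth m l (ltn_ord m) lH.
      rewrite (eq_mean _ _ (fun j => cosc N v m * (wt m * (c m j * c l j)) + wt m * sinc N v m * (s m j * c l j))); last by move=> j; ring.
      rewrite meanD !meanZ sc (mulrC (wt m)) cc (negbTE ml) /dirac0; ring.
    have [cc ss cs sc] := orth l l lH lH.
    rewrite (eq_mean _ _ (fun j => cosc N v l * (wt l * (c l j * c l j)) + wt l * sinc N v l * (s l j * c l j))); last by move=> j; ring.
    rewrite meanD !meanZ sc (mulrC (wt l)) cc eqxx /dirac0; ring.
  under eq_mean => j do rewrite /S mulr_suml.
  rewrite mean_sum (bigD1 (Ordinal lH))//= [X in _ + X]big1 ?addr0; last first.
    move=> m; rewrite -val_eqE /= => ml; have [cc ss cs sc] := orth m l (ltn_ord m) lH.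
    rewrite (eq_mean _ _ (fun j => sinc N v m * (wt m * (s m j * s l j)) + wt m * cosc N v m * (c m j * s l j))); last by move=> j; ring.
    rewrite meanD !meanZ cs (mulrC (wt m)) ss (negbTE ml) /dirac0 /=; ring.
  have [cc ss cs sc] := orth l l lH lH.
  rewrite (eq_mean _ _ (fun j => sinc N v l * (wt l * (s l j * s l j)) + wt l * cosc N v l * (c l j * s l j))); last by move=> j; ring.
  rewrite meanD !meanZ cs (mulrC (wt l)) ss eqxx /dirac0.
  by have [->|l0] := eqVneq l 0%N; rewrite ?sin0 /=; ring.
have XS (X : nat -> R) : mean N (fun j => X j * S j) = \sum_(m < H)
    wt m * (cosc N v m * mean N (fun j => X j * c m j) +
            sinc N v m * mean N (fun j => X j * s m j)).
  under eq_mean => j do rewrite /S mulr_sumr.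
  rewrite mean_sum; apply: eq_bigr => m _.
  rewrite -!meanZ -meanD -meanZ; apply: eq_mean => j; ring.
have vS : mean N (fun j => v j * S j) = B.
  by rewrite XS; apply: eq_bigr => m _; rewrite !expr2.
have SS : mean N (fun j => S j * S j) = B.
  rewrite XS; apply: eq_bigr => m _.
  by have [-> ->] := SC m (ltn_ord m); rewrite !expr2.
have : 0 <= mean N (fun j => (v j - S j) ^+ 2).
  by rewrite mulr_ge0 ?invr_ge0// sumr_ge0// => j _; rewrite sqr_ge0.
rewrite (eq_mean _ _ (fun j => v j ^+ 2 + ((- 2) * (v j * S j) + S j * S j))); last by move=> j; ring.
rewrite !meanD meanZ vS SS; lra.
Qed.

End discrete_fourier.

(** * Fejer smoothing and small-angle estimates *)

Section fejer.
Context {R : realType}.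
Implicit Types (N H m l j : nat) (x y : R) (v w : nat -> R).

Definition fejer H x : R :=
  \sum_(m < H) wt m * (1 - m%:R / H%:R) * cos (m%:R * x).

(** [H] times the kernel is [|sum_(a < H) exp (i a x)|^2]: raising [H] by one adds a Dirichlet
    kernel to both. *)
Lemma fejer_ge0 H x : (0 < H)%N -> 0 <= fejer H x.
Proof.
move=> H0.
pose C n := \sum_(a < n) cos (a%:R * x).
pose S n := \sum_(a < n) sin (a%:R * x).
pose G n := C n ^+ 2 + S n ^+ 2.
have D n : \sum_(m < n.+1) wt m * cos (m%:R * x) =
    1 + 2 * (cos (n%:R * x) * C n + sin (n%:R * x) * S n).
  rewrite big_ord_recl /= /wt/= mul0r cos0 mulr1; congr (_ + _).
  rewrite /C /S !mulr_sumr -big_split mulr_sumr /=.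
  rewrite (reindex_inj rev_ord_inj) /=; apply: eq_bigr => a _.
  rewrite -cosB; congr (_ * cos _).
  rewrite /bump leq0n add1n (_ : (n - a.+1).+1 = n - a)%N; last by have := ltn_ord a; lia.
  by rewrite natrB ?mulrBl// ltnW.
have HF n : \sum_(m < n) wt m * (n%:R - m%:R) * cos (m%:R * x) = G n.
  elim: n => [|n ih]; first by rewrite /G /C /S !big_ord0 expr0n addr0.
  transitivity (\sum_(m < n.+1) wt m * (n%:R - m%:R) * cos (m%:R * x) +
                \sum_(m < n.+1) wt m * cos (m%:R * x)).
    by rewrite -big_split; apply: eq_bigr => m _; rewrite -[n.+1%:R]natr1 /=; ring.
  rewrite big_ord_recr /= subrr mulr0 mul0r addr0 ih D /G /C /S !big_ord_recr /=.
  have := cos2Dsin2 (n%:R * x); set c := cos _; set s := sin _ => cs.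
  lra.
rewrite (_ : fejer H x = H%:R^-1 * G H).
  by rewrite mulr_ge0 ?invr_ge0// addr_ge0 ?sqr_ge0.
rewrite -HF mulr_sumr; apply: eq_bigr => m _.
by field; rewrite pnatr_eq0 -lt0n.
Qed.

Lemma mean_fejer N H x : (0 < H)%N -> (H <= N)%N ->
  mean N (fun j => fejer H (x - ang N * j%:R)) = 1.
Proof.
case: H => // H _ HN; rewrite /fejer mean_sum big_ord_recl /= big1 ?addr0.
  under eq_mean => j do rewrite /wt/= !mul0r cos0 subr0 !mulr1.
  by rewrite mean_cst//; lia.
move=> m _; rewrite meanZ mean_cos_shift ?mulr0//.
by have := ltn_ord m; rewrite /bump; lia.
Qed.

(** Since [2 - 2 cos] is the squared chord on the unit circle, the kernel has mean squared chord
    [2 / H], the square of the smoothing length. *)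
Lemma mean_fejer_cos N H x : (1 < H)%N -> (H < N)%N ->
  mean N (fun j => fejer H (x - ang N * j%:R) * cos (x - ang N * j%:R)) =
  1 - H%:R^-1.
Proof.
move=> H1 HN; have N0 : (0 < N)%N by lia.
rewrite (eq_mean _ _ (fun j => \sum_(m < H) (wt m * (1 - m%:R / H%:R)) *
   (2^-1 * (cos (m.+1%:R * (x - ang N * j%:R)) +
            cos (m%:R * (x - ang N * j%:R) - (x - ang N * j%:R)))))); last first.
  move=> j; rewrite /fejer mulr_suml; apply: eq_bigr => m _.
  by rewrite -mulrA cos_cos -[m.+1%:R]natr1 mulrDl mul1r.
rewrite mean_sum (bigD1 (Ordinal H1))//= [X in _ + X]big1 ?addr0 => [|m].
  have E1 (z : R) : 1%:R * z - z = 0 by rewrite mul1r subrr.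
  under eq_mean => j do rewrite E1 cos0.
  by rewrite !meanZ meanD mean_cos_shift ?mean_cst ?add0r /wt/=; [field; rewrite pnatr_eq0; lia|lia|lia].
rewrite -val_eqE /= => m1; have mH := ltn_ord m; rewrite !meanZ meanD.
rewrite mean_cos_shift ?add0r; last by lia.
have [k /andP[k0 kN] kE] : exists2 k, (0 < k < N)%N & forall z : R,
    cos (m%:R * z - z) = cos (k%:R * z).
  have [m0|m0] := posnP m.
    by exists 1%N => [|z]; [lia|rewrite m0 mul0r sub0r cosN mul1r].
  by exists (m - 1)%N => [|z]; [lia|rewrite natrB// mulrBl mul1r].
under eq_mean => j do rewrite kE.
by rewrite mean_cos_shift ?k0// !mulr0.
Qed.

Lemma mean_fejerE N H v x :
  mean N (fun j => fejer H (x - ang N * j%:R) * v j) =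
  \sum_(m < H) wt m * (1 - m%:R / H%:R) *
     (cosc N v m * cos (m%:R * x) + sinc N v m * sin (m%:R * x)).
Proof.
transitivity (mean N (fun j => \sum_(m < H) wt m * (1 - m%:R / H%:R) *
   (cos (m%:R * x) * (v j * cos (m%:R * (ang N * j%:R))) +
    sin (m%:R * x) * (v j * sin (m%:R * (ang N * j%:R)))))).
  apply: eq_mean => j; rewrite /fejer mulr_suml; apply: eq_bigr => m _.
  by rewrite (mulrBr m%:R x) cosB; ring.
rewrite mean_sum; apply: eq_bigr => m _; rewrite meanZ meanD !meanZ.
by rewrite [cos _ * _]mulrC [sin _ * _]mulrC.
Qed.

(* AM-GM bounds the first moment of the kernel by its second moment. *)
Lemma fejer_smoothing N H v (v0 B : R) x (d : nat -> R) :
  (1 < H)%N -> (H < N)%N -> 0 <= B ->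
  (forall j, d j ^+ 2 = 2 - 2 * cos (x - ang N * j%:R)) ->
  (forall j, `|v j - v0| <= B * d j) ->
  `|mean N (fun j => fejer H (x - ang N * j%:R) * v j) - v0| <=
  B * Num.sqrt (2 / H%:R).
Proof.
move=> H1 HN B0 dE vB; have H0 : (0 < H)%N by lia.
have N0 : (0 < N)%N by lia.
set b := Num.sqrt _.
have b0 : 0 < b by rewrite sqrtr_gt0 divr_gt0// ltr0n.
have Hn : H%:R != 0 :> R by rewrite pnatr_eq0; lia.
have bn : b != 0 by rewrite gt_eqF.
have b2 : b ^+ 2 = 2 / H%:R by rewrite sqr_sqrtr// divr_ge0.
set k := fun j => fejer H (x - ang N * j%:R).
have k0 j : 0 <= k j by exact: fejer_ge0.
rewrite (_ : _ - v0 = mean N (fun j => k j * (v j - v0))); last first.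
  transitivity (mean N (fun j => k j * v j) - v0 * mean N k).
    by rewrite mean_fejer ?mulr1// ltnW.
  by rewrite -meanZ -meanB; apply: eq_mean => j; ring.
apply: (le_trans (ler_norm_mean _ _)).
apply: (@le_trans _ _ (mean N (fun j => B / 2 * b * k j + B / b * (k j - k j * cos (x - ang N * j%:R))))).
  apply: ler_mean => j; rewrite normrM (ger0_norm (k0 j)).
  rewrite [leRHS](_ : _ = k j * (B * ((b ^+ 2 + d j ^+ 2) / (2 * b)))); last first.
    by rewrite dE; field; rewrite gt_eqF.
  rewrite ler_wpM2l// (le_trans (vB j))// ler_wpM2l//.
  rewrite ler_pdivlMr ?mulr_gt0// -subr_ge0.
  rewrite (_ : _ - _ = (b - d j) ^+ 2) ?sqr_ge0//; ring.
rewrite meanD !meanZ meanB mean_fejer ?(ltnW HN)// mean_fejer_cos//.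
rewrite [leLHS](_ : _ = B / 2 * b + B / b * (b ^+ 2 / 2)); last first.
  by rewrite b2; field; rewrite ?bn ?Hn.
by rewrite le_eqVlt; apply/orP; left; apply/eqP; field; rewrite gt_eqF.
Qed.

End fejer.

Section small_angles.
Context {R : realType}.
Implicit Types (x y : R).

Lemma sin_mvt x : 0 < x -> exists2 y, 0 < y < x & sin x = cos y * x.
Proof.
move=> x0.
have [y yx E] := @MVT R (@sin R) (@cos R) 0 x x0
  (fun y _ => is_derive_sin y) (continuous_subspaceT (@continuous_sin R)).
by exists y; [move: yx; rewrite in_itv|move: E; rewrite sin0 !subr0].
Qed.

Lemma sin_le_id x : 0 <= x -> sin x <= x.
Proof.
rewrite le_eqVlt => /predU1P[<-|x0]; first by rewrite sin0.
by have [y _ ->] := sin_mvt x x0; rewrite ger_pMl// cos_le1.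
Qed.

Lemma cos_half x : cos x = 1 - 2 * sin (x / 2) ^+ 2.
Proof.
rewrite {1}(_ : x = x / 2 + x / 2); last by field.
by rewrite cosD -!expr2 cos2sin2; ring.
Qed.

Lemma cos_ge_parabola x : 0 <= x <= 1 -> 1 - x ^+ 2 / 2 <= cos x.
Proof.
move=> /andP[x0 x1]; rewrite cos_half.
have s1 : sin (x / 2) <= x / 2 by rewrite sin_le_id// divr_ge0.
have s0 : 0 <= sin (x / 2).
  by rewrite sin_ge0_pi// divr_ge0//=; have := @pi_ge2 R; lra.
nra.
Qed.

Lemma sin_ge_cubic x : 0 <= x <= 1 -> x - x ^+ 3 / 2 <= sin x.
Proof.
move=> /andP[]; rewrite le_eqVlt => /predU1P[<- _|x0 x1].
  by rewrite sin0 expr0n /= mul0r subrr.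
have [y /andP[y0 yx] ->] := sin_mvt x x0.
have : 1 - y ^+ 2 / 2 <= cos y by rewrite cos_ge_parabola// (ltW y0) (le_trans (ltW yx)).
have : y ^+ 2 <= x ^+ 2 by rewrite ler_pXn2r ?nnegrE ?ltW// (lt_trans y0).
move=> h1 h2.
have -> : x - x ^+ 3 / 2 = (1 - x ^+ 2 / 2) * x by field.
rewrite ler_pM2r//; lra.
Qed.

Lemma cos_le_cubic x : 0 <= x <= 1 -> cos x <= 1 - x ^+ 2 / 2 + x ^+ 3 / 2.
Proof.
move=> /andP[x0 x1]; rewrite cos_half.
have : x / 2 - (x / 2) ^+ 3 / 2 <= sin (x / 2) by rewrite sin_ge_cubic//; lra.
set s := sin _ => hs.
have h0 : 0 <= x / 2 - (x / 2) ^+ 3 / 2.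
  rewrite (_ : _ - _ = x / 2 * (1 - x ^+ 2 / 8)); last by field.
  by rewrite mulr_ge0//; nra.
have : (x / 2 - (x / 2) ^+ 3 / 2) ^+ 2 <= s ^+ 2.
  by rewrite ler_pXn2r// nnegrE (le_trans h0).
have -> : (x / 2 - (x / 2) ^+ 3 / 2) ^+ 2 =
   x ^+ 2 / 4 - x ^+ 4 / 16 + x ^+ 6 / 256 by field.
have : 0 <= x ^+ 6 by rewrite exprn_ge0.
have : 0 <= x ^+ 3 by rewrite exprn_ge0.
have : x ^+ 4 <= x ^+ 3 by rewrite ler_wiXn2l.
lra.
Qed.

Lemma expR_le_inv x : x < 1 -> expR x <= (1 - x)^-1.
Proof.
move=> x1; rewrite -[x in expR x]opprK expRN lef_pV2 ?posrE ?expR_gt0 ?subr_gt0//.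
exact: expR_ge1Dx.
Qed.

(** The left side is [2 + (exp z - exp (- z))^2] with [z = y / 2], and [1 - z <= exp (- z)] bounds
    both exponentials. *)
Lemma expR_sum_le y : 0 <= y <= 10^-1 ->
  expR y + expR (- y) <= 2 + y ^+ 2 + y ^+ 3.
Proof.
move=> /andP[y0 y1]; set z := y / 2.
have E1 : expR y = expR z ^+ 2 by rewrite -expRM_natl; congr expR; rewrite /z; field.
have E2 : expR (- y) = expR (- z) ^+ 2 by rewrite -expRM_natl; congr expR; rewrite /z; field.
have EE : expR z * expR (- z) = 1 by rewrite expRxMexpNx_1.
have h1 : expR z <= (1 - z)^-1 by rewrite expR_le_inv// /z; lra.
have h2 : 1 - z <= expR (- z) by rewrite expR_ge1Dx.
have h3 : expR (- z) <= expR z by rewrite ler_expR /z; lra.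
have -> : expR y + expR (- y) = 2 + (expR z - expR (- z)) ^+ 2.
  by rewrite E1 E2 sqrrB EE; ring.
rewrite -[leRHS]addrA lerD2l.
have h4 : expR z - expR (- z) <= (1 - z)^-1 - (1 - z) by rewrite lerB.
apply: (@le_trans _ _ (((1 - z)^-1 - (1 - z)) ^+ 2)).
  by rewrite ler_pXn2r ?nnegrE ?subr_ge0// (le_trans h2)// (le_trans h3).
have z1 : 0 < 1 - z by rewrite /z; lra.
rewrite (_ : (1 - z)^-1 - (1 - z) = z * (2 - z) / (1 - z)); last by field; rewrite gt_eqF.
rewrite expr_div_n ler_pdivrMr ?exprn_gt0//.
have -> : y = 2 * z by rewrite /z; field.
have z0 : 0 <= z by rewrite /z; lra.
have zs : z <= 20^-1 by rewrite /z; lra.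
rewrite (_ : (z * (2 - z)) ^+ 2 = z ^+ 2 * (2 - z) ^+ 2); last by ring.
rewrite (_ : ((2 * z) ^+ 2 + (2 * z) ^+ 3) * (1 - z) ^+ 2 = z ^+ 2 * ((4 + 8 * z) * (1 - z) ^+ 2)); last by ring.
rewrite ler_wpM2l ?sqr_ge0// -subr_ge0.
rewrite (_ : _ - _ = z * (4 - 13 * z + 8 * z ^+ 2)); last by ring.
by rewrite mulr_ge0// addr_ge0 ?mulr_ge0 ?sqr_ge0//; clear -zs; lra.
Qed.

(** Here [w] stands for [1 - cos x], and the last factor is [y^2 + y^3] for [y = 17/10 x]. The
    leading terms are [3 x^2] against [289/100 x^2]; for [x <= 1/100] the margin [11/100 x^2]
    absorbs the cubic ones. *)
Lemma triangle_mode_poly x w : 0 <= x <= 100^-1 ->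
  x ^+ 2 / 2 - x ^+ 3 / 2 <= w <= x ^+ 2 / 2 ->
  0 <= 6 * w - 2 * w ^+ 2 - (1 - w) * (x ^+ 2 * (289 / 100 + 4913 / 1000 * x)).
Proof.
move=> /andP[x0 x1] /andP[w2 w1].
have w0 : 0 <= w.
  apply: le_trans w2; rewrite (_ : _ - _ = x ^+ 2 * ((1 - x) / 2)); last by field.
  by rewrite mulr_ge0 ?sqr_ge0//; clear -x1; lra.
have ww : w ^+ 2 <= x ^+ 2 * (x / 400).
  apply: (@le_trans _ _ ((x ^+ 2 / 2) ^+ 2)).
    by rewrite ler_pXn2r// nnegrE mulr_ge0// ?sqr_ge0.
  rewrite (_ : _ ^+ 2 = x ^+ 2 * (x * (x / 4))); last by field.
  rewrite ler_wpM2l ?sqr_ge0// ler_wpM2l//; clear -x1; lra.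
set Y := x ^+ 2 * _.
have Y0 : 0 <= Y by apply: mulr_ge0; [exact: sqr_ge0|clear -x0; lra].
have wY : 0 <= w * Y by rewrite mulr_ge0.
have : 0 <= x ^+ 2 * (3 - 3 * x - 2 * (x / 400) - (289 / 100 + 4913 / 1000 * x)).
  by apply: mulr_ge0; [exact: sqr_ge0|clear -x0 x1; lra].
have -> : x ^+ 2 * (3 - 3 * x - 2 * (x / 400) - (289 / 100 + 4913 / 1000 * x)) =
  6 * (x ^+ 2 / 2 - x ^+ 3 / 2) - 2 * (x ^+ 2 * (x / 400)) - Y.
  by rewrite /Y; field.
move=> h; rewrite mulrBl mul1r.
clear -h ww w2 wY; move: (x ^+ 2 * (x / 400)) (x ^+ 2 / 2 - x ^+ 3 / 2) (w ^+ 2) (w * Y) h ww w2 wY.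
by clear; move: Y => Y a b c d; lra.
Qed.

(* With [t = 17/10 < sqrt 3], to second order this is [t ^ 2 < 3]. *)
Lemma triangle_mode_bounds x : 0 <= x <= 100^-1 ->
  expR (- (17 / 10 * x)) <= cos x /\
  cos x * (expR (17 / 10 * x) + expR (- (17 / 10 * x))) <= 4 - 2 * cos x ^+ 2.
Proof.
move=> /andP[x0 x1]; set y := 17 / 10 * x.
have c1 : 1 - x ^+ 2 / 2 <= cos x by rewrite cos_ge_parabola//; lra.
have c2 : cos x <= 1 - x ^+ 2 / 2 + x ^+ 3 / 2 by rewrite cos_le_cubic//; lra.
have c0 : 0 <= cos x by apply: le_trans c1; clear -x0 x1; nra.
split.
  apply: le_trans c1; rewrite expRN.
  have e1 : 1 + y <= expR y by exact: expR_ge1Dx.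
  apply: (@le_trans _ _ (1 + y)^-1).
    by rewrite lef_pV2// posrE ?expR_gt0// /y; clear -x0; lra.
  have y0 : 0 < 1 + y by rewrite /y; clear -x0; lra.
  rewrite -[leLHS]mul1r ler_pdivrMr// -subr_ge0 /y.
  rewrite (_ : _ - _ = x * (17 / 10 - x / 2 - 17 / 20 * x ^+ 2)); last by field.
  rewrite mulr_ge0//.
  have : x ^+ 2 <= x by rewrite expr2 ler_piMr//; clear -x1; lra.
  by clear -x0 x1; move: (x ^+ 2) => z; lra.
have S : expR y + expR (- y) <= 2 + y ^+ 2 + y ^+ 3 by rewrite expR_sum_le// /y; lra.
apply: (@le_trans _ _ (cos x * (2 + y ^+ 2 + y ^+ 3))); first by rewrite ler_wpM2l.
move: c1 c2 c0; set c := cos x => c1 c2 c0.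
have yE : y ^+ 2 + y ^+ 3 = x ^+ 2 * (289 / 100 + 4913 / 1000 * x) by rewrite /y; field.
have := triangle_mode_poly x (1 - c).
rewrite x0 x1 -yE => /(_ isT) H; rewrite -subr_ge0.
rewrite (_ : _ - _ = 6 * (1 - c) - 2 * (1 - c) ^+ 2 - (1 - (1 - c)) * (y ^+ 2 + y ^+ 3)); last by ring.
by apply: H; apply/andP; split; clear -c1 c2; lra.
Qed.

End small_angles.

(** * A Dirichlet energy bound on a polar lattice *)

Section lattice_energy.
Context {R : realType}.
Implicit Types (N H S m l j s : nat) (x y t : R) (v w : nat -> R).

(** [(a, b)] and [(a', b')] are the coefficients of one mode on two consecutive circles; shifts by
    two and one samples rotate them by [2 x] and [x], so the right side collects the three sides of
    a triangle. It exceeds the left side by exactly [(8 - 4 c^2 - 2 c (1/la + la)) (a^2 + b^2)] plus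
    [2 (c/la - 1)] times the squared first-order factor, and [triangle_mode_bounds] makes both
    coefficients nonnegative. *)
Lemma triangle_mode x (a b a' b' c s la : R) : 0 <= x <= 100^-1 ->
  c = cos x -> s = sin x -> la = expR (- (17 / 10 * x)) ->
  2 * ((a - la * a') ^+ 2 + (b - la * b') ^+ 2) +
    (2 * c * la - 2) * ((a ^+ 2 + b ^+ 2) - (a' ^+ 2 + b' ^+ 2)) <=
  (((2 * c ^+ 2 - 1) * a + 2 * s * c * b - a) ^+ 2 +
   ((2 * c ^+ 2 - 1) * b - 2 * s * c * a - b) ^+ 2) +
  ((c * a' + s * b' - ((2 * c ^+ 2 - 1) * a + 2 * s * c * b)) ^+ 2 +
   (c * b' - s * a' - ((2 * c ^+ 2 - 1) * b - 2 * s * c * a)) ^+ 2) +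
  ((c * a' + s * b' - a) ^+ 2 + (c * b' - s * a' - b) ^+ 2).
Proof.
move=> x01 cE sE laE; have [] := triangle_mode_bounds x x01.
have := cos2Dsin2 x.
have -> : expR (17 / 10 * x) = la^-1 by rewrite laE expRN invrK.
rewrite -cE -sE -laE => cs lac key.
have la0 : 0 < la by rewrite laE expR_gt0.
rewrite -subr_ge0.
set A := a ^+ 2 + b ^+ 2; set A' := a' ^+ 2 + b' ^+ 2.
have s2 : s ^+ 2 = 1 - c ^+ 2 by rewrite -cs; ring.
rewrite [leRHS](_ : _ = (8 - 4 * c ^+ 2 - 2 * (c * (la^-1 + la))) * A +
  2 * (c / la - 1) * ((a - la * a') ^+ 2 + (b - la * b') ^+ 2)); last first.
  rewrite /A /A'.
  have laV : la^-1 * la = 1 by rewrite mulVf// gt_eqF.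
  move: s2 laV; set k := la^-1 => s2 laV.
  have s4 : s ^+ 4 = (1 - c ^+ 2) ^+ 2 by rewrite -s2; ring.
  transitivity (
     (4 * (1 - c ^+ 2) * (a ^+ 2 + b ^+ 2)) +
     2 * (a ^+ 2 + b ^+ 2) + 2 * (a' ^+ 2 + b' ^+ 2) - 4 * c * (a * a' + b * b')
     - (2 * ((a - la * a') ^+ 2 + (b - la * b') ^+ 2) +
    (2 * c * la - 2) * ((a ^+ 2 + b ^+ 2) - (a' ^+ 2 + b' ^+ 2)))).
    congr (_ - _).
    transitivity (((4 * c ^+ 4 - 8 * c ^+ 2 + 4) + 4 * s ^+ 2 * c ^+ 2) * (a ^+ 2 + b ^+ 2) +
      ((c ^+ 2 + s ^+ 2) * (a' ^+ 2 + b' ^+ 2) + (4 * c ^+ 4 - 4 * c ^+ 2 + 1 + 4 * s ^+ 2 * c ^+ 2) * (a ^+ 2 + b ^+ 2)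
       - 2 * ((2 * c ^+ 3 - c + 2 * s ^+ 2 * c) * (a * a' + b * b') +
              (2 * c ^+ 2 * s - s - 2 * s * c ^+ 2) * (a * b' - b * a') * 1)) +
      ((c ^+ 2 + s ^+ 2) * (a' ^+ 2 + b' ^+ 2) + (a ^+ 2 + b ^+ 2)
       - 2 * (c * (a * a' + b * b') + s * (a * b' - b * a')))).
      ring.
    rewrite s2; ring.
  have E : c * k * la = c by rewrite -mulrA laV mulr1.
  have E2 : c * k * la ^+ 2 = c * la by rewrite expr2 mulrA E.
  apply/eqP; rewrite -subr_eq0; apply/eqP.
  transitivity (
    (4 * (a * a' + b * b')) * (c * k * la - c) -
    2 * (a' ^+ 2 + b' ^+ 2) * (c * k * la ^+ 2 - c * la)); last by rewrite E E2; ring.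
  ring.
have sq0 (u w : R) : 0 <= u ^+ 2 + w ^+ 2 by rewrite addr_ge0// sqr_ge0.
apply: addr_ge0; apply: mulr_ge0 => //.
  by clear -key; lra.
  exact: sq0.
by rewrite mulr_ge0// subr_ge0 ler_pdivlMr// mul1r.
Qed.

Lemma cos_double x : cos (2 * x) = 2 * cos x ^+ 2 - 1.
Proof. by rewrite mulr_natl cos_mulr2n -mulr_natl. Qed.

Lemma sin_double x : sin (2 * x) = 2 * sin x * cos x.
Proof. by rewrite mulr_natl sin_mulr2n -mulr_natl; ring. Qed.

Lemma cosc_shift N l v m : (0 < N)%N -> (forall j, v (j + N)%N = v j) ->
  cosc N (fun j => v (j + l)%N) m =
    cos (l%:R * (m%:R * ang N)) * cosc N v m + sin (l%:R * (m%:R * ang N)) * sinc N v m /\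
  sinc N (fun j => v (j + l)%N) m =
    cos (l%:R * (m%:R * ang N)) * sinc N v m - sin (l%:R * (m%:R * ang N)) * cosc N v m.
Proof.
move=> N0 vN; set x := l%:R * _.
have E j : m%:R * (ang N * j%:R) = m%:R * (ang N * (j + l)%:R) - x.
  by rewrite /x natrD; ring.
split.
  rewrite /cosc /sinc -!meanZ -meanD.
  rewrite -(mean_shift _ l (fun j => cos x * _ + _)); last first.
    by move=> j /=; rewrite vN cos_ang_period// sin_ang_period.
  by apply: eq_mean => j; rewrite E cosB; ring.
rewrite /cosc /sinc -!meanZ -meanB.
rewrite -(mean_shift _ l (fun j => cos x * _ - _)); last first.
  by move=> j /=; rewrite vN cos_ang_period// sin_ang_period.
by apply: eq_mean => j; rewrite E sinB; ring.
Qed.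

Lemma coscB N v w m : cosc N (fun j => v j - w j) m = cosc N v m - cosc N w m.
Proof. by rewrite /cosc -meanB; apply: eq_mean => j; rewrite mulrBl. Qed.

Lemma sincB N v w m : sinc N (fun j => v j - w j) m = sinc N v m - sinc N w m.
Proof. by rewrite /sinc -meanB; apply: eq_mean => j; rewrite mulrBl. Qed.

(** Among three increments summing to zero, the largest in modulus is the sum of the moduli of the
    other two, so its square dominates the sum of their squares. This gives 2 where separate bounds
    give 3. *)
Lemma triangle_sides x y (L : R) : `|x| <= L -> `|y| <= L -> `|x + y| <= L ->
  x ^+ 2 + y ^+ 2 + (x + y) ^+ 2 <= 2 * L ^+ 2.
Proof.
move=> hx hy hxy.
have L0 : 0 <= L by rewrite (le_trans _ hx).
have sq (z : R) : `|z| <= L -> z ^+ 2 <= L ^+ 2.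
  by move=> zL; rewrite -real_normK ?num_real// ler_pXn2r// nnegrE.
have := sq _ hx; have := sq _ hy; have := sq _ hxy.
have [xy|xy] := leP 0 (x * y); first by rewrite sqrrD -mulr_natl; lra.
rewrite sqrrD -mulr_natl; case: (leP (x ^+ 2 + x * y) 0) => h; first lra.
have : y ^+ 2 + x * y <= 0; last by lra.
rewrite leNgt; apply/negP => h2; move: h h2.
rewrite expr2 -mulrDr expr2 -mulrDl => h h2.
have : 0 < (x * (x + y)) * ((y + x) * y) by rewrite mulr_gt0.
rewrite (_ : _ * _ = (x * y) * (x + y) ^+ 2); last by ring.
by rewrite ltNge mulr_le0_ge0 ?sqr_ge0// ltW.
Qed.

(* In each mode, the squared differences along the sides of a triangle dominate
   twice the square of the first-order factor [f_s - la f_(s+1)] of the radial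
   Laplacian, up to a term that telescopes in [s]. *)
Lemma lattice_dirichlet N H S (F : nat -> nat -> R) (L : nat -> R) (f0 : R) :
  (0 < H)%N -> (2 * H <= N)%N -> H%:R * ang N <= 100^-1 :> R ->
  (forall s j, F s (j + N)%N = F s j) -> (forall j, F S j = 0) ->
  (forall s j, (s < S)%N ->
     [/\ `|F s j.+2 - F s j| <= L s, `|F s.+1 j.+1 - F s j.+2| <= L s
       & `|F s.+1 j.+1 - F s j| <= L s]) ->
  forall la : nat -> R, (forall m, la m = expR (- (17 / 10 * (m%:R * ang N)))) ->
  \sum_(s < S) \sum_(m < H) wt m *
    ((cosc N (F s) m - la m * cosc N (F s.+1) m) ^+ 2 +
     (sinc N (F s) m - la m * sinc N (F s.+1) m) ^+ 2) <=
  \sum_(s < S) L s ^+ 2 + mean N (fun j => (F 0%N j - f0) ^+ 2).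
Proof.
move=> H0 HN Hsmall Fper FS Ftri la laE; have N0 : (0 < N)%N by lia.
pose A s m := cosc N (F s) m ^+ 2 + sinc N (F s) m ^+ 2.
pose tau m := 2 * cos (m%:R * ang N) * la m - 2.
pose G s m := (cosc N (F s) m - la m * cosc N (F s.+1) m) ^+ 2 +
     (sinc N (F s) m - la m * sinc N (F s.+1) m) ^+ 2.
have ang01 m : (m < H)%N -> 0 <= m%:R * (ang N : R) <= 100^-1.
  move=> mH; have a0 := ltW (@ang_gt0 R N N0).
  apply/andP; split; first exact: mulr_ge0 (ler0n _ _) a0.
  by apply: (le_trans _ Hsmall); rewrite ler_wpM2r// ler_nat ltnW.
have step s : (s < S)%N ->
    \sum_(m < H) wt m * (2 * G s m + tau m * (A s m - A s.+1 m)) <= 2 * L s ^+ 2.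
  move=> sS.
  pose X j := F s (j + 2)%N - F s j.
  pose Y j := F s.+1 (j + 1)%N - F s (j + 2)%N.
  pose Z j := F s.+1 (j + 1)%N - F s j.
  apply: (@le_trans _ _ (mean N (fun j => X j ^+ 2 + Y j ^+ 2 + Z j ^+ 2))); last first.
    rewrite -(@mean_cst _ N (2 * _))//; apply: ler_mean => j.
    have [h1 h2 h3] := Ftri s j sS.
    rewrite /X /Y /Z addn1 addn2.
    have E : F s.+1 j.+1 - F s j = (F s j.+2 - F s j) + (F s.+1 j.+1 - F s j.+2) by ring.
    by rewrite E triangle_sides// -E.
  rewrite !meanD.
  apply: le_trans (lerD (lerD (bessel N H X H0 HN) (bessel N H Y H0 HN)) (bessel N H Z H0 HN)).
  rewrite -!big_split /=; apply: ler_sum => m _.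
  rewrite -!mulrDr ler_wpM2l ?wt_ge0//.
  have := triangle_mode (m%:R * ang N) (cosc N (F s) m) (sinc N (F s) m)
     (cosc N (F s.+1) m) (sinc N (F s.+1) m) _ _ _ (ang01 _ (ltn_ord m)) erefl erefl erefl.
  rewrite -laE -/(tau m) => h; apply: (le_trans h).
  have [c2 s2] := cosc_shift N 2 (F s) m N0 (Fper s).
  have [c1 s1] := cosc_shift N 1 (F s.+1) m N0 (Fper s.+1).
  rewrite /X /Y /Z !coscB !sincB c2 s2 c1 s1 !mul1r.
  rewrite cos_double sin_double.
  by [].
have tauP m : (m < H)%N -> - 2 <= tau m.
  move=> mH; rewrite /tau lerBrDr addNr laE mulr_ge0 ?expR_ge0// mulr_ge0//.
  rewrite cos_ge0_pihalf//; have := ang01 m mH; have := @pihalf_ge1 R; lra.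
have tau0 : tau 0%N = 0 by rewrite /tau laE !mul0r mulr0 oppr0 expR0 cos0; ring.
have A_S m : A S m = 0.
  rewrite /A /cosc /sinc; under eq_mean => j do rewrite FS mul0r.
  under [X in _ + X ^+ 2]eq_mean => j do rewrite FS mul0r.
  by rewrite mean_cst// expr0n addr0.
have tel : \sum_(s < S) \sum_(m < H) wt m * (tau m * (A s m - A s.+1 m)) =
           \sum_(m < H) wt m * (tau m * A 0%N m).
  rewrite exchange_big; apply: eq_bigr => m _ /=.
  rewrite -mulr_sumr -mulr_sumr; congr (_ * (_ * _)).
  have -> : \sum_(s < S) (A s m - A s.+1 m) = - \sum_(0 <= s < S) (A s.+1 m - A s m).
    by rewrite big_mkord -sumrN; apply: eq_bigr => s _; rewrite opprB.
  by rewrite telescope_sumr// A_S sub0r opprK.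
(* The telescoping leaves a boundary term on the innermost circle. It has no mode 0 since
   [tau 0 = 0], and the other modes ignore constants, so the row may be centred at [f0]. *)
have bottom : - (2 * mean N (fun j => (F 0%N j - f0) ^+ 2)) <=
              \sum_(m < H) wt m * (tau m * A 0%N m).
  rewrite lerNl -sumrN.
  apply: (@le_trans _ _ (2 * \sum_(m < H) wt m *
    (cosc N (fun j => F 0%N j - f0) m ^+ 2 + sinc N (fun j => F 0%N j - f0) m ^+ 2))); last first.
    by rewrite ler_wpM2l// bessel.
  rewrite mulr_sumr; apply: ler_sum => m _.
  rewrite -mulrN mulrCA ler_wpM2l ?wt_ge0//.
  have [m0|m0] := posnP m.
    by rewrite m0 tau0 mul0r oppr0 mulr_ge0// addr_ge0// sqr_ge0.
  have [|Cm Sm] := @mean_cos_sin R N m; first by have := ltn_ord m; lia.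
  have -> : cosc N (fun j => F 0%N j - f0) m = cosc N (F 0%N) m.
    by rewrite coscB [X in _ - X]/cosc meanZ Cm mulr0 subr0.
  have -> : sinc N (fun j => F 0%N j - f0) m = sinc N (F 0%N) m.
    by rewrite sincB [X in _ - X]/sinc meanZ Sm mulr0 subr0.
  rewrite -/(A 0%N m) -mulNr ler_wpM2r ?addr_ge0 ?sqr_ge0//.
  by have := tauP m (ltn_ord m); rewrite lerNl.
have : \sum_(s < S) \sum_(m < H) wt m * (2 * G s m + tau m * (A s m - A s.+1 m)) <=
       \sum_(s < S) 2 * L s ^+ 2 by apply: ler_sum => s _; exact: step.
have -> : \sum_(s < S) \sum_(m < H) wt m * (2 * G s m + tau m * (A s m - A s.+1 m)) =
   2 * (\sum_(s < S) \sum_(m < H) wt m * G s m) +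
   \sum_(s < S) \sum_(m < H) wt m * (tau m * (A s m - A s.+1 m)).
  rewrite mulr_sumr -big_split; apply: eq_bigr => s _ /=.
  rewrite mulr_sumr -big_split; apply: eq_bigr => m _ /=; ring.
rewrite -mulr_sumr tel; move: bottom; rewrite /G.
set a := mean _ _; set b := \sum_(m < H) _; set c := \sum_(s < S) L s ^+ 2; set d := \sum_(s < S) _.
by move=> *; lra.
Qed.

End lattice_energy.

(** * Duality with the logarithmic energy of lattice points *)

Section lattice_duality.
Context {R : realType}.
Implicit Types (H S M m s : nat) (x y t la : R).

(** The Green function of [f |-> f_s - la f_(s+1)] on sequences that vanish at the outer end. *)
Definition ker la (i s : nat) : R := if (i <= s)%N then la ^+ (s - i) else 0.

Lemma telescoping_ker la (f : nat -> R) i S : (i <= S)%N -> f S = 0 ->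
  f i = \sum_(s < S) ker la i s * (f s - la * f s.+1).
Proof.
move=> iS fS; pose u s := if (s <= i)%N then f i else la ^+ (s - i) * f s.
transitivity (- \sum_(0 <= s < S) (u s.+1 - u s)).
  rewrite telescope_sumr// /u /=; case: ltngtP iS => // [_ _|-> _].
    by rewrite fS mulr0 sub0r opprK.
  by rewrite subrr oppr0 fS.
rewrite big_mkord -sumrN; apply: eq_bigr => s _; rewrite opprB /u /ker.
case: ltngtP => [si|is_|<-].
- by rewrite mul0r subrr.
- by rewrite subSn ?(ltnW is_)// exprS; ring.
- by rewrite subnn subSnn expr0 expr1 !mul1r.
Qed.

(** With [la = exp (- m h)] the main term is [exp (- m |u_a - u_b|)], the radial profile of the
    [m]th Fourier mode of the logarithmic kernel. The correction is a product of a function of [a]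
    and one of [b]. *)
Lemma sum_ker2 la a b S : (a <= S)%N -> (b <= S)%N ->
  (1 - la ^+ 2) * \sum_(s < S) ker la a s * ker la b s =
  la ^+ (maxn a b - minn a b) - la ^+ (S - a) * la ^+ (S - b).
Proof.
wlog ab : a b / (a <= b)%N.
  move=> W aS bS; have [ab|ba] := orP (leq_total a b); first exact: W.
  rewrite (eq_bigr (fun s : 'I_S => ker la b s * ker la a s)) => [|s _]; last exact: mulrC.
  by rewrite maxnC minnC W//; congr (_ - _); exact: mulrC.
move=> aS bS; rewrite (maxn_idPr ab) (minn_idPl ab).
pose u s := if (s <= b)%N then la ^+ (b - a) else la ^+ (s - a) * la ^+ (s - b).
transitivity (- \sum_(0 <= s < S) (u s.+1 - u s)).
  rewrite mulr_sumr big_mkord -sumrN; apply: eq_bigr => s _.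
  rewrite opprB /u /ker; case: (ltngtP s b) => [sb|bs|->].
  - by rewrite !mulr0 subrr.
  - by rewrite (leq_trans ab (ltnW bs)) !subSn ?(leq_trans ab (ltnW bs)) ?(ltnW bs)// !exprS; ring.
  - by rewrite ab subnn subSnn subSn// !exprS expr0; ring.
rewrite telescope_sumr// opprB /u /=; congr (_ - _).
by case: ltngtP bS => // -> _; rewrite subnn mulr1.
Qed.

Lemma sum_ker2_1 a b S : (a <= S)%N -> (b <= S)%N ->
  \sum_(s < S) ker 1 a s * ker 1 b s = S%:R - (maxn a b)%:R.
Proof.
elim: S => [|S ih] aS bS.
  by rewrite big_ord0; move: aS bS; rewrite !leqn0 => /eqP-> /eqP->; rewrite subrr.
rewrite big_ord_recr /= /ker !expr1n.
have [aS'|aS'] := boolP (a <= S)%N; have [bS'|bS'] := boolP (b <= S)%N.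
- by rewrite ih// -[S.+1%:R]natr1; ring.
- have -> : b = S.+1 by lia.
  rewrite mulr0 addr0 (maxn_idPr _)// subrr big1// => s _.
  by rewrite /ker [X in _ * X]ifN ?mulr0// -ltnNge ltnS ltnW.
- have -> : a = S.+1 by lia.
  rewrite mul0r addr0 (maxn_idPl _)// subrr big1// => s _.
  by rewrite /ker ifN ?mul0r// -ltnNge ltnS ltnW.
- have -> : a = S.+1 by lia.
  rewrite mul0r addr0 (maxn_idPl _)// subrr big1// => s _.
  by rewrite /ker ifN ?mul0r// -ltnNge ltnS ltnW.
Qed.

Context {K : finType} (i : K -> nat).

Lemma sum_sqr_ker la (x : K -> R) S :
  \sum_(s < S) (\sum_k x k * ker la (i k) s) ^+ 2 =
  \sum_j \sum_k x j * x k * \sum_(s < S) ker la (i j) s * ker la (i k) s.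
Proof.
under eq_bigr => s _.
  rewrite expr2 mulr_suml; under eq_bigr do rewrite mulr_sumr; over.
rewrite exchange_big; apply: eq_bigr => j _ /=.
rewrite exchange_big; apply: eq_bigr => k _ /=.
by rewrite mulr_sumr; apply: eq_bigr => s _; ring.
Qed.

(** The correction in [sum_ker2] sums to minus a square, which is dropped. *)
Lemma ker_energy la (x : K -> R) S : (forall k, i k <= S)%N ->
  (1 - la ^+ 2) * \sum_(s < S) (\sum_k x k * ker la (i k) s) ^+ 2 <=
  \sum_j \sum_k x j * x k * la ^+ (maxn (i j) (i k) - minn (i j) (i k)).
Proof.
move=> iS; rewrite sum_sqr_ker mulr_sumr -subr_ge0 -sumrB.
rewrite (_ : \sum_j _ = (\sum_k x k * la ^+ (S - i k)) ^+ 2) ?sqr_ge0//.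
rewrite [RHS]expr2 mulr_suml; apply: eq_bigr => j _.
rewrite [in RHS]mulr_sumr [in LHS]mulr_sumr -sumrB; apply: eq_bigr => k _.
by rewrite mulrCA sum_ker2//; ring.
Qed.

(** Mode 0, where [1 - la^2] degenerates. The divergent part [S] is multiplied by the squared total
    mass, which is zero. *)
Lemma ker_energy1 (x : K -> R) S : (forall k, i k <= S)%N -> \sum_k x k = 0 ->
  \sum_(s < S) (\sum_k x k * ker 1 (i k) s) ^+ 2 =
  - \sum_j \sum_k x j * x k * (maxn (i j) (i k))%:R.
Proof.
move=> iS x0; rewrite sum_sqr_ker.
transitivity (\sum_j \sum_k (x j * x k * S%:R) -
              \sum_j \sum_k x j * x k * (maxn (i j) (i k))%:R).
  rewrite -sumrB; apply: eq_bigr => j _; rewrite -sumrB; apply: eq_bigr => k _.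
  by rewrite sum_ker2_1// mulrBr.
rewrite big1 ?sub0r// => j _.
by rewrite -mulr_suml -mulr_sumr x0 mulr0 mul0r.
Qed.

Context (c e th : K -> R).

(* [e k = 0] encodes a point smeared uniformly over its circle, so that only
   the mode [0] survives. *)
Definition zcos m k : R := (if m == 0%N then 1 else e k) * cos (m%:R * th k).
Definition zsin m k : R := (if m == 0%N then 1 else e k) * sin (m%:R * th k).

(** The squared modulus of the [m]th mode of the flux through circle [s]: each charge inside is
    attenuated by [la] per circle crossed. *)
Definition lattice_mass la m s : R :=
  (\sum_k c k * zcos m k * ker la (i k) s) ^+ 2 +
  (\sum_k c k * zsin m k * ker la (i k) s) ^+ 2.

(** Expanding [f] by [telescoping_ker] and exchanging sums pairs the first-order factor of [f] with
    the flux of the charges; AM-GM with weight [t] then separates them. A free [t], instead of the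
    optimal square root, keeps the bound linear in both energies through the later limits. *)
Lemma duality H S (kap la : nat -> R) (fc fs : nat -> nat -> R) t : 0 < t ->
  (forall k, i k <= S)%N -> (forall m, fc S m = 0) -> (forall m, fs S m = 0) ->
  \sum_k c k * \sum_(m < H) wt m * kap m *
     (fc (i k) m * zcos m k + fs (i k) m * zsin m k) <=
  (t * \sum_(s < S) \sum_(m < H) wt m *
     ((fc s m - la m * fc s.+1 m) ^+ 2 + (fs s m - la m * fs s.+1 m) ^+ 2) +
   t^-1 * \sum_(s < S) \sum_(m < H) wt m * kap m ^+ 2 * lattice_mass (la m) m s) / 2.
Proof.
move=> t0 iS fcS fsS.
pose C m s := \sum_k c k * zcos m k * ker (la m) (i k) s.
pose D m s := \sum_k c k * zsin m k * ker (la m) (i k) s.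
pose gc s m := fc s m - la m * fc s.+1 m.
pose gs s m := fs s m - la m * fs s.+1 m.
apply: (@le_trans _ _ (\sum_(s < S) \sum_(m < H) wt m * (gc s m * (kap m * C m s) + gs s m * (kap m * D m s)))).
  rewrite le_eqVlt; apply/orP; left; apply/eqP.
  under eq_bigr do rewrite mulr_sumr.
  rewrite exchange_big [RHS]exchange_big; apply: eq_bigr => m _ /=.
  transitivity (\sum_k \sum_(s < S) wt m * (gc s m * (kap m * (c k * zcos m k * ker (la m) (i k) s))
     + gs s m * (kap m * (c k * zsin m k * ker (la m) (i k) s)))).
    apply: eq_bigr => k _.
    rewrite (telescoping_ker (la m) (fc ^~ m) (i k) S)//.
    rewrite (telescoping_ker (la m) (fs ^~ m) (i k) S)//.
    rewrite !mulr_suml -big_split !mulr_sumr; apply: eq_bigr => s _ /=.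
    by rewrite /gc /gs; ring.
  rewrite exchange_big; apply: eq_bigr => s _ /=.
  rewrite /C /D !mulr_sumr -big_split mulr_sumr.
  by apply: eq_bigr => k _ /=.
rewrite mulrDl ![_ * _ / 2]mulrAC !mulr_sumr -big_split; apply: ler_sum => s _ /=.
rewrite !mulr_sumr -big_split; apply: ler_sum => m _ /=.
have amgm (a b : R) : a * b <= t / 2 * a ^+ 2 + t^-1 / 2 * b ^+ 2.
  rewrite -subr_ge0 (_ : _ - _ = (t * a - b) ^+ 2 / (2 * t)).
    by rewrite divr_ge0 ?sqr_ge0// mulr_ge0// ltW.
  by field; rewrite gt_eqF.
rewrite [leRHS](_ : _ = wt m * ((t / 2 * gc s m ^+ 2 + t^-1 / 2 * (kap m * C m s) ^+ 2) +
   (t / 2 * gs s m ^+ 2 + t^-1 / 2 * (kap m * D m s) ^+ 2))).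
  by rewrite ler_wpM2l ?wt_ge0// lerD.
by rewrite /lattice_mass -/(C m s) -/(D m s) /gc /gs; ring.
Qed.

Definition mode_energy la m : R :=
  \sum_j \sum_k c j * c k * (e j * e k * cos (m%:R * (th j - th k))) *
     la ^+ (maxn (i j) (i k) - minn (i j) (i k)).

Lemma mass_le_mode_energy la m S : (0 < m)%N -> (forall k, i k <= S)%N ->
  (1 - la ^+ 2) * \sum_(s < S) lattice_mass la m s <= mode_energy la m.
Proof.
move=> m0 iS; rewrite big_split mulrDr /=.
apply: le_trans (lerD (ker_energy la (fun k => c k * zcos m k) S iS)
                      (ker_energy la (fun k => c k * zsin m k) S iS)) _.
rewrite -big_split le_eqVlt; apply/orP; left; apply/eqP.
apply: eq_bigr => j _; rewrite -big_split; apply: eq_bigr => k _ /=.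
by rewrite /zcos /zsin gtn_eqF// mulrBr cosB; ring.
Qed.

Lemma lattice_energy_le H M S (q h : R) (kap : nat -> R) :
  (forall k, i k <= S)%N -> \sum_k c k = 0 -> 0 < h -> 0 <= q ->
  kap 0%N = 1 -> (forall m, (m < H)%N -> kap m ^+ 2 <= q ^+ m) -> (H <= M.+1)%N -> (0 < H)%N ->
  h * \sum_(s < S) \sum_(m < H) wt m * kap m ^+ 2 *
         lattice_mass (expR (- (m%:R * h))) m s <=
  (1 + 2 * M%:R * h) *
  (- (h * \sum_j \sum_k c j * c k * (maxn (i j) (i k))%:R) +
   \sum_(m < M) q ^+ m.+1 / m.+1%:R * mode_energy (expR (- (m.+1%:R * h))) m.+1).
Proof.
move=> iS c0 h0 q0 kap0 kapq HM H0.
pose la m := expR (- (m%:R * h)).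
have la1 m : 0 < 1 - la m.+1 ^+ 2.
  rewrite subr_gt0 expr_lt1 ?expR_ge0// /la expR_lt1 oppr_lt0 mulr_gt0 ?ltr0n//.
(* Each mode energy dominates a sum of squares, so the modes from [H] up to [M], absent from the
   left side, can be added. *)
have mode_ge0 m : 0 <= mode_energy (la m.+1) m.+1.
  apply: le_trans (mass_le_mode_energy _ _ _ (ltn0Sn m) iS).
  rewrite mulr_ge0 ?(ltW (la1 _))// sumr_ge0// => s _.
  by rewrite addr_ge0// sqr_ge0.
have zeroE : \sum_(s < S) lattice_mass (la 0%N) 0 s =
             - \sum_j \sum_k c j * c k * (maxn (i j) (i k))%:R.
  rewrite -(ker_energy1 c S)//; apply: eq_bigr => s _.
  rewrite /lattice_mass /zcos /zsin /= /la mul0r oppr0 expR0.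
  rewrite [X in _ + X ^+ 2]big1 ?expr0n ?addr0 => [|k _]; last first.
    by rewrite mul0r sin0 !mulr0 mul0r.
  by congr (_ ^+ 2); apply: eq_bigr => k _; rewrite mul0r cos0 !mulr1.
have zero_ge0 : 0 <= - (h * \sum_j \sum_k c j * c k * (maxn (i j) (i k))%:R).
  rewrite -mulrN -zeroE mulr_ge0 ?(ltW h0)// sumr_ge0// => s _.
  by rewrite addr_ge0// sqr_ge0.
case: H H0 HM kapq => // H _ HM kapq.
rewrite exchange_big big_ord_recl /= -mulr_sumr zeroE /wt/= kap0 expr1n !mul1r mulrDr.
rewrite mulrN mulrDr; apply: lerD.
  by rewrite ler_peMl// lerDl mulr_ge0 ?(ltW h0)// mulr_ge0.
rewrite [leLHS]mulr_sumr [leRHS]mulr_sumr.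
apply: (@le_trans _ _ (\sum_(m < H) (1 + 2 * M%:R * h) * (q ^+ m.+1 / m.+1%:R * mode_energy (la m.+1) m.+1))); last first.
  rewrite (big_ord_widen _ (fun m => (1 + 2 * M%:R * h) * (q ^+ m.+1 / m.+1%:R * mode_energy (la m.+1) m.+1)) (HM : (H <= M)%N)).
  rewrite big_mkcond; apply: ler_sum => m _; case: ifP => // _.
  by rewrite mulr_ge0 ?addr_ge0 ?mulr_ge0 ?(ltW h0) ?invr_ge0 ?exprn_ge0//; exact: mode_ge0.
apply: ler_sum => m _; rewrite /bump leq0n add1n -mulr_sumr -/(la m.+1).
set T := \sum_(s < S) _.
have T0 : 0 <= T by rewrite sumr_ge0// => s _; rewrite addr_ge0// sqr_ge0.
have mH : (m.+1 < H.+1)%N by rewrite ltnS ltn_ord.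
have TW : (1 - la m.+1 ^+ 2) * T <= mode_energy (la m.+1) m.+1.
  exact: mass_le_mode_energy.
set W := mode_energy _ _ in TW *.
set x : R := 2 * (m.+1%:R * h).
have x0 : 0 < x by rewrite /x !mulr_gt0// ltr0n.
(* From [1 - exp (- x) >= x / (1 + x)]. As [x] is [2 h] times the mode, the weight 2 and the factor
   [h] turn [1 / x] into the Fourier coefficient [1 / m] of the logarithm. The excess
   [1 + x <= 1 + 2 M h] tends to 1. *)
have xla : x / (1 + x) <= 1 - la m.+1 ^+ 2.
  rewrite -[la m.+1 ^+ 2]expRM_natl mulrN -/x expRN.
  have : 1 + x <= expR x by exact: expR_ge1Dx.
  have x1 : 0 < 1 + x by lra.
  move=> h1; have : (expR x)^-1 <= (1 + x)^-1 by rewrite lef_pV2// posrE expR_gt0.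
  rewrite (_ : x / (1 + x) = 1 - (1 + x)^-1); last by field; rewrite gt_eqF.
  lra.
have TW' : x * T <= (1 + x) * W.
  have x1 : 0 < 1 + x by lra.
  rewrite -ler_pdivrMl// mulrCA mulrA mulrC.
  rewrite (_ : T * _ = x / (1 + x) * T); last by ring.
  by apply: le_trans TW; rewrite ler_wpM2r.
have W0 : 0 <= W by exact: mode_ge0.
apply: (@le_trans _ _ (q ^+ m.+1 / m.+1%:R * (x * T))).
  rewrite (_ : q ^+ m.+1 / m.+1%:R * (x * T) = h * (2 * q ^+ m.+1 * T)); last first.
    have : (m.+1%:R : R) != 0 by rewrite pnatr_eq0.
    by rewrite /x; move: (m.+1%:R) => z z0; field.
  rewrite ler_pM2l// ler_wpM2r// ler_wpM2l//; exact: kapq.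
rewrite [leRHS]mulrCA ler_wpM2l ?mulr_ge0 ?invr_ge0 ?exprn_ge0//.
apply: (le_trans TW'); rewrite ler_wpM2r// lerD2l /x mulrA ler_wpM2r ?(ltW h0)//.
by rewrite ler_wpM2l// ler_nat (leq_trans (ltn_ord m)).
Qed.

End lattice_duality.

(** * Lipschitz functions on the polar lattice *)

Section polar_lattice.
Context {R : realType}.
Implicit Types (N H S M m j s : nat) (x y t : R).

Definition polar (rho x : R) : R[i] := Complex (rho * cos x) (rho * sin x).

Lemma normc_sqr (a b : R) : normc (Complex a b) ^+ 2 = a ^+ 2 + b ^+ 2.
Proof. by rewrite /normc sqr_sqrtr// addr_ge0 ?sqr_ge0. Qed.

Lemma normcB (z w : R[i]) : normc (z - w) = normc (w - z).
Proof. by rewrite -normcN opprB. Qed.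

Lemma normc_polar (rho x : R) : 0 <= rho -> normc (polar rho x) = rho.
Proof.
move=> rho0; apply/eqP; rewrite -(@eqrXn2 _ 2) ?normc_ge0//.
by rewrite normc_sqr !exprMn -mulrDr cos2Dsin2 mulr1.
Qed.

Lemma dist_polar (rho sig x y : R) : normc (polar rho x - polar sig y) ^+ 2 =
  (rho - sig) ^+ 2 + 2 * rho * sig * (1 - cos (x - y)).
Proof.
rewrite (_ : polar rho x - polar sig y =
   Complex (rho * cos x - sig * cos y) (rho * sin x - sig * sin y))//.
rewrite normc_sqr cosB.
transitivity (rho ^+ 2 * (cos x ^+ 2 + sin x ^+ 2) + sig ^+ 2 * (cos y ^+ 2 + sin y ^+ 2) -
  2 * rho * sig * (cos x * cos y + sin x * sin y)); first by ring.
by rewrite !cos2Dsin2; ring.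
Qed.

Lemma dist_polar_le (rho sig x y L : R) : 0 <= rho <= sig -> 0 <= L ->
  0 <= x - y <= 1 \/ 0 <= y - x <= 1 ->
  (sig - rho) ^+ 2 + sig ^+ 2 * (x - y) ^+ 2 <= L ^+ 2 ->
  normc (polar rho x - polar sig y) <= L.
Proof.
move=> /andP[rho0 rs] L0 xy h.
rewrite -(@ler_pXn2r _ 2) ?nnegrE ?normc_ge0//; apply: le_trans h.
rewrite dist_polar -[(rho - sig) ^+ 2]sqrrN opprB lerD2l.
have c : 1 - cos (x - y) <= (x - y) ^+ 2 / 2.
  case: xy => /cos_ge_parabola; first lra.
  by rewrite -(opprB x y) cosN sqrrN; lra.
have sig0 : 0 <= sig := le_trans rho0 rs.
apply: (@le_trans _ _ (2 * rho * sig * ((x - y) ^+ 2 / 2))).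
  by rewrite ler_wpM2l// !mulr_ge0.
rewrite [leLHS](_ : _ = rho * sig * (x - y) ^+ 2); last by field.
by rewrite ler_wpM2r ?sqr_ge0// expr2 ler_wpM2r.
Qed.

Lemma polar_period rho N j : (0 < N)%N ->
  polar rho (ang N * (j + N)%:R) = polar rho (ang N * j%:R).
Proof.
move=> N0; rewrite /polar; have := @cos_ang_period R N 1 j N0; rewrite !mul1r => ->.
by have := @sin_ang_period R N 1 j N0; rewrite !mul1r => ->.
Qed.

Context {A r : R} {phi : R[i] -> R}.
Context (A_gt0 : 0 < A) (r_gt0 : 0 < r)
  (phi_lip : forall z w : R[i], `|phi z - phi w| <= A * normc (z - w))
  (phi0 : forall z, r < normc z -> phi z = 0).

Let rad (u0 h : R) s : R := expR (u0 + h * s%:R).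

Let radS u0 h s : rad u0 h s.+1 = expR h * rad u0 h s.
Proof. by rewrite /rad -expRD -[s.+1%:R]natr1; congr expR; ring. Qed.

Let rad_gt0 u0 h s : 0 < rad u0 h s. Proof. exact: expR_gt0. Qed.

Let side (eta u0 h : R) s : R :=
  if rad u0 h s <= r then A * (2 * eta) * rad u0 h s.+1 else 0.

(** A Riemann sum for the integral of [2 rho] over [[0, r]], the radii being geometric. The
    invariant [B n <= rad_(n+1)^2] controls the growth while the radius is below [r]; after that
    nothing is added. The last two radial steps cost [expR (4 * h)]. *)
Lemma sum_side_sqr (eta u0 h : R) S : 0 < h ->
  \sum_(s < S) side eta u0 h s ^+ 2 <=
  A ^+ 2 * (2 * eta) ^+ 2 * (r ^+ 2 * expR (4 * h)) / (2 * h).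
Proof.
move=> h0.
pose B n := \sum_(s < n) (if rad u0 h s <= r then 2 * h * rad u0 h s.+1 ^+ 2 else 0).
have e2 : 1 + 2 * h <= expR (2 * h) by exact: expR_ge1Dx.
have radS2 s : rad u0 h s.+1 ^+ 2 = expR (2 * h) * rad u0 h s ^+ 2.
  by rewrite radS exprMn -expRM_natl.
have HB n : B n <= rad u0 h n.+1 ^+ 2 /\ B n <= r ^+ 2 * expR (4 * h).
  elim: n => [|n [ih1 ih2]].
    by rewrite /B big_ord0 sqr_ge0 mulr_ge0 ?sqr_ge0 ?expR_ge0.
  rewrite /B big_ord_recr /= -/(B n); case: ifP => rn; last first.
    rewrite addr0; split=> //; apply: (le_trans ih1).
    rewrite [leRHS]radS2 ler_peMl ?sqr_ge0//; lra.
  have h1 : B n + 2 * h * rad u0 h n.+1 ^+ 2 <= rad u0 h n.+2 ^+ 2.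
    rewrite [leRHS]radS2; apply: (@le_trans _ _ ((1 + 2 * h) * rad u0 h n.+1 ^+ 2)).
      by rewrite [leRHS](_ : _ = rad u0 h n.+1 ^+ 2 + 2 * h * rad u0 h n.+1 ^+ 2) ?lerD2r//; ring.
    by rewrite ler_wpM2r ?sqr_ge0.
  split=> //; apply: (le_trans h1).
  rewrite (radS2 n.+1) (radS2 n) mulrA -expRD mulrC (_ : 2 * h + 2 * h = 4 * h); last by ring.
  by rewrite ler_wpM2r ?expR_ge0// ler_pXn2r// nnegrE ltW.
rewrite (_ : \sum_(s < S) _ = A ^+ 2 * (2 * eta) ^+ 2 / (2 * h) * B S).
  rewrite [leRHS](_ : _ = A ^+ 2 * (2 * eta) ^+ 2 / (2 * h) * (r ^+ 2 * expR (4 * h))); last by ring.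
  apply: ler_wpM2l; last exact: (HB S).2.
  apply: divr_ge0; first by rewrite mulr_ge0 ?sqr_ge0.
  by rewrite mulr_ge0 ?(ltW h0).
rewrite /B mulr_sumr; apply: eq_bigr => s _; rewrite /side; case: ifP => _.
  by field; rewrite gt_eqF.
by rewrite expr0n mulr0.
Qed.

Let F N u0 h s j := phi (polar (rad u0 h s) (ang N * j%:R)).

(** The base subtends the angle [2 eta]; a slanted side has squared length at most
    [((17/10)^2 + 1) eta^2 <= 4 eta^2] times the squared outer radius. Once the inner circle is
    beyond [r], [phi] vanishes at all vertices. *)
Lemma side_bound N u0 h s j : h = 17 / 10 * ang N -> (0 < N)%N -> ang N <= 2^-1 :> R ->
  [/\ `|F N u0 h s j.+2 - F N u0 h s j| <= side (ang N) u0 h s,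
      `|F N u0 h s.+1 j.+1 - F N u0 h s j.+2| <= side (ang N) u0 h s
    & `|F N u0 h s.+1 j.+1 - F N u0 h s j| <= side (ang N) u0 h s].
Proof.
move=> hE N0 eta2; have eta0 := @ang_gt0 R N N0.
have h0 : 0 < h by rewrite hE mulr_gt0.
set eta := ang N in eta2 eta0 hE *.
have rr : rad u0 h s <= rad u0 h s.+1.
  by rewrite radS ler_peMl ?(ltW (rad_gt0 _ _ _))// -expR0 ler_expR ltW.
rewrite /side; case: ifPn => [_|]; last first.
  rewrite -ltNge => rs.
  have z1 k : F N u0 h s k = 0 by rewrite /F phi0// normc_polar// ltW.
  have z2 k : F N u0 h s.+1 k = 0.
    by rewrite /F phi0// normc_polar ?(ltW (rad_gt0 _ _ _))// (lt_le_trans rs).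
  by rewrite !z1 z2 subrr normr0.
have rad0 k : 0 <= rad u0 h k by exact: ltW (rad_gt0 _ _ _).
have L0 : 0 <= 2 * eta * rad u0 h s.+1.
  by apply: mulr_ge0; [apply: mulr_ge0; [|exact: ltW]|exact: rad0].
have dr : (rad u0 h s.+1 - rad u0 h s) ^+ 2 <= rad u0 h s.+1 ^+ 2 * h ^+ 2.
  rewrite -exprMn ler_pXn2r ?nnegrE ?subr_ge0 ?mulr_ge0 ?(ltW (rad_gt0 _ _ _)) ?(ltW h0)//.
  have -> : rad u0 h s = rad u0 h s.+1 * expR (- h).
    by rewrite radS mulrAC expRxMexpNx_1 mul1r.
  rewrite -{1}[rad u0 h s.+1]mulr1 -mulrBr ler_wpM2l ?(ltW (rad_gt0 _ _ _))//.
  have := expR_ge1Dx (- h); lra.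
have R2 : 0 <= rad u0 h s.+1 ^+ 2 by exact: sqr_ge0.
have key : rad u0 h s.+1 ^+ 2 * h ^+ 2 + rad u0 h s.+1 ^+ 2 * eta ^+ 2 <=
           (2 * eta * rad u0 h s.+1) ^+ 2.
  rewrite -mulrDr hE (_ : (2 * eta * _) ^+ 2 = rad u0 (17 / 10 * eta) s.+1 ^+ 2 * (4 * eta ^+ 2)); last by ring.
  rewrite ler_wpM2l ?sqr_ge0// exprMn -{2}[eta ^+ 2]mul1r -mulrDl ler_wpM2r ?sqr_ge0//.
  lra.
have lip z w : normc (z - w) <= 2 * eta * rad u0 h s.+1 ->
    `|phi z - phi w| <= A * (2 * eta) * rad u0 h s.+1.
  move=> zw; apply: (le_trans (phi_lip z w)).
  by rewrite -mulrA ler_wpM2l// ltW.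
have j1 : j.+1%:R = j%:R + 1 :> R by rewrite natr1.
have j2 : j.+2%:R = j%:R + 1 + 1 :> R by rewrite -j1 natr1.
split; apply: lip.
- apply: dist_polar_le => //; rewrite ?lexx ?(ltW (rad_gt0 _ _ _))//.
    by left; rewrite ?j2 ?j1 -/eta; apply/andP; split; lra.
  rewrite subrr expr0n add0r ?j2 ?j1 -/eta.
  rewrite (_ : _ - _ = 2 * eta); last by ring.
  have e0 : 0 <= 2 * eta by rewrite mulr_ge0// ltW.
  rewrite -exprMn [rad u0 h s * _]mulrC; apply: lerXn2r; rewrite ?nnegrE//.
    by rewrite mulr_ge0.
  by rewrite ler_wpM2l.
- rewrite normcB; apply: dist_polar_le => //; rewrite ?rr ?(ltW (rad_gt0 _ _ _))//.
    by left; rewrite ?j2 ?j1 -/eta; apply/andP; split; lra.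
  apply: le_trans key; rewrite ?j2 ?j1 -/eta (_ : eta * _ - _ = eta); last by ring.
  by rewrite lerD2r.
- rewrite normcB; apply: dist_polar_le => //; rewrite ?rr ?(ltW (rad_gt0 _ _ _))//.
    by right; rewrite ?j2 ?j1 -/eta; apply/andP; split; lra.
  apply: le_trans key; rewrite ?j2 ?j1 -/eta (_ : eta * _ - _ = - eta); last by ring.
  by rewrite sqrrN lerD2r.
Qed.

Lemma fejer_value N H (rho x : R) : (1 < H)%N -> (H < N)%N -> 0 <= rho ->
  `|mean N (fun j => fejer H (x - ang N * j%:R) * phi (polar rho (ang N * j%:R)))
    - phi (polar rho x)| <= A * r * Num.sqrt (2 / H%:R).
Proof.
move=> H1 HN rho0; have [rr|rr] := leP rho r; last first.
  have z y : phi (polar rho y) = 0 by rewrite phi0// normc_polar.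
  rewrite z subr0 (eq_mean _ _ (fun=> 0)); last by move=> j; rewrite z mulr0.
  rewrite mean_cst ?normr0; last by lia.
  by rewrite !mulr_ge0 ?sqrtr_ge0// ltW.
apply: (@le_trans _ _ (A * rho * Num.sqrt (2 / H%:R))); last first.
  by rewrite ler_wpM2r ?sqrtr_ge0// ler_wpM2l// ltW.
apply: (@fejer_smoothing _ _ _ _ _ _ _ (fun j => normc (polar 1 (ang N * j%:R) - polar 1 x))) => //.
- by rewrite mulr_ge0// ltW.
- move=> j; rewrite dist_polar subrr expr0n add0r !mulr1 mulrBr mulr1.
  by rewrite -(opprB x) cosN.
- move=> j; apply: (le_trans (phi_lip _ _)); rewrite -mulrA ler_wpM2l ?(ltW A_gt0)//.
  rewrite -(@ler_pXn2r _ 2) ?nnegrE ?mulr_ge0 ?normc_ge0// exprMn !dist_polar.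
  by rewrite !subrr !expr0n !add0r !mulr1 le_eqVlt; apply/orP; left; apply/eqP; ring.
Qed.

End polar_lattice.

(** * The regularized logarithmic energy *)

Section energy.
Context {R : realType} {K : finType} (c e th : K -> R) (q : R).
Implicit Types (N H S M m s : nat) (u : K -> R).

(* The Fourier series of [- ln |z_j - z_k|], truncated to [M] modes, with the
   [m]th mode damped by [q ^ m]. *)
Definition log_kernel u M (j k : K) : R :=
  - Num.max (u j) (u k) + \sum_(m < M) q ^+ m.+1 / m.+1%:R *
     (e j * e k * cos (m.+1%:R * (th j - th k)) *
      expR (- (m.+1%:R * `|u j - u k|))).

Definition energy u M : R := \sum_j \sum_k c j * c k * log_kernel u M j k.

Lemma radius_gap (a b x : R) : 0 <= a * x -> a * (1 - 17 / 10 * x) <= b ->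
  a - b <= 2 * (a * x).
Proof. by move=> ax ab; lra. Qed.

Lemma max_lattice (u0 h : R) (a b : nat) : 0 < h ->
  Num.max (u0 + h * a%:R) (u0 + h * b%:R) = u0 + h * (maxn a b)%:R.
Proof.
move=> h0; wlog ab : a b / (a <= b)%N.
  move=> W; have [ab|ba] := orP (leq_total a b); first exact: W.
  by rewrite maxC maxnC W.
by rewrite (maxn_idPr ab) (max_idPr _)// lerD2l ler_pM2l// ler_nat.
Qed.

Lemma dist_lattice (u0 h : R) (a b : nat) : 0 < h ->
  `|(u0 + h * a%:R) - (u0 + h * b%:R)| = h * (maxn a b - minn a b)%:R.
Proof.
move=> h0; wlog ab : a b / (a <= b)%N.
  move=> W; have [ab|ba] := orP (leq_total a b); first exact: W.
  by rewrite distrC maxnC minnC W.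
rewrite (maxn_idPr ab) (minn_idPl ab) distrC natrB//.
rewrite (_ : _ - _ = h * (b%:R - a%:R)); last by ring.
by rewrite ger0_norm// mulr_ge0 ?(ltW h0)// subr_ge0 ler_nat.
Qed.

(** The offset [u0] in the radii contributes [u0] times the squared total mass, hence nothing. *)
Lemma energy_lattice (i : K -> nat) (u0 h : R) M : 0 < h -> \sum_k c k = 0 ->
  energy (fun k => u0 + h * (i k)%:R) M =
  - (h * \sum_j \sum_k c j * c k * (maxn (i j) (i k))%:R) +
   \sum_(m < M) q ^+ m.+1 / m.+1%:R * mode_energy i c e th (expR (- (m.+1%:R * h))) m.+1.
Proof.
move=> h0 c0.
have -> : - (h * \sum_j \sum_k c j * c k * (maxn (i j) (i k))%:R) =
    \sum_j \sum_k c j * c k * - (u0 + h * (maxn (i j) (i k))%:R).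
  rewrite mulr_sumr -sumrN; apply: eq_bigr => j _; rewrite mulr_sumr -sumrN.
  have z : \sum_k u0 * c j * c k = 0 by rewrite -mulr_sumr c0 mulr0.
  transitivity (\sum_k - (h * (c j * c k * (maxn (i j) (i k))%:R)) - \sum_k u0 * c j * c k); first by rewrite z subr0.
  by rewrite -sumrB; apply: eq_bigr => k _; ring.
under [X in _ = _ + X]eq_bigr do rewrite /mode_energy mulr_sumr.
rewrite [X in _ = _ + X]exchange_big -big_split; apply: eq_bigr => j _ /=.
under [X in _ = _ + X]eq_bigr do rewrite mulr_sumr.
rewrite [X in _ = _ + X]exchange_big -big_split; apply: eq_bigr => k _ /=.
rewrite /log_kernel max_lattice// dist_lattice// mulrDr; congr (_ + _).
rewrite mulr_sumr; apply: eq_bigr => m _.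
have -> : expR (- (m.+1%:R * h)) ^+ (maxn (i j) (i k) - minn (i j) (i k)) =
          expR (- (m.+1%:R * (h * (maxn (i j) (i k) - minn (i j) (i k))%:R))).
  by rewrite -expRM_natl; congr expR; ring.
ring.
Qed.

Lemma expRN_lipschitz (x y : R) : 0 <= x -> 0 <= y ->
  `|expR (- x) - expR (- y)| <= `|x - y|.
Proof.
wlog xy : x y / x <= y.
  move=> W x0 y0; have [xy|yx] := orP (le_total x y); first exact: W.
  by rewrite distrC (distrC x) W.
move=> x0 y0; rewrite ger0_norm ?subr_ge0 ?ler_expR ?lerN2//.
rewrite distrC ger0_norm ?subr_ge0//.
rewrite (_ : - y = - x - (y - x)); last by ring.
rewrite expRD; have h1 := expR_ge1Dx (- (y - x)).
have h2 : expR (- x) <= 1 by rewrite expR_le1 oppr_le0.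
have h3 := expR_ge0 (- x).
have h4 : expR (- (y - x)) <= 1 by rewrite expR_le1 oppr_le0 subr_ge0.
move: (expR (- x)) (expR (- (y - x))) h1 h2 h3 h4 => a b h1 h2 h3 h4.
apply: (@le_trans _ _ (1 - b)); last lra.
by rewrite -{1}[a]mulr1 -mulrBr ler_piMl// subr_ge0.
Qed.

(** The factor [1 / m] cancels the slope [m] of [exp (- m |u_j - u_k|)], so each of the [M] modes,
    like the maximum, changes by at most [h]. *)
Lemma energy_perturb u u' (h : R) M : 0 <= q <= 1 -> (forall k, `|e k| <= 1) ->
  (forall k, 0 <= u k - u' k <= h) ->
  energy u' M <= energy u M + (\sum_k `|c k|) ^+ 2 * (1 + M%:R) * h.
Proof.
move=> /andP[q0 q1] e1 uh.
have kerB j k : `|log_kernel u' M j k - log_kernel u M j k| <= (1 + M%:R) * h.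
  have /andP[j1 j2] := uh j; have /andP[k1 k2] := uh k.
  rewrite /log_kernel opprD opprK addrACA -sumrB mulrDl mul1r.
  apply: (le_trans (ler_normD _ _)); apply: lerD.
    rewrite /Num.max ler_norml; case: ifPn; case: ifPn; rewrite -?leNgt;
      by move=> *; apply/andP; split; lra.
  apply: (le_trans (ler_norm_sum _ _ _)).
  rewrite mulr_natl -[M in leRHS]card_ord -sumr_const; apply: ler_sum => m _.
  rewrite -!mulrBr !normrM.
  have m0 : 0 < m.+1%:R :> R by rewrite ltr0n.
  have hE : `|expR (- (m.+1%:R * `|u' j - u' k|)) - expR (- (m.+1%:R * `|u j - u k|))| <= m.+1%:R * h.
    apply: (le_trans (expRN_lipschitz _ _ _ _)); rewrite ?mulr_ge0 ?(ltW m0)//.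
    rewrite -mulrBr normrM ger0_norm ?(ltW m0)// ler_pM2l//.
    apply: (le_trans (ler_dist_dist _ _)).
    by rewrite ler_norml; apply/andP; split; lra.
  rewrite ger0_norm ?exprn_ge0// ger0_norm ?invr_ge0 ?(ltW m0)//.
  have h0 : 0 <= h by lra.
  apply: (@le_trans _ _ (1 / m.+1%:R * (1 * (m.+1%:R * h)))); last first.
    by rewrite mul1r mul1r mulKf// gt_eqF.
  apply: ler_pM => //; rewrite ?mulr_ge0 ?exprn_ge0 ?invr_ge0 ?(ltW m0)//.
    by rewrite ler_wpM2r ?invr_ge0 ?(ltW m0)// exprn_ile1.
  apply: ler_pM => //; rewrite ?mulr_ge0//.
  rewrite -(mulr1 1); apply: ler_pM => //; rewrite ?mulr_ge0 ?cos_max//.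
  by rewrite -(mulr1 1); apply: ler_pM.
rewrite -lerBlDl; apply: (le_trans (ler_norm _)).
rewrite /energy -sumrB; apply: (le_trans (ler_norm_sum _ _ _)).
have -> : (\sum_k `|c k|) ^+ 2 * (1 + M%:R) * h =
    \sum_j \sum_k `|c j| * `|c k| * ((1 + M%:R) * h).
  rewrite expr2 -mulrA !mulr_suml; apply: eq_bigr => j _.
  by rewrite mulr_sumr mulr_suml.
apply: ler_sum => j _.
rewrite -sumrB; apply: (le_trans (ler_norm_sum _ _ _)); apply: ler_sum => k _.
by rewrite -mulrBr !normrM ler_wpM2l// mulr_ge0.
Qed.

End energy.

(** * Duality on a single lattice *)

Section energy_bound.
Context {R : realType} {A r : R} {phi : R[i] -> R}.
Context (A_gt0 : 0 < A) (r_gt0 : 0 < r)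
  (phi_lip : forall z w : R[i], `|phi z - phi w| <= A * normc (z - w))
  (phi0 : forall z, r < normc z -> phi z = 0).
Context {K : finType} {c e th u v err Cst : K -> R} {q : R} {H : nat}.
Context (H1 : (1 < H)%N) (q01 : 0 <= q <= 1)
  (kapq : forall m, (m < H)%N -> (1 - m%:R / H%:R) ^+ 2 <= q ^+ m)
  (c_sum : \sum_k c k = 0) (e01 : forall k, e k = 0 \/ e k = 1)
  (v1 : forall k, e k = 1 -> [/\ v k = phi (polar (expR (u k)) (th k)),
     A * r * Num.sqrt (2 / H%:R) <= err k & 2 * A * expR (u k) <= Cst k])
  (v0 : forall k N (rho : R), e k = 0 -> (0 < N)%N ->
     expR (u k - 17 / 10 * ang N) <= rho <= expR (u k) ->
     `|mean N (fun j => phi (polar rho (ang N * j%:R))) - v k| <= err k + Cst k * ang N).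

Let X := \sum_k c k * v k.

(** Only the radii are rounded to the lattice: trigonometric polynomials can be evaluated at any
    angle. Every term with a factor [ang N] is an error of the discretization, and
    [34/5 = 4 * 17/10] comes from [sum_side_sqr]. *)
Lemma energy_bound_lattice N M (t : R) : 0 < t -> (H <= M)%N -> (2 * H < N)%N ->
  H%:R * ang N <= 100^-1 :> R ->
  X <= \sum_k `|c k| * (err k + Cst k * ang N) +
   (t * (200 / 289 * (A ^+ 2 * r ^+ 2) * expR (34 / 5 * ang N) + 10 / 17 * A ^+ 2 * ang N) +
    t^-1 * ((1 + 2 * M%:R * (17 / 10 * ang N)) *
      (energy c e th q u M + (\sum_k `|c k|) ^+ 2 * (1 + M%:R) * (17 / 10 * ang N)))) / 2.
Proof.
move=> t0 HM HN Hsmall; have N0 : (0 < N)%N by lia.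
have HN' : (H < N)%N by lia.
have eta0 := @ang_gt0 R N N0; set eta := ang N in eta0 Hsmall *.
have eta1 : eta <= 100^-1.
  apply: le_trans Hsmall; rewrite ler_peMl ?(ltW eta0)//.
  by rewrite (ler_nat R 1); lia.
pose h := 17 / 10 * eta; have h0 : 0 < h by rewrite mulr_gt0.
(* The innermost radius [exp u0] lies inside all the points and is at most [eta], so that [phi]
   deviates from [phi 0] there by at most [A eta]. *)
pose B := \sum_k `|u k|; pose u0 := ln eta - B.
have u0u k : u0 <= u k.
  have : `|u k| <= B by rewrite /B (bigD1 k)//= lerDl sumr_ge0.
  rewrite ler_norml => /andP[uk _].
  have : ln eta <= 0 by apply: ln_le0; lra.
  by rewrite /u0; lra.
pose i k := Num.truncn ((u k - u0) / h).
have iP k : 0 <= u k - (u0 + h * (i k)%:R) <= h.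
  have x0 : 0 <= (u k - u0) / h by rewrite divr_ge0 ?subr_ge0 ?(ltW h0).
  have := truncn_itv x0; rewrite -/(i k) ler_pdivlMr// ltr_pdivrMr// -natr1.
  by move=> /andP[a b]; apply/andP; split; lra.
have irho k : expR (u k - h) <= expR (u0 + h * (i k)%:R) <= expR (u k).
  by have /andP[i1 i2] := iP k; rewrite !ler_expR; apply/andP; split; lra.
(* The outermost circle lies beyond every point and beyond radius [r], where [phi] vanishes. *)
pose S := (\sum_k i k + (Num.truncn ((ln r - u0) / h)).+1)%N.
have iS k : (i k <= S)%N.
  by rewrite /S (bigD1 k)//= -addnA leq_addr.
have rS : r < expR (u0 + h * S%:R).
  rewrite -{1}[r]lnK ?posrE// ltr_expR.
  have : (ln r - u0) / h < S%:R.
    apply: (lt_le_trans (truncnS_gt _)); rewrite ler_nat /S leq_addl//.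
  by rewrite ltr_pdivrMr//; lra.
pose F s j := phi (polar (expR (u0 + h * s%:R)) (ang N * j%:R)).
pose la m := expR (- (17 / 10 * (m%:R * ang N))) : R.
have laE m : la m = expR (- (m%:R * h)) by rewrite /la /h -/eta; congr expR; ring.
pose L s := if expR (u0 + h * s%:R) <= r then A * (2 * ang N) * expR (u0 + h * s.+1%:R) else 0.
have Fper s j : F s (j + N)%N = F s j by rewrite /F polar_period.
have FS j : F S j = 0 by rewrite /F phi0// normc_polar// ltW// expR_gt0.
have D1 := @lattice_dirichlet R N H S F L (phi 0) (ltnW H1) (ltnW HN) Hsmall Fper FS
  (fun s j _ => side_bound A_gt0 phi_lip phi0 N u0 h s j erefl N0 ltac:(rewrite -/eta; lra)) la (fun=> erefl).
have D2 := sum_side_sqr r_gt0 (A := A) (ang N) u0 h S h0.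
have D3 : mean N (fun j => (F 0%N j - phi 0) ^+ 2) <= A ^+ 2 * eta ^+ 2.
  rewrite -(@mean_cst R N (A ^+ 2 * _) N0); apply: ler_mean => j.
  rewrite -real_normK ?num_real// -exprMn ler_pXn2r ?nnegrE//; last exact: mulr_ge0 (ltW A_gt0) (ltW eta0).
  apply: (le_trans (phi_lip _ _)); rewrite ler_pM2l// subr0 normc_polar ?expR_ge0//.
  rewrite -[leRHS]lnK ?posrE// ler_expR mulr0 addr0 /u0 gerBl.
  by rewrite sumr_ge0.
pose kap m : R := 1 - m%:R / H%:R.
have kap0 : kap 0%N = 1 by rewrite /kap mul0r subr0.
have E1 := @lattice_energy_le R K i c e th H M S q h kap iS c_sum h0
  (proj1 (andP q01)) kap0 kapq (leq_trans HM (leqnSn _)) (ltnW H1).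
rewrite -(energy_lattice c e th q i u0 h M h0 c_sum) in E1.
have eN k : `|e k| <= 1 by have [->|->] := e01 k; rewrite ?normr0 ?normr1.
have E2 := energy_perturb c e th q u (fun k => u0 + h * (i k)%:R) h M q01 eN iP.
pose T k := \sum_(m < H) wt m * kap m *
     (cosc N (F (i k)) m * zcos e th m k + sinc N (F (i k)) m * zsin e th m k).
have FSc m : cosc N (F S) m = 0.
  by rewrite /cosc; under eq_mean => j0 do rewrite FS mul0r; rewrite mean_cst.
have FSs m : sinc N (F S) m = 0.
  by rewrite /sinc; under eq_mean => j0 do rewrite FS mul0r; rewrite mean_cst.
have dual := @duality R K i c e th H S kap la (fun s => cosc N (F s)) (fun s => sinc N (F s))
  (t / h) (divr_gt0 t0 h0) iS FSc FSs.
have Tv k : `|v k - T k| <= err k + Cst k * eta.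
  (* For a smeared point only mode 0 remains, and the Fejer mean is the plain average over the
     circle. *)
  have [e0|e1] := e01 k.
    suff -> : T k = mean N (F (i k)) by rewrite distrC; exact: v0.
    rewrite /T (bigD1 (Ordinal (ltnW H1)))//= big1 ?addr0 => [|m]; last first.
      by rewrite -val_eqE /= /zcos /zsin => /negbTE ->; rewrite e0 !mul0r !mulr0 addr0 mulr0.
    rewrite /wt /= kap0 /zcos /zsin /= !mul0r cos0 sin0 !mulr0 addr0 !mul1r !mulr1.
    by apply: eq_mean => j0; rewrite mul0r cos0 mulr1.
  have [vk errk Ck] := v1 k e1.
  have -> : T k = mean N (fun j => fejer H (th k - ang N * j%:R) * F (i k) j).
    rewrite mean_fejerE; apply: eq_bigr => m _.
    by rewrite /zcos /zsin e1 if_same !mul1r.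
  have f1 := fejer_value A_gt0 r_gt0 phi_lip phi0 N H (expR (u0 + h * (i k)%:R)) (th k) H1
     HN' (expR_ge0 _).
  have f2 : `|phi (polar (expR (u k)) (th k)) - phi (polar (expR (u0 + h * (i k)%:R)) (th k))| <=
            2 * A * expR (u k) * eta.
    apply: (le_trans (phi_lip _ _)).
    rewrite [leRHS](_ : _ = A * (2 * (expR (u k) * eta))) ?ler_pM2l//; last by ring.
    have ae : 0 <= expR (u k) * eta by exact: mulr_ge0 (expR_ge0 _) (ltW eta0).
    have ae2 : 0 <= 2 * (expR (u k) * eta) by exact: mulr_ge0.
    have /andP[r1 r2] := irho k.
    rewrite -(@ler_pXn2r _ 2) ?nnegrE ?normc_ge0//.
    rewrite dist_polar subrr cos0 subrr mulr0 addr0 ler_pXn2r ?nnegrE ?subr_ge0//.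
    have : expR (u k) * (1 - h) <= expR (u0 + h * (i k)%:R).
      by apply: le_trans r1; rewrite expRD ler_wpM2l ?expR_ge0//; exact: expR_ge1Dx.
    by rewrite /h => ab; exact: radius_gap.
  rewrite vk -(subrKA (phi (polar (expR (u0 + h * (i k)%:R)) (th k)))).
  apply: (le_trans (ler_normD _ _)); rewrite addrC; apply: lerD.
    by rewrite distrC (le_trans f1).
  by apply: (le_trans f2); rewrite ler_pM2r.
have XT : X <= \sum_k `|c k| * (err k + Cst k * eta) + \sum_k c k * T k.
  rewrite /X -lerBlDr -sumrB; apply: (le_trans (ler_norm _)).
  apply: (le_trans (ler_norm_sum _ _ _)); apply: ler_sum => k _.
  by rewrite -mulrBr normrM ler_wpM2l.
apply: (le_trans XT); rewrite lerD2l; apply: (le_trans dual).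
rewrite ler_pM2r ?invr_gt0//; apply: lerD.
  rewrite -mulrA ler_pM2l// mulrC ler_pdivrMr//.
  apply: (le_trans D1); apply: (le_trans (lerD D2 D3)).
  rewrite le_eqVlt; apply/orP; left; apply/eqP.
  rewrite -/eta /h (_ : 4 * (17 / 10 * eta) = 34 / 5 * eta); last by field.
  by field; rewrite gt_eqF.
rewrite (_ : (t / h)^-1 = t^-1 * h); last by rewrite invf_div mulrC.
rewrite -[leLHS]mulrA ler_pM2l ?invr_gt0//.
have -> : \sum_(s < S) \sum_(m < H) wt m * kap m ^+ 2 * lattice_mass i c e th (la m) m s =
  \sum_(s < S) \sum_(m < H) wt m * kap m ^+ 2 * lattice_mass i c e th (expR (- (m%:R * h))) m s.
  by apply: eq_bigr => s _; apply: eq_bigr => m _; rewrite laE.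
apply: (le_trans E1); rewrite -/h ler_wpM2l//.
apply: addr_ge0 => //; apply: mulr_ge0; [exact: mulr_ge0|exact: ltW].
Qed.

End energy_bound.

Lemma cvg_ang (R : realType) : @ang R n.+1 @[n --> \oo] --> (0 : R).
Proof.
rewrite -[X in _ --> X](mulr0 (2 * pi)); apply: cvgM; first exact: cvg_cst.
exact: cvg_harmonic.
Qed.

(** * The limit of fine lattices *)

Section energy_bound.
Context {R : realType} {A r : R} {phi : R[i] -> R}.
Context (A_gt0 : 0 < A) (r_gt0 : 0 < r)
  (phi_lip : forall z w : R[i], `|phi z - phi w| <= A * normc (z - w))
  (phi0 : forall z, r < normc z -> phi z = 0).
Context {K : finType} {c e th u v err Cst : K -> R} {q : R} {H : nat}.
Context (H1 : (1 < H)%N) (q01 : 0 <= q <= 1)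
  (kapq : forall m, (m < H)%N -> (1 - m%:R / H%:R) ^+ 2 <= q ^+ m)
  (c_sum : \sum_k c k = 0) (e01 : forall k, e k = 0 \/ e k = 1)
  (v1 : forall k, e k = 1 -> [/\ v k = phi (polar (expR (u k)) (th k)),
     A * r * Num.sqrt (2 / H%:R) <= err k & 2 * A * expR (u k) <= Cst k])
  (v0 : forall k N (rho : R), e k = 0 -> (0 < N)%N ->
     expR (u k - 17 / 10 * ang N) <= rho <= expR (u k) ->
     `|mean N (fun j => phi (polar rho (ang N * j%:R))) - v k| <= err k + Cst k * ang N).

Lemma energy_bound_amgm M (t : R) : 0 < t -> (H <= M)%N ->
  \sum_k c k * v k <= \sum_k `|c k| * err k +
   (t * (200 / 289 * (A ^+ 2 * r ^+ 2)) + t^-1 * energy c e th q u M) / 2.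
Proof.
move=> t0 HM.
(* With [M] and [t] fixed, the bound on the lattice is a continuous function of [ang N]; its value
   at 0 is the claim. *)
pose g (x : R) := \sum_k `|c k| * err k + (\sum_k `|c k| * Cst k) * x +
   (t * (200 / 289 * (A ^+ 2 * r ^+ 2) * expR (34 / 5 * x) + 10 / 17 * A ^+ 2 * x) +
    t^-1 * ((1 + 2 * M%:R * (17 / 10 * x)) *
      (energy c e th q u M + (\sum_k `|c k|) ^+ 2 * (1 + M%:R) * (17 / 10 * x)))) / 2.
have gcvg : g (ang n.+1) @[n --> \oo] --> g 0.
  have a0 := @cvg_ang R.
  have e0 : expR (34 / 5 * @ang R n.+1) @[n --> \oo] --> expR (34 / 5 * (0 : R)).
    apply: continuous_cvg; first exact: continuous_expR.
    by apply: cvgM => //; exact: cvg_cst.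
  by do ?[exact: a0 | exact: e0 | exact: cvg_cst | apply: cvgD | apply: cvgM].
have -> : \sum_k `|c k| * err k +
   (t * (200 / 289 * (A ^+ 2 * r ^+ 2)) + t^-1 * energy c e th q u M) / 2 = g 0.
  by rewrite /g !mulr0 expR0 !addr0 mul1r !mulr1.
rewrite -(cvg_lim _ gcvg)//; apply: limr_ge; first by apply/cvg_ex; exists (g 0).
have bnd := cvgr_le _ (cvg_ang R) (100^-1 / H%:R) ltac:(by rewrite divr_gt0// ltr0n ltnW).
near=> n.
have -> : g (ang n.+1) = \sum_k `|c k| * (err k + Cst k * ang n.+1) +
   (t * (200 / 289 * (A ^+ 2 * r ^+ 2) * expR (34 / 5 * ang n.+1) + 10 / 17 * A ^+ 2 * ang n.+1) +
    t^-1 * ((1 + 2 * M%:R * (17 / 10 * ang n.+1)) *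
      (energy c e th q u M + (\sum_k `|c k|) ^+ 2 * (1 + M%:R) * (17 / 10 * ang n.+1)))) / 2.
  rewrite /g; congr (_ + _); rewrite mulr_suml -big_split /=.
  by apply: eq_bigr => k _; ring.
apply: (energy_bound_lattice A_gt0 r_gt0 phi_lip phi0 H1 q01 kapq c_sum e01 v1 v0) => //.
  by rewrite ltnS; near: n; exact: nbhs_infty_ge.
rewrite mulrC -ler_pdivlMr ?ltr0n 1?ltnW//.
by near: n; exact: bnd.
Unshelve. all: by end_near.
Qed.

End energy_bound.

(** * Comparison with the logarithmic kernel *)

Section log_kernel.
Context {R : realType}.
Implicit Types (x y q theta : R) (M m : nat).

Let D c y : R := 1 - 2 * y * c + y ^+ 2.

Lemma quadratic_ge c y : `|c| <= 1 -> 0 <= y -> (1 - y) ^+ 2 <= 1 - 2 * y * c + y ^+ 2.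
Proof. by rewrite ler_norml => /andP[_ c1] y0; nra. Qed.

Lemma log_series_derive (a : nat -> R) M y :
  is_derive y 1 (fun z => \sum_(m < M) a m / m.+1%:R * z ^+ m.+1)
    (\sum_(m < M) a m * y ^+ m).
Proof.
elim: M => [|M ih].
  rewrite big_ord0 (_ : (fun z => _) = cst 0); last by apply/funext => z; rewrite big_ord0.
  exact: is_derive_cst.
rewrite big_ord_recr (_ : (fun z => _) = (fun z => \sum_(m < M) a m / m.+1%:R * z ^+ m.+1) +
  (fun z => a M / M.+1%:R * z ^+ M.+1)); last by apply/funext => z; rewrite big_ord_recr.
apply: is_deriveD.
have -> : (fun z : R => a M / M.+1%:R * z ^+ M.+1) = a M / M.+1%:R \*: (id ^+ M.+1).
  by apply/funext => z; rewrite /= exprfctE.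
apply: is_derive_eq (is_deriveZ (a M / M.+1%:R) (is_deriveX M.+1 (is_derive_id y 1))) _.
rewrite /GRing.scale /=.
have : (M.+1%:R : R) != 0 by rewrite pnatr_eq0.
by move: (M.+1%:R) => z z0; field.
Qed.

(** The real part of a geometric sum, cleared of its denominator [|1 - y exp (i theta)|^2]. *)
Lemma geometric_cos theta y M :
  (1 - 2 * y * cos theta + y ^+ 2) * \sum_(m < M) cos (m.+1%:R * theta) * y ^+ m =
  cos theta - y - y ^+ M * cos (M.+1%:R * theta) + y ^+ M.+1 * cos (M%:R * theta).
Proof.
elim: M => [|M ih].
  by rewrite big_ord0 mulr0 expr0 expr1 !mul1r mul0r cos0 mulr1; ring.
rewrite big_ord_recr /= mulrDr ih.
have -> : cos (M.+2%:R * theta) = 2 * cos theta * cos (M.+1%:R * theta) - cos (M%:R * theta).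
  rewrite (_ : M.+2%:R * theta = M.+1%:R * theta + theta); last by rewrite -[M.+2%:R]natr1; ring.
  rewrite (_ : M%:R * theta = M.+1%:R * theta - theta); last by rewrite -[M.+1%:R]natr1; ring.
  by rewrite cosB cosD; ring.
rewrite !exprS; ring.
Qed.

(** The partial sum plus half the logarithm vanishes at [y = 0]. By [geometric_cos] its derivative
    is only the tail of order [M] divided by [|1 - y exp (i theta)|^2 >= (1 - q)^2], so the mean
    value theorem suffices. *)
Lemma log_series_le theta q y M : 0 <= y <= q -> q < 1 ->
  \sum_(m < M) y ^+ m.+1 / m.+1%:R * cos (m.+1%:R * theta) <=
  - (ln (1 - 2 * y * cos theta + y ^+ 2) / 2) + 2 * q ^+ M / (1 - q) ^+ 2.
Proof.
move=> /andP[y0 yq] q1; have q0 := le_trans y0 yq.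
have eps0 : 0 <= 2 * q ^+ M / (1 - q) ^+ 2.
  by rewrite divr_ge0 ?sqr_ge0// mulr_ge0// exprn_ge0.
rewrite -lerBlDl opprK.
move: y0; rewrite le_eqVlt => /predU1P[<-|y0].
  rewrite big1 => [|m _]; last by rewrite expr0n !mul0r.
  by rewrite mulr0 mul0r subr0 expr0n addr0 ln1 mul0r addr0.
set c := cos theta.
have Dpos z : 0 <= z <= q -> 0 < D c z.
  move=> /andP[z0 zq]; apply: lt_le_trans (quadratic_ge c z (cos_max _) z0).
  by rewrite exprn_gt0// subr_gt0 (le_lt_trans zq).
pose G z := \sum_(m < M) cos (m.+1%:R * theta) / m.+1%:R * z ^+ m.+1 + 2^-1 * ln (D c z).
pose dG z := \sum_(m < M) cos (m.+1%:R * theta) * z ^+ m + (z - c) / D c z.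
have GE : \sum_(m < M) y ^+ m.+1 / m.+1%:R * cos (m.+1%:R * theta) +
    ln (1 - 2 * y * c + y ^+ 2) / 2 = G y.
  rewrite /G [2^-1 * _]mulrC; congr (_ + _); apply: eq_bigr => m _; ring.
rewrite GE.
have derG z : 0 <= z <= q -> is_derive z 1 G (dG z).
  move=> zq; have Dz := Dpos z zq.
  have dD : is_derive z 1 (D c) (2 * (z - c)).
    have -> : D c = (cst 1 + (- (2 * c)) \*: id) + id ^+ 2.
      apply/funext => w; rewrite /D.
      transitivity (1 + (- (2 * c)) * w + w ^+ 2); [by ring|by []].
    apply: is_derive_eq (is_deriveD (is_deriveD (is_derive_cst (1 : R) z 1)
      (is_deriveZ (- (2 * c)) (is_derive_id z 1))) (is_deriveX 2 (is_derive_id z 1))) _.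
    by rewrite /GRing.scale /=; ring.
  have dln : is_derive z 1 (fun z => ln (D c z)) ((D c z)^-1 * (2 * (z - c))).
    exact: is_derive1_comp (is_derive1_ln Dz) dD.
  have -> : G = (fun z => \sum_(m < M) cos (m.+1%:R * theta) / m.+1%:R * z ^+ m.+1) +
      2^-1 \*: (fun z => ln (D c z)) by [].
  apply: is_derive_eq (is_deriveD (log_series_derive (fun m => cos (m.+1%:R * theta)) M z)
    (is_deriveZ 2^-1 dln)) _.
  by rewrite /dG /GRing.scale /=; congr (_ + _); field; rewrite gt_eqF.
have [z zy E] : exists2 z, z \in `]0, y[ & G y - G 0 = dG z * (y - 0).
  apply: MVT => //.
    by move=> z; rewrite in_itv /= => /andP[z0 zy]; apply: derG; rewrite ltW//= (le_trans (ltW zy)).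
  apply: derivable_within_continuous => z; rewrite in_itv /= => /andP[z0 zy].
  by have [] := derG z; rewrite ?z0 ?(le_trans zy).
move: zy; rewrite in_itv /= => /andP[z0 zy].
have zq : 0 <= z <= q by rewrite ltW//= (le_trans (ltW zy)).
have G0 : G 0 = 0.
  rewrite /G big1 => [|m _]; last by rewrite expr0n mulr0.
  by rewrite /D mulr0 mul0r subr0 expr0n addr0 ln1 mulr0 addr0.
move: E; rewrite G0 !subr0 => ->.
have D0 := Dpos z zq.
have dGE : dG z = (z ^+ M.+1 * cos (M%:R * theta) - z ^+ M * cos (M.+1%:R * theta)) / D c z.
  have Dn : D c z != 0 by rewrite gt_eqF.
  apply: (mulfI Dn).
  rewrite /dG mulrDr {1}/D geometric_cos -/c.
  by field; rewrite gt_eqF.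
have zM : z ^+ M <= q ^+ M by rewrite lerXn2r ?nnegrE ?(ltW z0)//; case/andP: zq.
have dGle : dG z <= 2 * q ^+ M / (1 - q) ^+ 2.
  have zM0 : 0 <= z ^+ M by rewrite exprn_ge0// ltW.
  rewrite dGE; apply: (@le_trans _ _ (2 * q ^+ M / D c z)).
    rewrite ler_wpM2r ?invr_ge0 ?(ltW D0)//; apply: (@le_trans _ _ (2 * z ^+ M)); last by rewrite ler_wpM2l.
    have z1 : z ^+ M.+1 <= z ^+ M.
      by rewrite exprS ler_piMl// (le_trans _ (ltW q1))//; case/andP: zq.
    have h1 : z ^+ M.+1 * cos (M%:R * theta) <= z ^+ M.+1.
      by rewrite ler_piMr ?cos_le1// exprn_ge0// ltW.
    have h2 : - z ^+ M <= z ^+ M * cos (M.+1%:R * theta).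
      by rewrite -mulrN1 ler_wpM2l// cos_geN1.
    lra.
  rewrite ler_wpM2l ?mulr_ge0 ?exprn_ge0// lef_pV2 ?posrE ?exprn_gt0 ?subr_gt0//.
  apply: le_trans (quadratic_ge c z (cos_max _) (ltW z0)).
  rewrite lerXn2r ?nnegrE ?subr_ge0 ?(ltW q1) ?lerB//; case/andP: zq => // _ zq.
  by rewrite (le_trans zq) ?ltW.
apply: (@le_trans _ _ (2 * q ^+ M / (1 - q) ^+ 2 * y)).
  by rewrite ler_wpM2r// ltW.
by rewrite ler_piMr// (le_trans yq) ?ltW.
Qed.

(** Both sides are affine in [c], so it is enough to compare them at [c = 1] and [c = -1], where
    they are squares; the weights of the combination are [(1 + c) / 2] and [(1 - c) / 2]. *)
Lemma quadratic_smoothing c q x : `|c| <= 1 -> 0 <= q <= 1 -> 0 <= x <= 1 ->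
  ((1 + q) / 2) ^+ 2 * (1 - 2 * x * c + x ^+ 2) <=
  1 - 2 * (q * x) * c + (q * x) ^+ 2.
Proof.
rewrite ler_norml => /andP[c0 c1] /andP[q0 q1] /andP[x0 x1].
have qx : 0 <= (1 - q) * (1 - x) by rewrite mulr_ge0// subr_ge0.
have a1 : (1 + q) / 2 * (1 + x) <= 1 + q * x by lra.
have a2 : (1 + q) / 2 * (1 - x) <= 1 - q * x.
  have : 0 <= (1 - q) * (1 + x) by rewrite mulr_ge0 ?subr_ge0// addr_ge0.
  lra.
have q2 : 0 <= (1 + q) / 2 by rewrite divr_ge0// addr_ge0.
have b1 : ((1 + q) / 2 * (1 + x)) ^+ 2 <= (1 + q * x) ^+ 2.
  by rewrite lerXn2r ?nnegrE ?mulr_ge0 ?addr_ge0 ?mulr_ge0.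
have b2 : ((1 + q) / 2 * (1 - x)) ^+ 2 <= (1 - q * x) ^+ 2.
  rewrite lerXn2r ?nnegrE//; first by rewrite mulr_ge0// subr_ge0.
  by rewrite (le_trans _ a2)// mulr_ge0// subr_ge0.
have d1 : 0 <= (1 - c) / 2 * ((1 + q * x) ^+ 2 - ((1 + q) / 2 * (1 + x)) ^+ 2).
  by apply: mulr_ge0; [lra|rewrite subr_ge0].
have d2 : 0 <= (1 + c) / 2 * ((1 - q * x) ^+ 2 - ((1 + q) / 2 * (1 - x)) ^+ 2).
  by apply: mulr_ge0; [lra|rewrite subr_ge0].
rewrite -subr_ge0; apply: le_trans (addr_ge0 d1 d2) _.
by rewrite le_eqVlt; apply/orP; left; apply/eqP; field.
Qed.

Context {K : finType} (e th : K -> R) (q : R) (u : K -> R).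

Lemma log_kernel_flat M j k : e j = 0 \/ e k = 0 ->
  log_kernel e th q u M j k = - Num.max (u j) (u k).
Proof.
by move=> ejk; rewrite /log_kernel big1 ?addr0// => m _; case: ejk => ->; ring.
Qed.

Lemma log_kernelE M j k : e j = 1 -> e k = 1 ->
  log_kernel e th q u M j k = - Num.max (u j) (u k) +
   \sum_(m < M) (q * expR (- `|u j - u k|)) ^+ m.+1 / m.+1%:R *
      cos (m.+1%:R * (th j - th k)).
Proof.
move=> ej ek; rewrite /log_kernel ej ek; congr (_ + _); apply: eq_bigr => m _.
by rewrite -mulrN expRM_natl exprMn; ring.
Qed.

Lemma log_kernel_diag M k : e k = 1 -> 0 <= q < 1 ->
  log_kernel e th q u M k k <= - u k - ln (1 - q) + 2 * q ^+ M / (1 - q) ^+ 2.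
Proof.
move=> ek /andP[q0 q1]; rewrite log_kernelE// maxxx !subrr normr0 oppr0 expR0 mulr1.
rewrite -addrA lerD2l; apply: (le_trans (log_series_le 0 q q M _ q1)).
  by rewrite q0 lexx.
rewrite lerD2r cos0 mulr1 (_ : 1 - 2 * q + q ^+ 2 = (1 - q) ^+ 2); last by ring.
by rewrite lnXn ?subr_gt0// -[_ *+ 2]mulr_natr mulfK// pnatr_eq0.
Qed.

(** Damping costs a pair of distinct points only [ln (2 / (1 + q))], uniformly in their distance;
    for [q = n / (n + 1)] this is at most [1 / (2 n)]. On the diagonal it costs
    [- ln (1 - q) = ln (n + 1)]. *)
Lemma log_kernel_offdiag M j k : e j = 1 -> e k = 1 -> 0 <= q < 1 ->
  polar (expR (u j)) (th j) != polar (expR (u k)) (th k) ->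
  log_kernel e th q u M j k <=
  - ln (normc (polar (expR (u j)) (th j) - polar (expR (u k)) (th k))) +
  ln (2 / (1 + q)) + 2 * q ^+ M / (1 - q) ^+ 2.
Proof.
move=> ej ek /andP[q0 q1] jk; rewrite log_kernelE//.
set x := expR (- _); set c := th j - th k; set d := normc _.
have x0 : 0 <= x by exact: expR_ge0.
have x1 : x <= 1 by rewrite expR_le1 oppr_le0.
have qx : 0 <= q * x <= q by rewrite mulr_ge0//= ler_piMr.
apply: (@le_trans _ _ (- Num.max (u j) (u k) + (- (ln (1 - 2 * (q * x) * cos c + (q * x) ^+ 2) / 2) + 2 * q ^+ M / (1 - q) ^+ 2))).
  by rewrite lerD2l log_series_le.
rewrite addrA lerD2r.
have d0 : 0 < d.
  by rewrite lt_neqAle normc_ge0 andbT eq_sym normc_neq0 subr_eq0.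
have dE : d ^+ 2 = expR (Num.max (u j) (u k)) ^+ 2 * (1 - 2 * x * cos c + x ^+ 2).
  rewrite /d dist_polar -/c /x; have [ujk|ukj] := leP (u j) (u k).
    rewrite ler0_norm ?subr_le0// opprK (_ : expR (u j - u k) = expR (u j) / expR (u k)) ?expRB//.
    by field; rewrite expR_eq0.
  rewrite gtr0_norm ?subr_gt0// opprB expRB; field; by rewrite expR_eq0.
have P0 : 0 < 1 - 2 * x * cos c + x ^+ 2.
  by rewrite -(pmulr_rgt0 _ (exprn_gt0 2 (expR_gt0 (Num.max (u j) (u k))))) -dE exprn_gt0.
have s0 : 0 < (1 + q) / 2 by lra.
have key := quadratic_smoothing (cos c) q x (cos_max _) ltac:(by rewrite q0 ltW) ltac:(by rewrite x0 x1).
have L0 : 0 < ((1 + q) / 2) ^+ 2 * (1 - 2 * x * cos c + x ^+ 2) by rewrite mulr_gt0 ?exprn_gt0.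
have lnkey : ln (((1 + q) / 2) ^+ 2 * (1 - 2 * x * cos c + x ^+ 2)) <=
             ln (1 - 2 * (q * x) * cos c + (q * x) ^+ 2).
  by rewrite ler_ln ?posrE ?(lt_le_trans L0 key).
rewrite lnM ?posrE ?exprn_gt0// lnXn// in lnkey.
have lnd : ln d *+ 2 = Num.max (u j) (u k) *+ 2 + ln (1 - 2 * x * cos c + x ^+ 2).
  by rewrite -lnXn// dE lnM ?posrE ?exprn_gt0 ?expR_gt0// lnXn ?expR_gt0// expRK.
have -> : ln (2 / (1 + q)) = - ln ((1 + q) / 2) by rewrite -lnV ?posrE// invf_div.
rewrite mulr2n in lnkey; rewrite (mulr2n (ln d)) (mulr2n (Num.max _ _)) in lnd; move: lnkey lnd.
move: (ln d) (ln ((1 + q) / 2)) (ln (1 - 2 * x * cos c + x ^+ 2)) (ln (1 - 2 * (q * x) * cos c + (q * x) ^+ 2)) (Num.max _ _).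
by clear => *; lra.
Qed.

End log_kernel.

(** * The arclength integral as a limit of Riemann sums *)

Section riemann_sums.
Context {R : realType}.
Implicit Types (N j : nat) (F : nat -> R) (t x y B : R).
Local Notation mu := (@lebesgue_measure R).
Local Notation circ := (`[0, 2 * pi[%classic : set R).

Lemma sin_norm_le x : `|sin x| <= `|x|.
Proof.
wlog x0 : x / 0 <= x.
  move=> W; have [x0|/ltW x0] := leP 0 x; first exact: W.
  by rewrite -normrN -sinN -[leRHS]normrN W// oppr_ge0.
move: x0; rewrite le_eqVlt => /predU1P[<-|x0]; first by rewrite sin0.
have [y _ ->] := sin_mvt x x0.
by rewrite normrM ler_piMl// cos_max.
Qed.

Lemma polar1E t : polar 1 t = expi t :> R[i].
Proof. by rewrite /polar /expi !mul1r. Qed.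

Lemma dist_expi x y : normc (expi x - expi y) <= `|x - y|.
Proof.
rewrite -!polar1E -(@ler_pXn2r _ 2) ?nnegrE ?normc_ge0// dist_polar.
rewrite subrr expr0n add0r !mulr1 cos_half real_normK ?num_real//.
have : sin ((x - y) / 2) ^+ 2 <= ((x - y) / 2) ^+ 2.
  rewrite -[leLHS]real_normK ?num_real// -[leRHS]real_normK ?num_real//.
  by rewrite lerXn2r ?nnegrE// sin_norm_le.
rewrite expr_div_n; lra.
Qed.

Definition cell N j : set R := `[ang N * j%:R, ang N * j.+1%:R[%classic.

Definition step N F t : R := \sum_(j < N) F j * \1_(cell N j) t.

Lemma step_cell N t : (0 < N)%N -> circ t ->
  exists2 j, ang N * j%:R <= t < ang N * j.+1%:R & forall F, step N F t = F j.
Proof.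
move=> N0 /=; rewrite in_itv /= => /andP[t0 t2].
have a0 := @ang_gt0 R N N0.
have x0 : 0 <= t / ang N by rewrite divr_ge0// ltW.
pose j := Num.truncn (t / ang N).
have := truncn_itv x0; rewrite -/j ler_pdivlMr// ltr_pdivrMr// => /andP[j1 j2].
rewrite mulrC in j1; rewrite mulrC in j2.
have jN : (j < N)%N.
  rewrite -(ltr_nat R) -(@ltr_pM2l _ (ang N))//; apply: (le_lt_trans j1).
  by rewrite {1}/ang divfK// pnatr_eq0 -lt0n.
exists j; first by rewrite j1 j2.
move=> F; rewrite /step (bigD1 (Ordinal jN))//= big1 ?addr0 => [|k].
  by rewrite indicE mem_set ?mulr1// /cell /= in_itv /= j1 j2.
rewrite -val_eqE /= indicE => kj; rewrite memNset ?mulr0// /cell /= in_itv /=.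
apply/negP; rewrite negb_and -ltNge -leNgt.
move: kj; rewrite neq_ltn => /orP[kj|jk]; apply/orP; [right|left].
  by apply: le_trans j1; rewrite ler_pM2l// ler_nat.
by apply: (lt_le_trans j2); rewrite ler_pM2l// ler_nat.
Qed.

Lemma measurable_step N F (D : set R) : measurable_fun D (step N F).
Proof.
apply: measurable_sum => j; apply: measurable_funM; first exact: measurable_cst.
by apply: measurable_indic; exact: measurable_itv.
Qed.

Lemma integral_step N F : (0 < N)%N -> (forall j, 0 <= F j) ->
  (\int[mu]_(t in circ) (step N F t)%:E = (2 * pi * mean N F)%:E)%E.
Proof.
move=> N0 F0; have a0 := @ang_gt0 R N N0.
have mcell j : measurable (cell N j) by exact: measurable_itv.
under eq_integral => t _ do rewrite /step -sumEFin.
rewrite ge0_integral_sum//=; first last.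
- by move=> j t _; rewrite lee_fin mulr_ge0.
- move=> j; apply/measurable_EFinP; apply: measurable_funM; first exact: measurable_cst.
  by apply: measurable_indic; exact: mcell.
transitivity (\sum_(j < N) (F j * ang N)%:E)%E.
  apply: eq_bigr => j _.
  under eq_integral => t _ do rewrite EFinM.
  rewrite ge0_integralZl_EFin//=; last first.
    by apply/measurable_EFinP; apply: measurable_indic; exact: mcell.
  have -> : (\int[mu]_(t in circ) (\1_(cell N j) t)%:E = mu (cell N j `&` circ))%E.
    by rewrite integral_indic//; exact: mcell.
  rewrite setIidl; last first.
    move=> t; rewrite /cell /= !in_itv /= => /andP[t1 t2]; apply/andP; split.
      by apply: le_trans t1; rewrite mulr_ge0// ltW.
    apply: (lt_le_trans t2); rewrite (_ : 2 * pi = ang N * N%:R).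
      by rewrite ler_pM2l// ler_nat.
    by rewrite /ang divfK// pnatr_eq0 -lt0n.
  rewrite /cell lebesgue_measure_itv /= lte_fin ltr_pM2l// ltr_nat ltnSn.
  by rewrite -EFinB -EFinM; congr (_ * _)%:E; rewrite -[j.+1%:R]natr1; ring.
by rewrite sumEFin -mulr_suml /mean /ang; congr _%:E; ring.
Qed.

Lemma integral_riemann (f : R -> R) B N : (0 < N)%N ->
  measurable_fun setT f -> (forall t, 0 <= f t) ->
  (forall x y, `|f x - f y| <= B * `|x - y|) ->
  let I := (\int[mu]_(t in `[0%R, (2 * pi)%R]) (f t)%:E)%E in
  I \is a fin_num /\
  `|(2 * pi)^-1 * fine I - mean N (fun j => f (ang N * j%:R))| <= B * ang N.
Proof.
move=> N0 mf f0 fB I; have a0 := @ang_gt0 R N N0.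
have pi2 : 0 < 2 * pi :> R by rewrite mulr_gt0// pi_gt0.
have B0 : 0 <= B.
  by have := le_trans (normr_ge0 _) (fB 1 0); rewrite subr0 normr1 mulr1.
have IE : I = (\int[mu]_(t in circ) (f t)%:E)%E.
  rewrite /I -integral_itv_bndo_bndc//; apply/measurable_EFinP.
  exact: measurable_funTS.
set F := fun j => f (ang N * j%:R); set m := mean N F.
have near j t : ang N * j%:R <= t < ang N * j.+1%:R -> `|f t - F j| <= B * ang N.
  rewrite -[j.+1%:R]natr1 mulrDr mulr1 => /andP[t1 t2].
  by apply: (le_trans (fB _ _)); rewrite ler_wpM2l// ger0_norm; lra.
have mE (g : R -> R) : measurable_fun setT g -> measurable_fun circ (EFin \o g).
  by move=> mg; apply/measurable_EFinP; exact: measurable_funTS.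
have up : (I <= (2 * pi * (m + B * ang N))%:E)%E.
  rewrite -[X in m + X](mean_cst N _ N0) -meanD -integral_step//; last first.
    by move=> j; apply: addr_ge0; [exact: f0|apply: mulr_ge0 => //; exact: ltW].
  rewrite IE; apply: ge0_le_integral => //=.
  - by move=> t _; rewrite lee_fin.
  - exact: mE.
  - by apply/measurable_EFinP; exact: measurable_step.
  - move=> t ct; rewrite lee_fin; have [j jt ->] := step_cell N t N0 ct.
    by have := near j t jt; rewrite ler_norml => /andP[_]; rewrite lerBlDl.
have lo : ((2 * pi * (m - B * ang N))%:E <= I)%E.
  (* Lowering the samples may make them negative; clipping at 0 keeps the step function nonnegative
     and still below [f]. *)
  apply: (@le_trans _ _ (2 * pi * mean N (fun j => Num.max (F j - B * ang N) 0))%:E).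
    rewrite lee_fin ler_pM2l// -[X in m - X](mean_cst N _ N0) -meanB.
    by apply: ler_mean => j; rewrite le_max lexx.
  rewrite -integral_step//; last by move=> j; rewrite le_max lexx orbT.
  rewrite IE; apply: ge0_le_integral => //=.
  - move=> t ct; rewrite lee_fin; have [j _ ->] := step_cell N t N0 ct.
    by rewrite le_max lexx orbT.
  - by apply/measurable_EFinP; exact: measurable_step.
  - exact: mE.
  - move=> t ct; rewrite lee_fin; have [j jt ->] := step_cell N t N0 ct.
    rewrite ge_max f0 andbT; have := near j t jt.
    by rewrite ler_norml => /andP[+ _]; lra.
have finI : I \is a fin_num.
  by rewrite fin_numE; apply/andP; split; apply/eqP => Ie; rewrite Ie in up lo.
split=> //; move: up lo; rewrite -{1 2}(fineK finI) !lee_fin => up lo.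
have h1 : (2 * pi)^-1 * fine I <= m + B * ang N by rewrite ler_pdivrMl.
have h2 : m - B * ang N <= (2 * pi)^-1 * fine I by rewrite ler_pdivlMl.
by rewrite ler_norml; apply/andP; split; lra.
Qed.

End riemann_sums.

Section arclength_integral.
Context {R : realType} {A r : R} {phi : R[i] -> R}.
Context (A_gt0 : 0 < A) (r_gt0 : 0 < r)
  (phi_lip : forall z w : R[i], `|phi z - phi w| <= A * normc (z - w))
  (phi0 : forall z, r < normc z -> phi z = 0).

Lemma measurable_lipschitz : @measurable_fun _ _ (borelC R) (measurableTypeR R) setT phi.
Proof.
apply: (measurability _ (RGenOInfty.measurableE R)) => _ [_ [x ->] <-].
rewrite setTI; apply: sub_sigma_algebra.
rewrite /= openE => z; rewrite /= in_itv /= andbT => xz.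
have d0 : 0 < (phi z - x) / A by rewrite divr_gt0// subr_gt0.
suff : nbhs (z : R[i]^o) (phi @^-1` `]x, +oo[) by [].
apply/nbhs_ballP; exists (((phi z - x) / A)%:C)%C; first by rewrite /= ltcE /= eqxx.
move=> w; rewrite /ball /= (_ : `|z - w| = (normc (z - w))%:C%C)// ltcR => zw.
rewrite in_itv /= andbT; have := phi_lip z w.
have : A * normc (z - w) < phi z - x by rewrite mulrC -ltr_pdivlMr.
by move=> h1 h2; have := ler_norm (phi z - phi w); lra.
Qed.

Lemma arclength_riemann N : (0 < N)%N ->
  `|\int[arclength R]_z phi z - mean N (fun j => phi (polar 1 (ang N * j%:R)))|
    <= A * ang N.
Proof.
move=> N0.
(* Adding a bound for [|phi|] makes the integrand nonnegative, as the change of variables and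
   [integral_riemann] require. *)
pose C := `|phi 0| + A * r + A.
have phiC z : `|phi z| <= C.
  have [zr|zr] := leP (normc z) r; last first.
    by rewrite phi0// normr0 !addr_ge0// ?mulr_ge0// ltW.
  rewrite -[phi z](subrK (phi 0)); apply: (le_trans (ler_normD _ _)).
  have : `|phi z - phi 0| <= A * r.
    by apply: (le_trans (phi_lip _ _)); rewrite subr0 ler_pM2l.
  by move=> h; rewrite addrC /C -addrA lerD2l (le_trans h)// lerDl ltW.
have C0 z : 0 <= phi z + C.
  by have := phiC z; rewrite ler_norml => /andP[h _]; rewrite -lerBlDr sub0r.
pose f t := phi (expi t) + C.
have mphi := measurable_lipschitz.
have mf : measurable_fun (setT : set (measurableTypeR R)) f.
  apply: measurable_funD; last exact: measurable_cst.
  by apply: (measurableT_comp mphi); exact: measurable_expi.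
have f0 t : 0 <= f t by exact: C0.
have fB x y : `|f x - f y| <= A * `|x - y|.
  rewrite /f opprD addrACA subrr addr0; apply: (le_trans (phi_lip _ _)).
  by rewrite ler_pM2l// dist_expi.
have [finI HI] := integral_riemann f A N N0 mf f0 fB.
have iphi : (arclength R).-integrable setT (EFin \o phi).
  apply: measurable_bounded_integrable => //.
    by rewrite (le_lt_trans (probability_le1 _ _)) ?ltry.
  exists C; split; first exact: num_real.
  by move=> x Cx z _ /=; rewrite (le_trans (phiC z))// ltW.
have E1 : \int[arclength R]_z (phi z + C) = \int[arclength R]_z phi z + C.
  rewrite RintegralD//; last exact: finite_measure_integrable_cst.
  rewrite Rintegral_cst// [X in fine X](_ : _ = 1%E) ?mulr1//.
  exact: probability_setT.
have E2 : \int[arclength R]_z (phi z + C) =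
    (2 * pi)^-1 * fine (\int[lebesgue_measure]_(t in `[0%R, (2 * pi)%R]) (f t)%:E)%E.
  rewrite /Rintegral.
  have -> : (\int[arclength R]_z (phi z + C)%:E =
     \int[pushforward (uniform_prob (twopi_gt0 R)) (@expi R : measurableTypeR R -> borelC R)]_z (phi z + C)%:E)%E by [].
  rewrite ge0_integral_pushforward//=; first last.
  - by move=> z _; rewrite lee_fin.
  - apply/measurable_EFinP; apply: measurable_funD => //; exact: measurable_cst.
  - exact: measurable_expi.
  rewrite preimage_setT integral_uniform//=; first last.
  - by apply/measurable_EFinP.
  by rewrite subr0 fineM// finI.
have -> : mean N (fun j => phi (polar 1 (ang N * j%:R))) =
          mean N (fun j => f (ang N * j%:R)) - C.
  rewrite -[X in _ - X](mean_cst N _ N0) -meanB; apply: eq_mean => j.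
  by rewrite /f polar1E; ring.
rewrite (_ : \int[arclength R]_z phi z = \int[arclength R]_z (phi z + C) - C); last by rewrite E1 addrK.
by rewrite opprB addrA subrK E2.
Qed.

End arclength_integral.

(** * Jensen's lower bound for the Mahler measure *)

Section roots_of_unity.
Context {R : realType}.

Lemma polar_full N m (a : R) : (0 < N)%N -> polar a (ang N * (m * N)%:R) = polar a 0.
Proof.
move=> N0; elim: m => [|m ih]; first by rewrite mul0n mulr0.
by rewrite mulSn addnC polar_period.
Qed.

Lemma polarM (a b x y : R) : polar a x * polar b y = polar (a * b) (x + y).
Proof.
rewrite /polar cosD sinD; apply/eqP; rewrite eq_complex /=.
by apply/andP; split; apply/eqP; ring.
Qed.

Lemma polarX (a x : R) m : polar a x ^+ m = polar (a ^+ m) (m%:R * x).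
Proof.
elim: m => [|m ih].
  by rewrite !expr0 mul0r /polar cos0 sin0 mulr1 mulr0.
by rewrite exprS ih polarM -exprS -[m.+1%:R]natr1; congr polar; ring.
Qed.

(** An order [m < N] would make the mean of the [m]th cosine equal to 1, whereas [mean_cos_sin]
    makes it 0. *)
Lemma polar_ang_primitive N : (0 < N)%N ->
  N.-primitive_root (polar 1 (ang N) : R[i]).
Proof.
move=> N0; have period : polar 1 (ang N) ^+ N = 1 :> R[i].
  rewrite polarX expr1n; have := polar_period (1 : R) N 0 N0.
  by rewrite add0n mulr0 mulrC => ->; rewrite /polar cos0 sin0 mul1r mulr0.
have [m prim mN] := prim_order_exists N0 period.
suff NE : N = m by move: prim; rewrite -NE.
apply/eqP; rewrite eqn_leq (dvdn_leq N0 mN) andbT leqNgt; apply/negP => ltmN.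
have m0 := prim_order_gt0 prim.
have [|C0 _] := @mean_cos_sin R N m; first by rewrite m0.
suff : mean N (fun j => cos (m%:R * (ang N * j%:R))) = (1 : R).
  by rewrite C0 => /eqP; rewrite eq_sym oner_eq0.
rewrite -[RHS](@mean_cst R N 1 N0); apply: eq_mean => j.
have := congr1 (fun z => z ^+ j) (prim_expr_order prim).
rewrite expr1n polarX expr1n polarX expr1n => /(congr1 (@complex.Re R)) /=.
rewrite mul1r => E; transitivity (cos (j%:R * (m%:R * @ang R N))); last exact: E.
by congr cos; ring.
Qed.

(** This is [X^N - 1] factored over the roots of unity, evaluated at [al / s]. It gives the sample
    means of [ln |z - al|] in closed form. *)
Lemma prod_dist_circle N (s : R) (al : R[i]) : (0 < N)%N -> 0 < s ->
  \prod_(j < N) normc (polar s (ang N * j%:R) - al) = normc (polar (s ^+ N) 0 - al ^+ N).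
Proof.
move=> N0 s0; set w : R[i] := polar 1 (ang N).
have prim := polar_ang_primitive N N0.
have sE (x : R) : polar s x = s%:C%C * polar 1 x.
  rewrite /polar !mul1r; apply/eqP; rewrite eq_complex /=.
  by apply/andP; split; apply/eqP; ring.
have sn : s%:C%C != 0 :> R[i].
  by rewrite eq_complex /= eqxx andbT gt_eqF.
transitivity (normc (s%:C%C ^+ N * ((al / s%:C%C) ^+ N - 1))).
  have := congr1 (fun p : {poly R[i]} => p.[al / s%:C%C]) (factor_Xn_sub_1 prim).
  rewrite !hornerE => <-.
  have Es : normc s%:C%C ^+ N = \prod_(j < N) normc (s%:C%C : R[i]).
    by rewrite prodr_const card_ord.
  rewrite horner_prod normcM normcX big_mkord normc_prod Es.
  rewrite -big_split; apply: eq_bigr => j _.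
  rewrite -[RHS]/(normc _ * normc _) hornerXsubC -normcM sE polarX expr1n mulrBr mulrCA mulfV// mulr1.
  by rewrite normcB; congr (normc (_ - _ * polar _ _)); exact: mulrC.
rewrite mulrBr mulr1 -exprMn mulrCA mulfV// mulr1 normcB; congr (normc (_ - _)).
by rewrite /polar cos0 sin0 mulr1 mulr0 -rmorphXn.
Qed.

End roots_of_unity.

Section jensen.
Context {R : realType} {n : nat} {P : {poly R[i]}} {a : R[i]} {alpha : 'I_n -> R[i]}.
Context (a_neq0 : a != 0) (PE : P = a *: \prod_(k < n) ('X - (alpha k)%:P)).
Local Notation mu := (@lebesgue_measure R).
Local Notation circ := (`[0, 2 * pi[%classic : set R).

Let na : R := normc a.

Let na_gt0 : 0 < na.
Proof. by rewrite lt_neqAle normc_ge0 andbT eq_sym normc_neq0. Qed.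

Let V : R := ln na + \sum_(k < n) ln (Num.max 1 (normc (alpha k))).

Let normP z : normc P.[z] = na * \prod_(k < n) normc (z - alpha k).
Proof.
rewrite PE hornerZ normcM horner_prod normc_prod; congr (_ * _).
by apply: eq_bigr => k _; rewrite hornerXsubC.
Qed.

(* On the radius [rho N] the [N]th powers have modulus 2, which keeps the sample
   points away from the roots on the unit circle. *)
Let rho N : R := expR (ln 2 / N%:R).

Let rhoX N : (0 < N)%N -> rho N ^+ N = 2.
Proof.
move=> N0; rewrite /rho -expRM_natl mulrCA mulfV ?mulr1 ?lnK ?posrE//.
by rewrite pnatr_eq0 -lt0n.
Qed.

Let ln2_ge0 : 0 <= ln (2 : R).
Proof. by rewrite ln_ge0// ler1n. Qed.

Let rho_ge1 N : 1 <= rho N.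
Proof. by rewrite -expR0 ler_expR divr_ge0. Qed.

Let rho_le2 N : (0 < N)%N -> rho N <= 2.
Proof.
move=> N0; rewrite -[leRHS]lnK ?posrE// ler_expR ler_pdivrMr ?ltr0n//.
by rewrite ler_peMr// ler1n.
Qed.

Lemma normcB_ge (z w : R[i]) : normc z - normc w <= normc (z - w).
Proof. by rewrite lerBlDr -{1}(subrK w z) le_normcD. Qed.

Let far k : exists N0, forall N, (N0 <= N)%N -> (0 < N)%N ->
  let d := normc (polar (rho N ^+ N) 0 - alpha k ^+ N) in
  0 < d /\ ln (Num.max 1 (normc (alpha k))) - ln 2 / N%:R <= N%:R^-1 * ln d.
Proof.
have [a1|a1] := leP (normc (alpha k)) 1.
  exists 0%N => N _ N0 d.
  have d1 : 1 <= d.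
    apply: (le_trans _ (normcB_ge _ _)); rewrite normc_polar rhoX// normcX.
    have : normc (alpha k) ^+ N <= 1 by rewrite exprn_ile1// normc_ge0.
    lra.
  split; first by rewrite (lt_le_trans _ d1).
  rewrite ?(max_idPl a1) ln1 sub0r (@le_trans _ _ 0)// ?oppr_le0 ?divr_ge0//.
  by rewrite mulr_ge0 ?invr_ge0// ln_ge0.
pose x := normc (alpha k); have x0 : 0 < x by rewrite (lt_trans _ a1).
exists (Num.truncn (4 / (x - 1))).+1 => N NN N0 d.
(* Bernoulli's inequality. With [x^N >= 4], subtracting 2 leaves at least half of [x^N]. *)
have xN : 4 <= x ^+ N.
  have : 1 + (x - 1) *+ N <= (1 + (x - 1)) ^+ N.
    have y0 : 0 <= x - 1 by rewrite subr_ge0 ltW.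
    elim: (N) => [|m ih]; first by rewrite mulr0n addr0.
    rewrite exprS; apply: (@le_trans _ _ ((1 + (x - 1)) * (1 + (x - 1) *+ m))).
      have : 0 <= (x - 1) * ((x - 1) *+ m) by rewrite mulr_ge0// mulrn_wge0.
      by rewrite mulrS; move: ((x - 1) *+ m) (x - 1) => w y; lra.
    by rewrite ler_wpM2l// addr_ge0.
  have -> : 1 + (x - 1) = x by ring.
  apply: le_trans.
  have : 4 / (x - 1) <= N%:R.
    by apply: (le_trans (ltW (truncnS_gt _))); rewrite ler_nat.
  rewrite ler_pdivrMr ?subr_gt0// mulrC mulr_natr; lra.
have dx : x ^+ N / 2 <= d.
  rewrite /d normcB; apply: (le_trans _ (normcB_ge _ _)).
  by rewrite normc_polar rhoX// normcX -/x; lra.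
have xN0 : 0 < x ^+ N by rewrite exprn_gt0.
have d0 : 0 < d by rewrite (lt_le_trans _ dx)// divr_gt0.
split=> //; rewrite ?(max_idPr (ltW a1)) -/x ler_pdivlMl ?ltr0n//.
rewrite mulrBr [N%:R * (ln 2 / _)]mulrC divfK ?pnatr_eq0 -?lt0n//.
rewrite mulr_natl -lnXn// -ln_div ?posrE// ler_ln ?posrE// divr_gt0//.
Qed.

Let sample_lower : exists N0, forall N, (N0 <= N)%N -> (0 < N)%N ->
  V - n%:R * (ln 2 / N%:R) <= mean N (fun j => ln (normc P.[polar (rho N) (ang N * j%:R)])) /\
  forall j, 0 < normc P.[polar (rho N) (ang N * j%:R)].
Proof.
have /choice[N0 HN0] := far.
exists (\max_(k < n) N0 k)%N => N NN N0'.
have Nk k : (N0 k <= N)%N by apply: leq_trans NN; exact: leq_bigmax.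
have rho0 : 0 < rho N by exact: expR_gt0.
have pos j k : 0 < normc (polar (rho N) (ang N * j%:R) - alpha k).
  have [d0 _] := HN0 k N (Nk k) N0'.
  rewrite lt_neqAle normc_ge0 andbT eq_sym normc_neq0 subr_eq0.
  apply: contraTneq d0 => ak; rewrite -ak polarX -leNgt.
  rewrite (_ : N%:R * (ang N * j%:R) = ang N * (j * N)%:R); last by rewrite natrM; ring.
  by rewrite polar_full// subrr normc0.
split; last by move=> j; rewrite normP mulr_gt0// prodr_gt0.
have -> : mean N (fun j => ln (normc P.[polar (rho N) (ang N * j%:R)])) =
  ln na + \sum_(k < n) N%:R^-1 * ln (normc (polar (rho N ^+ N) 0 - alpha k ^+ N)).
  have ln_prod (I : finType) (F : I -> R) : (forall i, 0 < F i) ->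
      ln (\prod_i F i) = \sum_i ln (F i).
    move=> F0; suff [] : 0 < \prod_i F i /\ ln (\prod_i F i) = \sum_i ln (F i) by [].
    elim/big_rec2 : _ => [|i y x _ [x0 xE]]; first by rewrite ln1.
    by rewrite mulr_gt0// lnM ?posrE// xE.
  rewrite (eq_mean _ _ (fun j => ln na + \sum_(k < n) ln (normc (polar (rho N) (ang N * j%:R) - alpha k)))); last first.
    move=> j; rewrite normP lnM ?posrE ?prodr_gt0//.
    by rewrite ln_prod.
  rewrite meanD mean_cst// mean_sum; congr (_ + _); apply: eq_bigr => k _.
  rewrite /mean -prod_dist_circle//; congr (_ * _).
  by rewrite ln_prod.
rewrite /V -addrA lerD2l mulr_natl -[n in _ *+ n]card_ord -sumr_const -sumrB.
by apply: ler_sum => k _; have [_] := HN0 k N (Nk k) N0'.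
Qed.

Let sup_P : R := na * \prod_(k < n) (2 + normc (alpha k)).

(** The summand 1 makes [C] nonnegative, so that it also bounds the value [ln 0 = 0] at a zero of
    [P]. *)
Let C : R := ln (1 + sup_P).

Let sup_P_ge0 : 0 <= sup_P.
Proof.
apply: mulr_ge0; first exact: ltW.
by apply: prodr_ge0 => k _; rewrite addr_ge0 ?normc_ge0.
Qed.

Let lnP_le z : normc z <= 2 -> ln (normc P.[z]) <= C.
Proof.
move=> z2; have C0 : 0 <= C by rewrite ln_ge0// lerDl.
have [P0|P0] := leP (normc P.[z]) 0; first by rewrite ln0.
rewrite ler_ln ?posrE ?ltr_pwDl// (@le_trans _ _ sup_P)//; last by rewrite lerDr.
rewrite normP ler_pM2l//; apply: ler_prod => k _; rewrite normc_ge0/=.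
by rewrite (le_trans (le_normcD _ _))// normcN lerD2r.
Qed.

Let f (t : R) : R := C - ln (normc P.[expi t]).

Let g N j : R := C - ln (normc P.[polar (rho N) (ang N * j%:R)]).

Let normc_expi (t : R) : normc (expi t) = 1.
Proof. by rewrite -polar1E normc_polar. Qed.

Let f_ge0 t : 0 <= f t.
Proof. by rewrite subr_ge0 lnP_le// normc_expi ler1n. Qed.

Let g_ge0 N j : (0 < N)%N -> 0 <= g N j.
Proof.
by move=> N0; rewrite subr_ge0 lnP_le// normc_polar ?expR_ge0// rho_le2.
Qed.

Let dist_normc (z w al : R[i]) : `|normc (z - al) - normc (w - al)| <= normc (z - w).
Proof.
have T (x y : R[i]) : normc (x - al) <= normc (x - y) + normc (y - al).
  by rewrite -[x - al](subrKA y) le_normcD.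
have := T z w; have := T w z; rewrite (normcB w z) ler_norml => h1 h2.
by apply/andP; split; lra.
Qed.

Let measurable_f : measurable_fun setT f.
Proof.
apply: measurable_funB; first exact: measurable_cst.
apply: measurableT_comp; first exact: measurable_ln.
rewrite (_ : (fun t => _) = (fun t => na * \prod_(k < n) normc (expi t - alpha k))); last first.
  by apply/funext => t; rewrite normP.
apply: measurable_funM; first exact: measurable_cst.
apply: measurable_prod => k _; apply: continuous_measurable_fun => t.
apply/cvgrPdist_lt => e e0; near=> s.
apply: (le_lt_trans (dist_normc _ _ _)); apply: (le_lt_trans (dist_expi _ _)).
near: s; apply/nbhs_ballP; exists e => //.
Unshelve. all: by end_near.
Qed.

Let cvg_gap : (rho m.+1 - 1) + ang m.+1 @[m --> \oo] --> (0 : R).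
Proof.
have rcvg : rho m.+1 @[m --> \oo] --> (1 : R).
  rewrite -[X in _ --> X](@expR0 R).
  rewrite /rho; apply: continuous_cvg; first exact: continuous_expR.
  rewrite -[X in _ --> X](mulr0 (ln 2)); apply: cvgM; first exact: cvg_cst.
  exact: cvg_harmonic.
have -> : (0 : R) = 1 - 1 + 0 by rewrite subrr addr0.
by apply: cvgD; [apply: cvgB; [exact: rcvg|exact: cvg_cst]|exact: cvg_ang].
Qed.

(** In other words, [f] is at most the lower limit of the step functions, the pointwise hypothesis
    under which Fatou's lemma transfers the bound on sample means to the integral. *)
Let liminf_step t e : circ t -> 0 < e ->
  \forall m \near \oo, f t - e <= step m.+1 (g m.+1) t.
Proof.
move=> ct e0.
have /choice[j Hj] : forall m, exists j,
    ang m.+1 * j%:R <= t < ang m.+1 * j.+1%:R /\ forall F, step m.+1 F t = F j.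
  by move=> m; have [j h1 h2] := step_cell m.+1 t (ltn0Sn m) ct; exists j.
pose z m := polar (rho m.+1) (ang m.+1 * (j m)%:R).
have zt m : normc (z m - expi t) <= (rho m.+1 - 1) + ang m.+1.
  have -> : z m - expi t = (z m - polar 1 (ang m.+1 * (j m)%:R)) +
      (expi (ang m.+1 * (j m)%:R) - expi t) by rewrite polar1E addrA subrK.
  apply: (le_trans (le_normcD _ _)); apply: lerD.
    rewrite -(@ler_pXn2r _ 2) ?nnegrE ?normc_ge0 ?subr_ge0// dist_polar.
    by rewrite subrr cos0 subrr mulr0 addr0.
  apply: (le_trans (dist_expi _ _)); have [/andP[t1 t2] _] := Hj m.
  rewrite distrC ger0_norm ?subr_ge0// lerBlDr.
  by move: t2; rewrite -[(j m).+1%:R]natr1 mulrDr mulr1 addrC => /ltW.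
have xcvg : normc P.[z m] @[m --> \oo] --> normc P.[expi t].
  under eq_cvg do rewrite normP; rewrite normP.
  apply: cvgM; first exact: cvg_cst.
  have pcvg (F : 'I_n -> nat -> R) (l : 'I_n -> R) : (forall k, F k m @[m --> \oo] --> l k) ->
      \prod_(k < n) F k m @[m --> \oo] --> \prod_(k < n) l k.
    move=> Fl; elim: (index_enum _) => [|k s ih].
      by rewrite big_nil; under eq_cvg do rewrite big_nil; exact: cvg_cst.
    by rewrite big_cons; under eq_cvg do rewrite big_cons; exact: cvgM.
  apply: pcvg => k; apply/cvgrPdist_lt => d d0.
  apply: (filterS _ (cvgr_lt _ cvg_gap d d0)) => m /=; apply: le_lt_trans.
  by rewrite distrC; apply: (le_trans (dist_normc _ _ _)).
have lncvg : \forall m \near \oo, ln (normc P.[z m]) <= ln (normc P.[expi t]) + e.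
  (* At a zero of [P], [ln 0 = 0] gives [f t = C], while the sampled values of [|P|] are eventually
     below 1 and have nonpositive logarithms. *)
  have [P0|P0] := leP (normc P.[expi t]) 0.
    have P1 : normc P.[expi t] < 1 by rewrite (le_lt_trans P0).
    apply: (filterS _ (cvgr_lt _ xcvg 1 P1)) => m /= xm.
    by rewrite (ln0 P0) add0r (le_trans (ln_le0 (ltW xm)))// ltW.
  have lc : ln (normc P.[z m]) @[m --> \oo] --> ln (normc P.[expi t]).
    by apply: continuous_cvg => //; exact: continuous_ln.
  by apply: (cvgr_le _ lc); rewrite ltrDl.
apply: (filterS _ lncvg) => m /= hm.
by have [_ ->] := Hj m; rewrite /f /g -/(z m); lra.
Qed.

Let integral_f_le : (\int[mu]_(t in circ) (f t)%:E <= (2 * pi * (C - V))%:E)%E.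
Proof.
have pi2 : 0 < 2 * pi :> R by rewrite mulr_gt0// pi_gt0.
pose G m t : \bar R := (step m.+1 (g m.+1) t)%:E.
have G0 m t : circ t -> (0 <= G m t)%E.
  move=> ct; have [j _ E] := step_cell m.+1 t (ltn0Sn m) ct.
  by rewrite /G E lee_fin g_ge0.
have mG m : measurable_fun circ (G m).
  by apply/measurable_EFinP; exact: measurable_step.
have IG m : (\int[mu]_(t in circ) G m t = (2 * pi * (C - mean m.+1 (fun j =>
    ln (normc P.[polar (rho m.+1) (ang m.+1 * j%:R)]))))%:E)%E.
  rewrite /G integral_step//; last by move=> j; exact: g_ge0.
  by rewrite /g meanB mean_cst.
apply: (@le_trans _ _ (\int[mu]_(t in circ) limn_einf (G^~ t))%E).
  apply: ge0_le_integral => //=.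
  - by move=> t _; rewrite lee_fin.
  - by apply/measurable_EFinP; exact: measurable_funTS.
  - apply: (emeasurable_fun_cvg (fun m t => einfs (G^~ t) m)).
      by move=> m; exact: measurable_fun_einfs.
    by move=> t _; rewrite limn_einf_lim; exact: is_cvg_einfs.
  - move=> t ct; rewrite limn_einf_lim.
    apply/lee_addgt0Pr => e e0; rewrite -leeBlDr// -EFinB.
    apply: lime_ge; first exact: is_cvg_einfs.
    have := liminf_step t e ct e0 => -[M _ HM].
    exists M => // m /= Mm; apply: le_ereal_inf_tmp => _ [k /= mk <-].
    by rewrite lee_fin; apply: HM => /=; exact: leq_trans mk.
apply: (le_trans (fatou _ _ _ _)) => //; rewrite limn_einf_lim.
apply/lee_addgt0Pr => e e0.
apply: lime_le; first exact: is_cvg_einfs.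
have [N0 HN0] := sample_lower.
have small : \forall m \near \oo, 2 * pi * (n%:R * (ln 2 / m.+1%:R)) < e.
  have c : 2 * pi * (n%:R * (ln 2 / m.+1%:R)) @[m --> \oo] --> 2 * pi * (n%:R * (ln 2 * (0 : R))).
    by do ?[exact: cvg_cst | exact: cvg_harmonic | apply: cvgM].
  by apply: (cvgr_lt _ c); rewrite !mulr0.
near=> m.
apply: (@le_trans _ _ (\int[mu]_(t in circ) G m t)%E).
  by apply: ereal_inf_lbound; exists m => /=.
rewrite IG -EFinD lee_fin.
have [||lo _] := HN0 m.+1 => //.
  by apply: leqW; near: m; exact: nbhs_infty_ge.
have sm : 2 * pi * (n%:R * (ln 2 / m.+1%:R)) < e by near: m; exact: small.
apply: (@le_trans _ _ (2 * pi * (C - (V - n%:R * (ln 2 / m.+1%:R))))).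
  by rewrite ler_pM2l// lerD2l lerN2.
by rewrite opprB addrA addrAC mulrDr lerD2l ltW.
Unshelve. all: by end_near.
Qed.

Lemma ln_mahler_ge :
  ln (normc a) + \sum_(k < n) ln (Num.max 1 (normc (alpha k))) <= ln (mahler P).
Proof.
have pi2 : 0 < 2 * pi :> R by rewrite mulr_gt0// pi_gt0.
rewrite -/na -/V /mahler expRK ler_pdivlMl//.
have mfD (D : set R) : measurable_fun D f by exact: measurable_funTS.
have Ile : (\int[mu]_(t in `[0%R, (2 * pi)%R]) (f t)%:E <= (2 * pi * (C - V))%:E)%E.
  rewrite -integral_itv_bndo_bndc//; exact/measurable_EFinP.
have I0 : (0 <= \int[mu]_(t in `[0%R, (2 * pi)%R]) (f t)%:E)%E.
  by apply: integral_ge0 => t _; rewrite lee_fin.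
have intf : mu.-integrable `[0%R, (2 * pi)%R] (EFin \o f).
  apply/integrableP; split; first by apply/measurable_EFinP; exact: mfD.
  under eq_integral => t _ do rewrite /= ger0_norm ?f_ge0//.
  by rewrite (le_lt_trans Ile)// ltry.
have intC : mu.-integrable `[0%R, (2 * pi)%R] (EFin \o cst C).
  apply: measurable_bounded_integrable => //=.
    by rewrite lebesgue_measure_itv /= lte_fin pi2 -EFinB ltry.
  exact: bounded_cst.
have -> : \int[mu]_(t in `[0, 2 * pi]) ln (normc P.[expi t]) =
    \int[mu]_(t in `[0, 2 * pi]) (cst C t - f t).
  by apply: eq_Rintegral => t _; rewrite /f /cst subKr.
have IC : \int[mu]_(t in `[0, 2 * pi]) cst C t = C * (2 * pi).
  rewrite (Rintegral_cst mu (measurable_itv `[0, 2 * pi])); congr (_ * _).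
  by rewrite [X in fine X](lebesgue_measure_itv `[0, 2 * pi]) /= lte_fin pi2 /= subr0.
rewrite RintegralB// IC.
have fin : (\int[mu]_(t in `[0%R, (2 * pi)%R]) (f t)%:E)%E \is a fin_num.
  by rewrite ge0_fin_numE// (le_lt_trans Ile)// ltry.
have : \int[mu]_(t in `[0, 2 * pi]) f t <= 2 * pi * (C - V).
  by rewrite -lee_fin /Rintegral fineK.
by rewrite mulrBr [C * _]mulrC; lra.
Qed.

End jensen.

(** * The zero-counting measure against arclength *)

Section auxiliary.
Context {R : realType}.

Lemma exists_polar (z : R[i]) : exists theta : R, z = polar (normc z) theta.
Proof.
have [z0|z0] := eqVneq (normc z) 0.
  by exists 0; rewrite z0 (eq0_normc z0) /polar !mul0r.
have rho0 : 0 < normc z by rewrite lt_neqAle normc_ge0 eq_sym z0.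
case: z z0 rho0 => x y; set rho := normc _ => z0 rho0.
have E : (x / rho) ^+ 2 + (y / rho) ^+ 2 = 1.
  rewrite !expr_div_n -mulrDl -normc_sqr -/rho mulfV// expf_neq0//.
have c1 : -1 <= x / rho <= 1.
  rewrite -ler_norml -(@ler_pXn2r _ 2) ?nnegrE// real_normK ?num_real// expr1n -E lerDl sqr_ge0//.
have sE : Num.sqrt (1 - (x / rho) ^+ 2) = `|y / rho|.
  by rewrite -E [X in X - _]addrC addrK sqrtr_sqr.
have xE : x = rho * (x / rho) by rewrite mulrC divfK.
have yE : y = rho * (y / rho) by rewrite mulrC divfK.
have [s0|s0] := leP 0 (y / rho).
  exists (acos (x / rho)).
  by rewrite /polar acosK ?in_itv// sin_acos// sE ger0_norm// -xE -yE.
exists (- acos (x / rho)).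
by rewrite /polar cosN sinN acosK ?in_itv// sin_acos// sE ltr0_norm// opprK -xE -yE.
Qed.

Lemma sum_option (I : finType) (F : option I -> R) :
  \sum_x F x = F None + \sum_i F (Some i).
Proof.
rewrite (bigD1 None)//=; congr (_ + _).
rewrite (reindex_omap Some id) => [|[i|]]//.
by apply: eq_bigl => i; rewrite eqxx.
Qed.

Lemma ln55_ge : 15 / 4 <= ln (55 : R).
Proof.
rewrite -[leLHS](@expRK R) ler_ln ?posrE ?expR_gt0 ?ltr0n//.
(* [15/4 = (32 + 16 + 8 + 4) / 16], so repeated squaring of [exp (1/16) <= 16/15], rounded up at
   each step, bounds [exp (15/4)] by a rational below 55. *)
pose x : R := expR (16^-1).
have x0 : 0 <= x by exact: expR_ge0.
have x1 : x <= 16 / 15.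
  have /expR_le_inv : (16^-1 : R) < 1 by lra.
  move=> h; apply: (le_trans h); rewrite le_eqVlt; apply/orP; left; apply/eqP; by field.
have sq (y b d : R) : 0 <= y -> y <= b -> b ^+ 2 <= d -> y ^+ 2 <= d.
  by move=> y0 yb; apply: le_trans; rewrite lerXn2r ?nnegrE// (le_trans y0).
pose x2 := x ^+ 2; pose x4 := x2 ^+ 2; pose x8 := x4 ^+ 2.
pose x16 := x8 ^+ 2; pose x32 := x16 ^+ 2.
have h2 : x2 <= 57 / 50 by apply: (sq _ _ _ x0 x1); lra.
have h4 : x4 <= 13 / 10 by apply: (sq _ _ _ (sqr_ge0 _) h2); lra.
have h8 : x8 <= 169 / 100 by apply: (sq _ _ _ (sqr_ge0 _) h4); lra.
have h16 : x16 <= 143 / 50 by apply: (sq _ _ _ (sqr_ge0 _) h8); lra.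
have h32 : x32 <= 409 / 50 by apply: (sq _ _ _ (sqr_ge0 _) h16); lra.
have -> : expR (15 / 4) = (x32 * x16) * (x8 * x4).
  rewrite /x32 /x16 /x8 /x4 /x2 -!exprM -!exprD -expRM_natl; congr expR.
  by field.
have a1 : x32 * x16 <= 409 / 50 * (143 / 50) by apply: ler_pM; rewrite ?sqr_ge0.
have a2 : x8 * x4 <= 169 / 100 * (13 / 10) by apply: ler_pM; rewrite ?sqr_ge0.
have : (x32 * x16) * (x8 * x4) <= 409 / 50 * (143 / 50) * (169 / 100 * (13 / 10)).
  by apply: ler_pM => //; rewrite mulr_ge0 ?sqr_ge0.
move=> h; apply: (le_trans h); lra.
Qed.

Lemma le_of_geometric (x y k q : R) N : 0 <= q < 1 ->
  (forall M, (N <= M)%N -> x <= y + k * q ^+ M) -> x <= y.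
Proof.
move=> /andP[q0 q1] H.
have c : y + k * q ^+ M @[M --> \oo] --> y + k * 0.
  apply: cvgD; first exact: cvg_cst.
  apply: cvgM; first exact: cvg_cst.
  by apply: cvg_expr; rewrite ger0_norm.
rewrite -[y]addr0 -(mulr0 k) -(cvg_lim _ c)//.
apply: limr_ge; first by apply/cvg_ex; exists (y + k * 0).
by exists N.
Qed.

(** With [y = 1 / (2 n)], Bernoulli gives [1 - m y <= (1 - y)^m], and
    [(1 - y)^2 <= 1 / (1 + 2 y) = n / (n + 1)]. *)
Lemma fejer_le_geometric n m : (0 < n)%N -> (m < 2 * n)%N ->
  (1 - m%:R / (2 * n)%:R) ^+ 2 <= (n%:R / n.+1%:R) ^+ m :> R.
Proof.
move=> n0 mn; have nR : 0 < n%:R :> R by rewrite ltr0n.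
have n1 : 1 <= n%:R :> R by rewrite ler1n.
set y : R := (2 * n%:R)^-1.
have y0 : 0 < y by rewrite invr_gt0 mulr_gt0.
have y1 : y <= 2^-1 by rewrite /y lef_pV2 ?posrE ?mulr_gt0//; lra.
have bern : 1 - m%:R * y <= (1 - y) ^+ m.
  elim: m {mn} => [|m ih]; first by rewrite mul0r subr0.
  rewrite exprS; apply: (@le_trans _ _ ((1 - y) * (1 - m%:R * y))); last first.
    by rewrite ler_wpM2l//; lra.
  have : 0 <= m%:R * y ^+ 2 by rewrite mulr_ge0// sqr_ge0.
  by rewrite -[m.+1%:R]natr1; move: (m%:R) => w; lra.
have -> : 1 - m%:R / (2 * n)%:R = 1 - m%:R * y by rewrite natrM.
have b0 : 0 <= 1 - m%:R * y.
  by rewrite subr_ge0 /y ler_pdivrMr ?mulr_gt0// mul1r -natrM ler_nat ltnW.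
apply: (@le_trans _ _ (((1 - y) ^+ m) ^+ 2)).
  by rewrite lerXn2r ?nnegrE// exprn_ge0//; lra.
rewrite exprAC; apply: lerXn2r; rewrite ?nnegrE ?sqr_ge0 ?divr_ge0//.
rewrite ler_pdivlMr ?ltr0n// -[n.+1%:R]natr1.
have -> : n%:R = (2 * y)^-1 by rewrite /y; field; rewrite gt_eqF.
have y2 : 0 < 2 * y by rewrite mulr_gt0.
rewrite -(ler_pM2r y2).
have yn : y != 0 by rewrite gt_eqF.
rewrite mulVf ?mulf_neq0// (_ : _ * (2 * y) = (1 - y) ^+ 2 * (1 + 2 * y)); last by field.
have : 0 <= y ^+ 2 * (3 - 2 * y) by rewrite mulr_ge0 ?sqr_ge0//; lra.
lra.
Qed.

End auxiliary.

(** * Energy and discrepancy of the zeros *)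

Section equidistribution.
Context {R : realType} {A r : R} (A_gt0 : 0 < A) (r_gt0 : 0 < r) {phi : R[i] -> R}.
Context (phi_lip : forall z w : R[i], `|phi z - phi w| <= A * normc (z - w))
  (phi0 : forall z, r < normc z -> phi z = 0).
Context {n : nat} {p : {poly int}} {alpha : 'I_n -> R[i]} (n_gt1 : (1 < n)%N)
  (p_deg : size p = n.+1)
  (p_zeros : map_poly intr p =
     (lead_coef p)%:~R *: \prod_(k < n) ('X - (alpha k)%:P))
  (p_simple : injective alpha).

Let a : R := normc ((lead_coef p)%:~R : R[i]).
Let q : R := n%:R / n.+1%:R.
(** Equal to [1 - q], so that the circle replacing a root at the origin has self-energy
    [- ln (1 - q)], the damping cost of any other root. *)
Let delta : R := n.+1%:R^-1.
Let theta : 'I_n -> R := projT1 (choice (fun k => exists_polar (alpha k))).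

Let thetaE k : alpha k = polar (normc (alpha k)) (theta k).
Proof. exact: projT2 (choice (fun k => exists_polar (alpha k))) k. Qed.

(* [None] stands for the measure on the unit circle; a root at the origin is
   replaced by the circle of radius [delta]. *)
Let c (x : option 'I_n) : R := if x is Some _ then n%:R^-1 else - 1.
Let e (x : option 'I_n) : R :=
  if x is Some k then (if alpha k == 0 then 0 else 1) else 0.
Let u (x : option 'I_n) : R :=
  if x is Some k then (if alpha k == 0 then ln delta else ln (normc (alpha k)))
  else 0.
Let th (x : option 'I_n) : R := if x is Some k then theta k else 0.
Let v (x : option 'I_n) : R :=
  if x is Some k then phi (alpha k) else \int[arclength R]_z phi z.

Let nR_gt0 : 0 < n%:R :> R.
Proof. by rewrite ltr0n ltnW. Qed.

Let delta_gt0 : 0 < delta.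
Proof. by rewrite invr_gt0 ltr0n. Qed.

Let deltaE : 1 - q = delta.
Proof.
rewrite /q /delta -[n.+1%:R]natr1; field.
by rewrite natr1 pnatr_eq0.
Qed.

Let delta_lt1 : delta < 1.
Proof. by rewrite invf_lt1 ?ltr0n// ltr1n ltnS ltnW. Qed.

Let q01 : 0 <= q < 1.
Proof. by rewrite divr_ge0//= -subr_gt0 deltaE. Qed.

Let normc_gt0 (z : R[i]) : (0 < normc z) = (z != 0).
Proof. by rewrite lt_neqAle normc_ge0 andbT eq_sym normc_neq0. Qed.

Let eN0 k : alpha k != 0 -> e (Some k) = 1.
Proof. by move=> /negbTE ak; rewrite /e ak. Qed.

Let eps M : R := 2 * q ^+ M / (1 - q) ^+ 2.

Let eps_ge0 M : 0 <= eps M.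
Proof.
have /andP[q0 _] := q01.
by rewrite /eps divr_ge0 ?sqr_ge0// mulr_ge0 ?exprn_ge0.
Qed.

Let polar_u k : alpha k != 0 -> polar (expR (u (Some k))) (th (Some k)) = alpha k.
Proof.
move=> ak; rewrite /u (negbTE ak) /th lnK ?posrE ?normc_gt0// -thetaE//.
Qed.

Let kernel_diag M k : log_kernel e th q u M (Some k) (Some k) <=
  (if alpha k != 0 then - ln (normc (alpha k)) else 0) - ln delta + eps M.
Proof.
have [ak|ak] := eqVneq (alpha k) 0.
  rewrite log_kernel_flat; last by left; rewrite /e ak eqxx.
  by rewrite maxxx /u ak eqxx /= sub0r lerDl.
apply: (le_trans (log_kernel_diag e th q u M (Some k) (eN0 _ ak) q01)).
by rewrite -/(eps M) deltaE /u (negbTE ak) /=.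
Qed.

Let kernel_offdiag M j k : j != k -> log_kernel e th q u M (Some j) (Some k) <=
  - ln (normc (alpha j - alpha k)) + ln (2 / (1 + q)) + eps M.
Proof.
move=> jk; have /andP[q0 q1] := q01.
have ln_ge : 0 <= ln (2 / (1 + q)).
  by rewrite ln_ge0// ler_pdivlMr ?ltr_pwDl// mul1r; lra.
have ajk : alpha j != alpha k by apply: contraNneq jk => /p_simple ->.
(* The circle around the origin meets any other root through [- max (ln delta, ln |alpha k|)], which
   is at most minus the logarithm of the true distance. *)
have [aj|aj] := eqVneq (alpha j) 0.
  rewrite log_kernel_flat; last by left; rewrite /e aj eqxx.
  have ak : alpha k != 0 by rewrite -aj eq_sym.
  rewrite aj sub0r normcN -addrA -[leLHS]addr0 lerD ?addr_ge0//.
  by rewrite lerN2 le_max /u (negbTE ak) lexx orbT.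
have [ak|ak] := eqVneq (alpha k) 0.
  rewrite log_kernel_flat; last by right; rewrite /e ak eqxx.
  rewrite ak subr0 -addrA -[leLHS]addr0 lerD ?addr_ge0//.
  by rewrite lerN2 le_max /u (negbTE aj) lexx.
apply: (le_trans (log_kernel_offdiag e th q u M _ _ (eN0 _ aj) (eN0 _ ak) q01 _)).
  by rewrite !polar_u.
by rewrite !polar_u.
Qed.

Let kernel_circle M (x : option 'I_n) :
  log_kernel e th q u M None x = - Num.max 0 (u x) /\
  log_kernel e th q u M x None = - Num.max 0 (u x).
Proof.
split; first by rewrite log_kernel_flat//; left.
by rewrite log_kernel_flat; [rewrite maxC|right].
Qed.

Let max_u k : Num.max 0 (u (Some k)) = ln (Num.max 1 (normc (alpha k))).
Proof.
rewrite /u; have [->|ak] := eqVneq (alpha k) 0.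
  rewrite normc0 (max_idPl (ler01 : 0 <= 1 :> R)) ln1.
  by apply/max_idPl; rewrite ln_le0// ltW.
have [a1|a1] := leP (normc (alpha k)) 1.
  by rewrite ln1; apply/max_idPl; rewrite ln_le0.
by apply/max_idPr; rewrite ln_ge0// ltW.
Qed.

Let ln_prod (I : finType) (P : pred I) (F : I -> R) : (forall i, P i -> 0 < F i) ->
  ln (\prod_(i | P i) F i) = \sum_(i | P i) ln (F i).
Proof.
move=> F0; suff [] : 0 < \prod_(i | P i) F i /\
  ln (\prod_(i | P i) F i) = \sum_(i | P i) ln (F i) by [].
elim/big_rec2 : _ => [|i y x Pi [x0 xE]]; first by rewrite ln1.
by rewrite mulr_gt0 ?F0// lnM ?posrE ?F0// xE.
Qed.

Let a_ge1 : 1 <= a.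
Proof. exact: lead_coef_normc_ge1 p_deg. Qed.

Let a_gt0 : 0 < a.
Proof. exact: lt_le_trans ltr01 a_ge1. Qed.

Let sum_ln_dist : - \sum_(k < n) \sum_(j < n | j != k) ln (normc (alpha k - alpha j)) <=
  (2 * n%:R - 1) * ln a.
Proof.
have pos k j : j != k -> 0 < normc (alpha k - alpha j).
  move=> jk; rewrite normc_gt0 subr_eq0; apply: contraNneq jk => /p_simple ->//.
have := discriminant_ge1 p_deg p_zeros p_simple (ltnW n_gt1).
have P0 : 0 < \prod_(k < n) \prod_(j < n | j != k) normc (alpha k - alpha j).
  by apply: prodr_gt0 => k _; apply: prodr_gt0 => j; exact: pos.
rewrite -/a -ler_ln ?posrE// ?mulr_gt0 ?exprn_gt0// ln1 lnM ?posrE ?exprn_gt0// lnXn//.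
rewrite ln_prod; last by move=> k _; apply: prodr_gt0 => j; exact: pos.
rewrite (eq_bigr (fun k => \sum_(j < n | j != k) ln (normc (alpha k - alpha j)))); last first.
  by move=> k _; rewrite ln_prod// => j; exact: pos.
rewrite -[ln a *+ _]mulr_natl natrB ?muln_gt0 ?(ltnW n_gt1)// natrM; lra.
Qed.

Let sum_ln_roots : - \sum_(k < n | alpha k != 0) ln (normc (alpha k)) <= ln a.
Proof.
have P0 : 0 < \prod_(k < n | alpha k != 0) normc (alpha k).
  by apply: prodr_gt0 => k; rewrite normc_gt0.
have := prod_nonzero_roots_ge1 p_deg p_zeros p_simple.
rewrite -/a -ler_ln ?posrE// ?mulr_gt0// ln1 lnM ?posrE//.
rewrite ln_prod; last by move=> k; rewrite normc_gt0.
lra.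
Qed.

Lemma energy_upper M : energy c e th q u M <=
  n%:R^-1 * (2 * ln (mahler (map_poly intr p)) + ln n.+1%:R) + ln (2 / (1 + q)) + eps M.
Proof.
have aN : (lead_coef p)%:~R != 0 :> R[i] by rewrite -normc_gt0.
have mah := ln_mahler_ge aN p_zeros; rewrite -/a in mah.
set m := \sum_(k < n) ln (Num.max 1 (normc (alpha k))) in mah.
have n0 : n%:R != 0 :> R by rewrite gt_eqF.
have lg : 0 <= ln (2 / (1 + q)).
  by have /andP[q0 q1] := q01; rewrite ln_ge0// ler_pdivlMr ?ltr_pwDl// mul1r; lra.
rewrite /energy sum_option sum_option /c.
under eq_bigr => k _ do rewrite (kernel_circle M _).1 max_u.
under [X in _ + X]eq_bigr => k _.
  rewrite sum_option (kernel_circle M _).2 max_u; over.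
rewrite (kernel_circle M None).1 maxxx oppr0 mulr0 add0r big_split /=.
have -> : \sum_(k < n) -1 / n%:R * - ln (Num.max 1 (normc (alpha k))) = n%:R^-1 * m.
  by rewrite mulr_sumr; apply: eq_bigr => k _; ring.
have -> : \sum_(k < n) n%:R^-1 * -1 * - ln (Num.max 1 (normc (alpha k))) = n%:R^-1 * m.
  by rewrite mulr_sumr; apply: eq_bigr => k _; ring.
have dl : - ln delta = ln n.+1%:R by rewrite /delta lnV ?posrE ?ltr0n// opprK.
pose B j k := if j == k then (if alpha k != 0 then - ln (normc (alpha k)) else 0) - ln delta + eps M
   else - ln (normc (alpha j - alpha k)) + ln (2 / (1 + q)) + eps M.
have kB j k : log_kernel e th q u M (Some j) (Some k) <= B j k.
  by rewrite /B; case: eqVneq => [->|jk]; [exact: kernel_diag|exact: kernel_offdiag].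
(* The discriminant brings [(2 n - 1) ln a] and the product of the nonzero roots one more [ln a].
   Divided by [n^2], they combine with the interaction of the roots with the unit circle into
   [2 / n] times Jensen's lower bound for [ln M]. *)
have sumB : \sum_(j < n) \sum_(k < n) B j k <=
   2 * n%:R * ln a + n%:R * ln n.+1%:R + n%:R ^+ 2 * (ln (2 / (1 + q)) + eps M).
  have row j : \sum_(k < n) B j k <=
      (if alpha j != 0 then - ln (normc (alpha j)) else 0) - ln delta -
      \sum_(k < n | k != j) ln (normc (alpha j - alpha k)) +
      n%:R * (ln (2 / (1 + q)) + eps M).
    rewrite (bigD1 j)//= {1}/B eqxx.
    have -> : \sum_(k < n | k != j) B j k = - \sum_(k < n | k != j) ln (normc (alpha j - alpha k)) +
        \sum_(k < n | k != j) (ln (2 / (1 + q)) + eps M).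
      rewrite -sumrN -big_split; apply: eq_bigr => k kj /=.
      by rewrite /B eq_sym (negbTE kj) addrA.
    have -> : n%:R * (ln (2 / (1 + q)) + eps M) = (ln (2 / (1 + q)) + eps M) +
        \sum_(k < n | k != j) (ln (2 / (1 + q)) + eps M).
      by rewrite mulr_natl -[in LHS](card_ord n) -sumr_const (bigD1 j).
    move: (\sum_(k < n | k != j) (ln _ + _)) (\sum_(k < n | k != j) ln _) => w1 w2.
    by move: (if _ then _ else _) => w3; lra.
  apply: (le_trans (ler_sum _ (fun j _ => row j))).
  rewrite !big_split /=.
  have -> : \sum_(j < n) (if alpha j != 0 then - ln (normc (alpha j)) else 0) =
      - \sum_(k < n | alpha k != 0) ln (normc (alpha k)) by rewrite -sumrN -big_mkcond.
  rewrite !sumr_const card_ord dl -[ln _ *+ n]mulr_natl -[n%:R * _ *+ n]mulr_natl sumrN.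
  have := sum_ln_roots; have := sum_ln_dist.
  move: (\sum_(k < n) \sum_(j < n | j != k) _) (\sum_(k < n | alpha k != 0) _) => w1 w2.
  by move=> h1 h2; lra.
have sumk : \sum_(j < n) \sum_(k < n) n%:R^-1 / n%:R * log_kernel e th q u M (Some j) (Some k) <=
   n%:R^-1 ^+ 2 * \sum_(j < n) \sum_(k < n) B j k.
  rewrite mulr_sumr; apply: ler_sum => j _; rewrite mulr_sumr; apply: ler_sum => k _.
  by rewrite expr2 ler_wpM2l// mulr_ge0// invr_ge0.
have n2 : 0 <= n%:R^-1 ^+ 2 :> R by exact: sqr_ge0.
have := le_trans sumk (ler_wpM2l n2 sumB).
rewrite (_ : n%:R^-1 ^+ 2 * (2 * n%:R * ln a + n%:R * ln n.+1%:R + n%:R ^+ 2 * (ln (2 / (1 + q)) + eps M)) =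
  n%:R^-1 * (2 * ln a + ln n.+1%:R) + (ln (2 / (1 + q)) + eps M)); last by field.
have : n%:R^-1 * (2 * (ln a + m)) <= n%:R^-1 * (2 * ln (mahler (map_poly intr p))).
  by rewrite ler_pM2l ?invr_gt0// ler_pM2l.
rewrite !mulrDr; move: (\sum_(j < n) _) => w; lra.
Qed.

Let err (x : option 'I_n) : R := if x is Some k then
  (if alpha k == 0 then A * delta else A * r * Num.sqrt (2 / (2 * n)%:R)) else 0.
(** For the unit circle, rounding the radius costs [17/10 A] and the Riemann sum [A], together below
    [3 A]. *)
Let Cst (x : option 'I_n) : R := if x is Some k then
  (if alpha k == 0 then 0 else 2 * A * normc (alpha k)) else 3 * A.

Let mean_dist N rho z B : (0 < N)%N ->
  (forall x, normc (polar rho x - z x) <= B) ->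
  `|mean N (fun j => phi (polar rho (ang N * j%:R))) -
    mean N (fun j => phi (z (ang N * j%:R)))| <= A * B.
Proof.
move=> N0 zB; rewrite -meanB; apply: (le_trans (ler_norm_mean _ _)).
rewrite -[leRHS](mean_cst N)//; apply: ler_mean => j.
by apply: (le_trans (phi_lip _ _)); rewrite ler_pM2l.
Qed.

Let circle_mean k N rho : e k = 0 -> (0 < N)%N ->
  expR (u k - 17 / 10 * ang N) <= rho <= expR (u k) ->
  `|mean N (fun j => phi (polar rho (ang N * j%:R))) - v k| <= err k + Cst k * ang N.
Proof.
move=> ek N0 /andP[rho1 rho2].
have rho0 : 0 < rho := lt_le_trans (expR_gt0 _) rho1.
have an0 : 0 < (ang N : R) := ang_gt0 _ N0.
case: k ek rho1 rho2 => [k|] ek rho1 rho2.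
  have ak : alpha k = 0.
    by apply/eqP; apply: contra_eqT ek => ak; rewrite eN0// oner_eq0.
  rewrite /err /Cst /v ak eqxx mul0r addr0 -[phi 0](mean_cst N)//.
  apply: (mean_dist N rho (fun=> 0)) => // x.
  rewrite subr0 normc_polar ?(ltW rho0)//.
  by move: rho2; rewrite /u ak eqxx lnK.
rewrite /err /Cst /v add0r.
have dist : `|mean N (fun j => phi (polar rho (ang N * j%:R))) -
    mean N (fun j => phi (polar 1 (ang N * j%:R)))| <= A * (17 / 10 * ang N).
  apply: mean_dist => // x.
  rewrite /u sub0r expR0 in rho1 rho2.
  have rho3 : 0 <= 1 - rho by rewrite subr_ge0.
  apply: (@le_trans _ _ (1 - rho)).
    rewrite -(@ler_pXn2r _ 2) ?nnegrE ?normc_ge0// dist_polar subrr cos0.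
    by rewrite le_eqVlt; apply/orP; left; apply/eqP; ring.
  have := le_trans (expR_ge1Dx _) rho1; lra.
have arc := arclength_riemann A_gt0 r_gt0 phi_lip phi0 N N0.
rewrite distrC in arc.
apply: (le_trans (ler_distD (mean N (fun j => phi (polar 1 (ang N * j%:R)))) _ _)).
apply: (le_trans (lerD dist arc)).
have : 0 <= A * ang N by rewrite mulr_ge0 ?ltW.
lra.
Qed.

Lemma discrepancy_le sg t : `|sg| = 1 -> 0 < t ->
  sg * (n%:R^-1 * (\sum_(k < n) phi (alpha k)) - \int[arclength R]_z phi z) <=
  A * r * Num.sqrt (n%:R^-1) + A * delta +
  (t * (200 / 289 * (A ^+ 2 * r ^+ 2)) + t^-1 *
    (n%:R^-1 * (2 * ln (mahler (map_poly intr p)) + ln n.+1%:R) + ln (2 / (1 + q)))) / 2.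
Proof.
move=> sg1 t0; apply: (@le_of_geometric _ _ _ (t^-1 / (1 - q) ^+ 2) q (2 * n) q01) => M HM.
(* Changing the sign of all charges preserves the energy, so both signs of the discrepancy obey the
   same bound. *)
pose cs x := sg * c x.
have n0 : n%:R != 0 :> R by rewrite gt_eqF.
have H1 : (1 < 2 * n)%N by rewrite mul2n -addnn ltn_addl.
have q01' : 0 <= q <= 1 by have /andP[-> /ltW] := q01.
have kapq m : (m < 2 * n)%N -> (1 - m%:R / (2 * n)%:R) ^+ 2 <= q ^+ m.
  exact: fejer_le_geometric (ltnW n_gt1).
have c_sum : \sum_x cs x = 0.
  rewrite -mulr_sumr sum_option /c sumr_const card_ord -[_ *+ n]mulr_natl mulfV//.
  by rewrite addNr mulr0.
have e01 k : e k = 0 \/ e k = 1.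
  by case: k => [k|] /=; [rewrite /e; case: ifP; [left|right]|left].
have v1 k : e k = 1 -> [/\ v k = phi (polar (expR (u k)) (th k)),
    A * r * Num.sqrt (2 / (2 * n)%:R) <= err k & 2 * A * expR (u k) <= Cst k].
  case: k => [k|]; rewrite /e; last by move/eqP; rewrite eq_sym oner_eq0.
  case: ifPn => [_ /eqP|ak _]; first by rewrite eq_sym oner_eq0.
  rewrite polar_u// /err /Cst /u (negbTE ak) lnK ?posrE ?normc_gt0//.
have := energy_bound_amgm A_gt0 r_gt0 phi_lip phi0 H1 q01' kapq c_sum e01 v1 circle_mean M t t0 HM.
have -> : energy cs e th q u M = energy c e th q u M.
  apply: eq_bigr => j _; apply: eq_bigr => k _; congr (_ * _); rewrite /cs mulrACA.
  by rewrite -expr2 -(real_normK (num_real sg)) sg1 expr1n mul1r.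
have -> : \sum_k cs k * v k =
    sg * (n%:R^-1 * (\sum_(k < n) phi (alpha k)) - \int[arclength R]_z phi z).
  under eq_bigr => k _ do rewrite /cs -mulrA.
  by rewrite -mulr_sumr sum_option /c /v mulN1r mulr_sumr addrC.
move=> h; apply: (le_trans h).
have errS : \sum_k `|cs k| * err k <= A * r * Num.sqrt (n%:R^-1) + A * delta.
  have sq : 2 / (2 * n)%:R = n%:R^-1 :> R by rewrite natrM; field.
  rewrite /cs; under eq_bigr => k _ do rewrite normrM sg1 mul1r.
  rewrite sum_option /err mulr0 add0r sq.
  apply: (@le_trans _ _ (\sum_(k < n) n%:R^-1 * (A * r * Num.sqrt (n%:R^-1) + A * delta))).
    apply: ler_sum => k _; rewrite /c ger0_norm ?invr_ge0// ler_pM2l ?invr_gt0//.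
    have x1 : 0 <= A * r * Num.sqrt (n%:R^-1) by rewrite !mulr_ge0 ?sqrtr_ge0// ltW.
    have x2 : 0 <= A * delta by rewrite mulr_ge0// ltW.
    by case: ifP => _; rewrite ?lerDl ?lerDr.
  by rewrite sumr_const card_ord -[_ *+ n]mulr_natl mulrA mulfV// mul1r.
rewrite -addrA; apply: lerD => //.
have t1 : 0 < t^-1 by rewrite invr_gt0.
have h' := energy_upper M; rewrite -(ler_pM2l t1) in h'; move: h'.
set z := n%:R^-1 * (2 * ln _ + ln _) + ln _.
have -> : t^-1 * (z + eps M) = t^-1 * z + 2 * (t^-1 / (1 - q) ^+ 2 * q ^+ M).
  by rewrite /eps; ring.
by lra.
Qed.

End equidistribution.

(** * Numerical constants and conclusion *)

Lemma energy_term_le (R : realType) (n : nat) (m L : R) : (55 <= n)%N ->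
  15 / 4 <= L -> ln n%:R <= L -> m <= L ->
  n%:R^-1 * (2 * m + ln n.+1%:R) + ln (2 / (1 + n%:R / n.+1%:R)) <=
  157 / 50 * (n%:R^-1 * L).
Proof.
move=> n55 L1 nL mL; have n1 : 55 <= n%:R :> R by rewrite ler_nat.
have n0 : 0 < n%:R :> R by apply: lt_le_trans n1; rewrite ltr0n.
have ninv : n%:R^-1 <= 55^-1 :> R by rewrite lef_pV2 ?posrE//; lra.
have ni0 : 0 < n%:R^-1 :> R by rewrite invr_gt0.
have l1 : ln n.+1%:R <= ln n%:R + n%:R^-1 :> R.
  rewrite -[n.+1%:R]natr1 (_ : n%:R + 1 = n%:R * (1 + n%:R^-1)); last first.
    by rewrite mulrDr mulr1 mulfV// gt_eqF.
  by rewrite lnM ?posrE ?addr_gt0// lerD2l le_ln1Dx// (lt_trans (ltrN10 _) ni0).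
have l2 : ln (2 / (1 + n%:R / n.+1%:R)) <= n%:R^-1 / 2 :> R.
  have x0 : 0 < (2 * n%:R + 1)^-1 :> R by rewrite invr_gt0 addr_gt0// mulr_gt0.
  rewrite -[n.+1%:R]natr1 (_ : 2 / _ = 1 + (2 * n%:R + 1)^-1); last first.
    by field; rewrite !gt_eqF// ?addr_gt0 ?mulr_gt0//; lra.
  have x1 : -1 < (2 * n%:R + 1)^-1 :> R by exact: lt_trans (ltrN10 _) x0.
  apply: (le_trans (le_ln1Dx x1)).
  rewrite -invfM lef_pV2 ?posrE ?mulr_gt0 ?addr_gt0 ?mulr_gt0//; lra.
(* The logarithms amount to [3 L]; the spare [7/50 L >= 21/40] absorbs [1/55 + 1/2]. *)
apply: (@le_trans _ _ (n%:R^-1 * (2 * L + (L + 55^-1)) + n%:R^-1 / 2)).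
  by apply: lerD => //; rewrite ler_pM2l//; lra.
rewrite [leRHS](_ : _ = n%:R^-1 * (157 / 50 * L)); last by ring.
by rewrite -mulrDr ler_pM2l//; lra.
Qed.

(* [t = 32 s / (15 A r)] nearly balances the two terms. *)
Lemma balance (R : realType) (A r s E : R) : 0 < A -> 0 < r -> 0 < s ->
  E <= 157 / 50 * s ^+ 2 ->
  (32 / 15 * s / (A * r) * (200 / 289 * (A ^+ 2 * r ^+ 2)) +
   (32 / 15 * s / (A * r))^-1 * E) / 2 <= 37 / 25 * (A * r * s).
Proof.
move=> A0 r0 s0 Es; have Ar : 0 < A * r by rewrite mulr_gt0.
have t0 : 0 < (32 / 15 * s / (A * r))^-1 by rewrite invr_gt0 divr_gt0// mulr_gt0.
have AN : A != 0 by rewrite gt_eqF.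
have rN : r != 0 by rewrite gt_eqF.
have sN : s != 0 by rewrite gt_eqF.
have := ler_wpM2l (ltW t0) Es.
rewrite (_ : _ * (157 / 50 * s ^+ 2) = 157 / 50 * 15 / 32 * (A * r * s)); last first.
  by field; rewrite AN rN sN.
rewrite (_ : 32 / 15 * s / (A * r) * (200 / 289 * (A ^+ 2 * r ^+ 2)) =
  32 / 15 * 200 / 289 * (A * r * s)); last by field; rewrite AN rN.
have : 0 < A * r * s by rewrite mulr_gt0.
move: (A * r * s) (_^-1 * E) => w z; lra.
Qed.

Theorem theorem1p5 (R : realType) (A r : R) (A_gt0 : 0 < A) (r_gt0 : 0 < r)
    (phi : R[i] -> R)
    (phi_lip : forall z t : R[i], `|phi z - phi t| <= A * normc (z - t))
    (phi_supp : supp phi `<=` [set z | normc z <= r])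
    (n : nat) (p : {poly int}) (alpha : 'I_n -> R[i])
    (p_deg : size p = n.+1)
    (p_zeros : map_poly intr p =
               (lead_coef p)%:~R *: \prod_(k < n) ('X - (alpha k)%:P))
    (p_simple : injective alpha)
    (n_ge55 : (55 <= n)%N) :
  `|n%:R^-1 * (\sum_(k < n) phi (alpha k))
      - \int[arclength R]_z phi z|
  <= A * (2 * r + 1) *
     Num.sqrt (ln (Num.max n%:R (mahler (map_poly intr p))) / n%:R).
Proof.
have phi0 z : r < normc z -> phi z = 0.
  move=> rz; apply/eqP; apply: contraTT rz => z0; rewrite -leNgt.
  by apply: phi_supp; exact: subset_closure.
have n_gt1 : (1 < n)%N by exact: leq_trans n_ge55.
have n0 : 0 < n%:R :> R by rewrite ltr0n ltnW.
have n0' : 0 < n%:R^-1 :> R by rewrite invr_gt0.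
have m0 : 0 < mahler (map_poly intr p : {poly R[i]}) by exact: expR_gt0.
set m := mahler _ in m0 *.
have nx : n%:R <= Num.max n%:R m by rewrite le_max lexx.
have x0 : 0 < Num.max n%:R m by exact: lt_le_trans nx.
set L := ln _; set s := Num.sqrt _.
have L_ge : 15 / 4 <= L.
  apply: (le_trans (@ln55_ge R)); rewrite ler_ln ?posrE ?ltr0n//.
  by apply: le_trans nx; rewrite ler_nat.
have L_gt0 : 0 < L by apply: lt_le_trans L_ge; rewrite divr_gt0.
have s2 : s ^+ 2 = n%:R^-1 * L by rewrite [RHS]mulrC sqr_sqrtr// divr_ge0// ltW.
have s0 : 0 < s by rewrite sqrtr_gt0 divr_gt0.
have energy_le := energy_term_le R n (ln m) L n_ge55 L_ge.
have : n%:R^-1 * (2 * ln m + ln n.+1%:R) + ln (2 / (1 + n%:R / n.+1%:R)) <= 157 / 50 * s ^+ 2.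
  by rewrite s2; apply: energy_le; rewrite ler_ln ?posrE// le_max lexx orbT.
move=> /(balance _ _ _ _ _ A_gt0 r_gt0 s0).
set t := 32 / 15 * s / (A * r) => bal.
have t0 : 0 < t by rewrite !divr_gt0 ?mulr_gt0.
(* Amounts to [(13/25)^2 L >= 1], true because [L >= 15/4 > 625/169]. *)
have root_le : Num.sqrt n%:R^-1 <= 13 / 25 * s.
  rewrite -(@ler_pXn2r _ 2) ?nnegrE ?sqrtr_ge0 ?mulr_ge0 ?(ltW s0)//.
  rewrite sqr_sqrtr ?(ltW n0')// exprMn s2 mulrCA ler_pMr//; lra.
have delta_le : n.+1%:R^-1 <= s.
  apply: (@le_trans _ _ n%:R^-1).
    by rewrite lef_pV2 ?posrE// ler_nat.
  rewrite -(@ler_pXn2r _ 2) ?nnegrE ?(ltW s0) ?(ltW n0')//.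
  rewrite s2 expr2 ler_pM2l//; apply: (@le_trans _ _ 1); last by lra.
  by rewrite invf_le1// ler1n ltnW.
have main sg : `|sg| = 1 -> sg * (n%:R^-1 * (\sum_(k < n) phi (alpha k)) -
    \int[arclength R]_z phi z) <= A * (2 * r + 1) * s.
  move=> sg1; have := discrepancy_le A_gt0 r_gt0 phi_lip phi0 n_gt1 p_deg p_zeros p_simple sg t sg1 t0.
  move=> /le_trans; apply; apply: le_trans (lerD (lexx _) bal) _.
  have Ar : 0 < A * r by rewrite mulr_gt0.
  have h1 : A * r * Num.sqrt n%:R^-1 <= A * r * (13 / 25 * s) by rewrite ler_pM2l.
  have h2 : A * n.+1%:R^-1 <= A * s by rewrite ler_pM2l.
  (* [13/25 + 37/25 = 2] is the coefficient of [A r s]; the term from [delta] supplies the last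
     [A s]. *)
  apply: le_trans (lerD (lerD h1 h2) (lexx _)) _; lra.
have := main 1 (normr1 _); have := main (-1) (normrN1 _).
by rewrite mulN1r mul1r => h1 h2; rewrite ler_norml lerNl h1 h2.
Qed.
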